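(* There exist absolute constants $C, c > 0$ such that the following holds. Let $0<s<d$, $0<\nu\le L$, let $f\in\mathcal{F}_{L,\nu,d}\cap CG_{s,d}$, and let $\mathcal{C}_f(\cdot,\cdot)$ be a polynomial comparison oracle for $f$ with $\kappa=1$ and $0<\delta_0<\mu\le 0.5$. Choose any initial point $\mathbf{x}_0\in\mathbb{R}^d$, any step size $\alpha>0$ and any target gradient accuracy $0<\eta<\nu/(2L)$. Let $\Delta_0=\|\mathbf{x}_0-\mathrm{P}_\star(\mathbf{x}_0)\|_2$ and $\rho^\star=\dfrac{1-\eta^2}{\frac{\nu}{2L}-\eta}$. Choose $$K=\frac{(\Delta_0-\alpha\eta)^3}{(\alpha\rho^\star)^2\left(\frac{\alpha\nu}{2L}-\alpha\eta\right)},\qquad m=\frac{C}{\eta^4\delta_0^2}\,s\log(2d/s),\qquad r=\frac{\alpha\nu\rho^\star}{2L\sqrt d},$$ where $m$ and $K$ are rounded up to integers (and $K=0$ if the expression is negative). Then SCOBO with inputs $\mathbf{x}_0,s,m,r,K$ and fixed step size $\alpha_k=\alpha$ for all $k$ returns $\mathbf{x}_K$ satisfying $$f(\mathbf{x}_K)-f^\star\le\frac{L}{2}\alpha^2(1+\rho^\star)^2$$ using $mK$ oracle queries, with probability at least $1-8K\exp\left(-c\eta^4 s\log(2d/s)\right)$.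
   Context: Function classes. $CG_{s,d}$ is the set of all (differentiable) $f:\mathbb{R}^d\to\mathbb{R}$ with $\|\nabla f(\mathbf{x})\|_1\le\sqrt{s}\,\|\nabla f(\mathbf{x})\|_2$ for all $\mathbf{x}\in\mathbb{R}^d$. For $0<\nu\le L$, $\mathcal{F}_{L,\nu,d}$ is the set of all $f:\mathbb{R}^d\to\mathbb{R}$ that are twice continuously differentiable, convex, $L$-Lipschitz differentiable ($\|\nabla f(\mathbf{x})-\nabla f(\mathbf{y})\|_2\le L\|\mathbf{x}-\mathbf{y}\|_2$ for all $\mathbf{x},\mathbf{y}$), and $\nu$-restricted-strongly convex: $f(\mathbf{x})-f^\star\ge\frac{\nu}{2}\|\mathbf{x}-\mathrm{P}_\star(\mathbf{x})\|_2^2$ for all $\mathbf{x}\in\mathbb{R}^d$. Here $f^\star=\min_{\mathbf{x}\in\mathbb{R}^d}f(\mathbf{x})$ (assumed attained), $\mathcal{X}=\arg\min f$ is the (nonempty, closed, convex) solution set, and $\mathrm{P}_\star(\mathbf{x})=\arg\min_{\mathbf{z}\in\mathcal{X}}\|\mathbf{x}-\mathbf{z}\|_2$ is the projection onto it. Oracle. A polynomial comparison oracle for $f$ with parameters $0<\delta_0\le 1/2$, $\mu>0$, $\kappa\ge1$ returns, for each query $(\mathbf{x},\mathbf{y})$, a random value $\mathcal{C}_f(\mathbf{x},\mathbf{y})\in\{-1,+1\}$ with $$\mathbb{P}\left[\mathcal{C}_f(\mathbf{x},\mathbf{y})=\mathrm{sign}(f(\mathbf{y})-f(\mathbf{x}))\right]\ge\tfrac12+\min\{\delta_0,\mu|f(\mathbf{y})-f(\mathbf{x})|^{\kappa-1}\}.$$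 Signs are regarded as taking values in $\{-1,+1\}$ (with a fixed convention for $\mathrm{sign}(0)$). For $\kappa=1$ and $\delta_0<\mu$ this lower bound is $\frac12+\delta_0$, and the oracle is understood to be correct with a constant probability not depending on the points queried. The randomness of the oracle is independent across queries and independent of all other random choices. Algorithm 1BitGradEst$(\mathbf{x},s,m,r)$. Draw $\mathbf{z}_1,\dots,\mathbf{z}_m$ independently and uniformly from the unit sphere $\mathbb{S}^{d-1}\subset\mathbb{R}^d$; query $y_i=\mathcal{C}_f(\mathbf{x},\mathbf{x}+r\mathbf{z}_i)$ for $i=1,\dots,m$; output $$\hat{\mathbf{g}}\in\arg\max\Big\{\sum_{i=1}^m y_i\mathbf{z}_i^\top\mathbf{g}' : \|\mathbf{g}'\|_1\le\sqrt{s},\ \|\mathbf{g}'\|_2\le1\Big\}.$$ Algorithm SCOBO (inputs $\mathbf{x}_0,s,m,r,K$ and step sizes $\alpha_k$). For $k=0,\dots,K-1$: set $\hat{\mathbf{g}}_k=$ 1BitGradEst$(\mathbf{x}_k,s,m,r)$ (with fresh independent randomness) and $\mathbf{x}_{k+1}=\mathbf{x}_k-\alpha_k\hat{\mathbf{g}}_k$. Output $\mathbf{x}_K$. *)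

(* Defs.v *)
From HB Require Import structures.
From mathcomp Require Import all_boot all_order all_algebra.
From mathcomp Require Import all_classical all_reals all_analysis.
Import Order.TTheory GRing.Theory Num.Theory.
Import numFieldNormedType.Exports.

Set Implicit Arguments.
Unset Strict Implicit.
Unset Printing Implicit Defensive.

Local Open Scope classical_set_scope.
Local Open Scope ring_scope.

Section Euclidean.
Context {R : realType} {d : nat}.
Implicit Types (x y : 'rV[R]_d) (f : 'rV[R]_d -> R).

Definition dotv x y : R := \sum_(i < d) x 0 i * y 0 i.

(* The canonical norm of 'rV[R]_d in the library is the sup norm, so the l1 and
   l2 norms are defined here. All three induce the same topology, hence the same
   notions of continuity and differentiability. *)
Definition norm1 x : R := \sum_(i < d) `|x 0 i|.
Definition norm2 x : R := Num.sqrt (dotv x x).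

Definition grad f x : 'rV[R]_d := \row_(i < d) 'D_(delta_mx 0 i) f x.

Definition twice_cont_differentiable f : Prop :=
  [/\ forall x, differentiable f x,
      forall x, differentiable (grad f) x
    & continuous (fun x => jacobian (grad f) x)].

Definition argmin f : set 'rV[R]_d := [set x | forall y, f x <= f y].

(* This is the minimum of f as soon as argmin f is nonempty. *)
Definition minval f : R := inf (range f).

(* [xget 0] selects the nearest point of argmin f; it exists and is unique when
   argmin f is nonempty, closed and convex. *)
Definition proj_argmin f x : 'rV[R]_d :=
  xget 0 [set z | argmin f z /\
                  forall w, argmin f w -> norm2 (x - z) <= norm2 (x - w)].

End Euclidean.

Definition CG (R : realType) (s : R) (d : nat) : set ('rV[R]_d -> R) :=
  [set f | forall x, differentiable f x /\
     norm1 (grad f x) <= Num.sqrt s * norm2 (grad f x)].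
Arguments CG {R} s d _.

Record in_F (R : realType) (L nu : R) (d : nat) (f : 'rV[R]_d -> R) : Prop := {
  F_C2 : twice_cont_differentiable f ;
  F_convex : convex_function [set: convex_lmodType 'rV[R]_d] f ;
  F_Lipschitz_grad : forall x y,
    norm2 (grad f x - grad f y) <= L * norm2 (x - y) ;
  F_min_attained : argmin f !=set0 ;
  F_restricted_strongly_convex : forall x,
    nu / 2 * norm2 (x - proj_argmin f x) ^+ 2 <= f x - minval f }.

Definition F_class (R : realType) (L nu : R) (d : nat) :
  set ('rV[R]_d -> R) := [set f | in_F L nu f].
Arguments F_class {R} L nu d _.

(* R^d with its Borel sigma-algebra. *)
Definition borel_rV (R : realType) (d : nat) :=
  g_sigma_algebraType (@open 'rV[R]_d).

Definition sigma_of {dO dT} {Omega : measurableType dO} {T : measurableType dT}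
    (X : Omega -> T) : set (set Omega) :=
  preimage_set_system setT X measurable.

Definition mutually_independent {dO} {Omega : measurableType dO} {R : realType}
    (P : probability Omega R) (I : finType) (F : I -> set (set Omega)) : Prop :=
  forall (J : {set I}) (E : I -> set Omega),
    (forall i, i \in J -> F i (E i)) ->
    P (\big[setI/setT]_(i in J) E i) = (\prod_(i in J) P (E i))%E.

(* The uniform distribution on the unit sphere is the unique Borel probability
   measure carried by the sphere and invariant under all orthogonal maps. *)
Definition uniform_on_sphere {dO} {Omega : measurableType dO} {R : realType}
    (P : probability Omega R) {d : nat} (Z : Omega -> borel_rV R d) : Prop :=
  [/\ measurable_fun setT Z,
      P [set w | norm2 (Z w : 'rV[R]_d) = 1] = 1%E
    & forall (U : 'M[R]_d) (A : set (borel_rV R d)),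
        U *m U^T = 1%:M -> measurable A ->
        P [set w | A ((Z w : 'rV[R]_d) *m U)] = P [set w | A (Z w)]].

(* Sign with values in {-1, +1}; the convention is sign 0 = +1. *)
Definition sign_pm {R : realType} (t : R) : R := if 0 <= t then 1 else -1.

Section Oracle.
Context {R : realType} {d : nat} {dS : measure_display}.
Context {S : measurableType dS}.

(* The oracle is a function [Cf] of a random seed drawn from (S, Q) and of the
   query (x, y): each query consumes a fresh independent seed. *)
Definition correct_answer (f : 'rV[R]_d -> R)
    (Cf : S -> 'rV[R]_d -> 'rV[R]_d -> R) (x y : 'rV[R]_d) : set S :=
  [set w | Cf w x y = sign_pm (f y - f x)].

(* [powR] satisfies 0 `^ 0 = 1, so that for kappa = 1 the lower bound is
   1/2 + min(delta0, mu) also when f x = f y. *)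
Record poly_comparison_oracle (Q : probability S R) (f : 'rV[R]_d -> R)
    (delta0 mu kappa : R) (Cf : S -> 'rV[R]_d -> 'rV[R]_d -> R) : Prop := {
  oracle_delta0 : 0 < delta0 <= 1 / 2 ;
  oracle_mu : 0 < mu ;
  oracle_kappa : 1 <= kappa ;
  oracle_pm1 : forall w x y, Cf w x y = 1 \/ Cf w x y = -1 ;
  oracle_measurable :
    measurable_fun setT (fun q : S * borel_rV R d * borel_rV R d =>
                           Cf q.1.1 q.1.2 q.2) ;
  oracle_correct : forall x y,
    ((1 / 2 + Num.min delta0 (mu * `|f y - f x| `^ (kappa - 1)))%:E
       <= Q (correct_answer f Cf x y))%E }.

Definition constant_accuracy (Q : probability S R) (f : 'rV[R]_d -> R)
    (Cf : S -> 'rV[R]_d -> 'rV[R]_d -> R) : Prop :=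
  exists p : R, forall x y, Q (correct_answer f Cf x y) = p%:E.

End Oracle.

Section Algorithms.
Context {R : realType} {d : nat}.
Local Notation V := 'rV[R]_d.

(* [ans i] is the answer function of the oracle at the i-th query, [z i] the
   i-th sampled direction, and [g] the output (any maximizer is allowed). *)
Definition one_bit_grad_est (s : R) (m : nat) (r : R)
    (ans : nat -> V -> V -> R) (x : V) (z : nat -> V) (g : V) : Prop :=
  let feasible := [set h : V | norm1 h <= Num.sqrt s /\ norm2 h <= 1] in
  let objective h :=
    \sum_(i < m) ans i x (x + r *: z i) * dotv (z i) h in
  feasible g /\ forall h, feasible h -> objective h <= objective g.

Context {dS dO : measure_display}.
Context {S : measurableType dS} {Omega : measurableType dO}.

Section Past.
Variables (m : nat) (Z : nat -> nat -> Omega -> V).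
Variables (W : nat -> nat -> Omega -> S) (G : nat -> Omega -> V).

(* Everything that has been sampled or computed before iteration k. *)
Definition past (k : nat) : set (set Omega) :=
  <<s [set A | exists2 j, (j < k)%N &
         (exists2 i, (i < m)%N &
            sigma_of (Z j i : Omega -> borel_rV R d) A \/ sigma_of (W j i) A)
         \/ sigma_of (G j : Omega -> borel_rV R d) A] >>.

(* The past together with the individual random choices of iteration k. *)
Definition past_and_fresh (k : nat) (a : option ('I_m + 'I_m)) :
    set (set Omega) :=
  match a with
  | None => past k
  | Some (inl i) => sigma_of (Z k i : Omega -> borel_rV R d)
  | Some (inr i) => sigma_of (W k i)
  end.

End Past.

(* A random run of the algorithm on (Omega, P): at iteration k, Z k i are the
   sampled directions, W k i the oracle seeds, G k the gradient estimate and
   X k the iterate. Since the maximizer G k need not be unique, freshness is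
   expressed relative to a past that includes the earlier choices G j; it implies
   that all the Z k i and W k i are mutually independent. *)
Record scobo_run (P : probability Omega R) (Q : probability S R)
    (Cf : S -> V -> V -> R) (x0 : V) (s : R) (m : nat) (r : R) (K : nat)
    (step : nat -> R) (Z : nat -> nat -> Omega -> V)
    (W : nat -> nat -> Omega -> S) (G X : nat -> Omega -> V) : Prop := {
  run_init : forall w, X 0%N w = x0 ;
  run_step : forall k w, (k < K)%N ->
    X k.+1 w = X k w - step k *: G k w ;
  run_grad_est : forall k w, (k < K)%N ->
    one_bit_grad_est s m r (fun i => Cf (W k i w)) (X k w)
      (fun i => Z k i w) (G k w) ;
  run_grad_measurable : forall k, (k < K)%N ->
    measurable_fun setT (G k : Omega -> borel_rV R d) ;
  run_direction_law : forall k i, (k < K)%N -> (i < m)%N ->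
    uniform_on_sphere P (Z k i : Omega -> borel_rV R d) ;
  run_seed_measurable : forall k i, (k < K)%N -> (i < m)%N ->
    measurable_fun setT (W k i) ;
  run_seed_law : forall k i, (k < K)%N -> (i < m)%N ->
    forall A, measurable A -> P (W k i @^-1` A) = Q A ;
  run_fresh : forall k, (k < K)%N ->
    mutually_independent P (past_and_fresh Z W G (m := m) k) }.

Definition scobo_queries (m : nat) (r : R) (K : nat)
    (Z : nat -> nat -> Omega -> V) (X : nat -> Omega -> V) (w : Omega) :
    seq (V * V) :=
  [seq (X k w, X k w + r *: Z k i w) | k <- iota 0 K, i <- iota 0 m].

End Algorithms.

(* Rounding up to a natural number, negative numbers being sent to 0. *)
Definition ceil_nat {R : realType} (t : R) : nat :=
  absz (Num.max 0 (Num.ceil t)).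

(* Main.v *)
Require Import Defs.
From HB Require Import structures.
From mathcomp Require Import all_boot all_order all_algebra.
From mathcomp Require Import all_classical all_reals all_analysis.
From mathcomp Require Import unstable measurable_realfun.
From mathcomp Require Import zify ring lra.
Import Order.TTheory GRing.Theory Num.Theory.
Import numFieldNormedType.Exports.

(** The proof has a probabilistic part, which shows that every gradient estimate is
    well aligned with the direction away from the minimizers, and a deterministic
    part, which follows the distance to the minimizers.

    The estimate maximizes a random linear form on the sparse ball. Its mean is
    computed by integrating over the oracle seed: since the accuracy [p] does not
    depend on the query, it is [2 p - 1] times the correlation of the direction [z]
    with the exact sign of [f (x + r z) - f x] ([mean_response_correlation]).
    Convexity and smoothness make this sign equal to the sign of [dotv z u], with [u]
    the unit gradient, outside a strip [- t <= dotv z u < 0] with [t] of order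
    [r L / |grad f x|]. For uniform [z] the correlation with [u] is at least
    [1 / sqrt (2 d) - 2 t / 3], and the correlation with a unit vector orthogonal to
    [u] at most [t / 3] ([sign_correlation_along], [sign_correlation_across]). The
    strip biases the mean, so that the estimate need not be close to [u]. But its
    possible tilt is controlled by the ratio [X = nu D / (2 |grad f x|)], [D] being
    the distance to the minimizers, and the cosine [c] of the angle between the
    gradient and the direction of the minimizers satisfies
    [nu / (2 L) <= 2 X (c - X)] ([curvature_ratio]): where the tilt can be large, the
    gradient points well enough to absorb it ([estimate_alignment]). The facts about
    the sphere are derived from orthogonal invariance alone, by rotating planes,
    without densities ([sphere_abs_ge], [sphere_strip]).

    The deviation of the linear form from its mean is sub-Gaussian, conditionally on
    the past of the run ([noise_laplace], by [sphere_laplace] and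
    [fresh_product_le]). It has to be bounded uniformly on the sparse ball with
    [s log (2 d / s)] in place of [d]. For this each coordinate enters a mixture of
    exponentials that dominates [exp ((|t| - theta)_+^2 / 8)]; the product over
    coordinates has expectation at most [exp s], and it bounds the linear form on the
    ball by duality: the part of each coordinate below [theta] is paid with the l1
    norm, the excess with the l2 norm ([soft_mixture_dual], [integral_potential]).
    This gives the bound [11 sqrt (s log (2 d / s))] with probability at least
    [1 - exp (- s log (2 d / s))] ([noise_event]), and the constant [C = 128 ^ 2]
    provides enough queries for an alignment up to [eta].

    On the event that all iterations are good, the distance [D_k] satisfies
    [D_(k+1)^2 <= D_k^2 - 2 alpha (nu / (2 L) - eta) D_k + alpha^2] as long as
    [D_k >= alpha rho], and [D_(k+1) <= D_k + alpha] always. After [K] steps it is at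
    most [alpha (1 + rho)] ([descent_recursion]), and smoothness turns this into the
    bound on [f]. *)

Set Implicit Arguments.
Unset Strict Implicit.
Unset Printing Implicit Defensive.

Local Open Scope classical_set_scope.
Local Open Scope ring_scope.

(** * Euclidean geometry of row vectors *)

Section EuclideanTheory.
Context {R : realType} {d : nat}.
Implicit Types (x y z u v h : 'rV[R]_d).

Lemma dotvC x y : dotv x y = dotv y x.
Proof. by apply: eq_bigr => i _; rewrite mulrC. Qed.

Lemma dotvDl x y z : dotv (x + y) z = dotv x z + dotv y z.
Proof. by rewrite -big_split/=; apply: eq_bigr => i _; rewrite mxE mulrDl. Qed.

Lemma dotvZl (a : R) x y : dotv (a *: x) y = a * dotv x y.
Proof. by rewrite mulr_sumr; apply: eq_bigr => i _; rewrite mxE mulrA. Qed.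

Lemma dotvNl x y : dotv (- x) y = - dotv x y.
Proof. by rewrite -scaleN1r dotvZl mulN1r. Qed.

Lemma dotvBl x y z : dotv (x - y) z = dotv x z - dotv y z.
Proof. by rewrite dotvDl dotvNl. Qed.

Lemma dotv0l x : dotv 0 x = 0.
Proof. by rewrite -(scale0r 0) dotvZl mul0r. Qed.

Lemma dotvDr x y z : dotv z (x + y) = dotv z x + dotv z y.
Proof. by rewrite !(dotvC z) dotvDl. Qed.

Lemma dotvZr (a : R) x y : dotv y (a *: x) = a * dotv y x.
Proof. by rewrite !(dotvC y) dotvZl. Qed.

Lemma dotvNr x y : dotv y (- x) = - dotv y x.
Proof. by rewrite !(dotvC y) dotvNl. Qed.

Lemma dotvBr x y z : dotv z (x - y) = dotv z x - dotv z y.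
Proof. by rewrite dotvDr dotvNr. Qed.

Lemma dotv0r x : dotv x 0 = 0.
Proof. by rewrite dotvC dotv0l. Qed.

Lemma dotv_sumr (I : Type) (r : seq I) (P : pred I) (F : I -> 'rV[R]_d) x :
  dotv x (\sum_(i <- r | P i) F i) = \sum_(i <- r | P i) dotv x (F i).
Proof. by elim/big_rec2: _ => [|i a b _ <-]; rewrite ?dotv0r ?dotvDr. Qed.

Lemma dotv_delta x i : dotv x (delta_mx 0 i) = x 0 i.
Proof.
rewrite /dotv (bigD1 i)//= big1 => [|j /negPf ji]; rewrite !mxE !eqxx ?ji /=.
  by rewrite mulr1 addr0.
by rewrite mulr0.
Qed.

Lemma dotv_ge0 x : 0 <= dotv x x.
Proof. by apply: sumr_ge0 => i _; rewrite -expr2 sqr_ge0. Qed.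

Lemma dotv_mul (U : 'M[R]_d) x y : dotv (x *m U) y = dotv x (y *m U^T).
Proof.
have mx (a b : 'rV[R]_d) : dotv a b = (a *m b^T) 0 0.
  by rewrite mxE; apply: eq_bigr => i _; rewrite !mxE.
by rewrite !mx trmx_mul trmxK mulmxA.
Qed.

Lemma norm2_ge0 x : 0 <= norm2 x.
Proof. exact: sqrtr_ge0. Qed.

Lemma norm2_sqr x : norm2 x ^+ 2 = dotv x x.
Proof. by rewrite sqr_sqrtr// dotv_ge0. Qed.

Lemma norm2_eq0 x : (norm2 x == 0) = (x == 0).
Proof.
apply/eqP/eqP => [x0|->]; last by rewrite /norm2 dotv0l sqrtr0.
have : dotv x x == 0 by rewrite -norm2_sqr x0 expr0n.
rewrite psumr_eq0 => [/allP x0'|i _]; last by rewrite -expr2 sqr_ge0.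
apply/rowP => i; rewrite mxE; apply/eqP; rewrite -sqrf_eq0 expr2.
exact: (x0' i (mem_index_enum _)).
Qed.

Lemma norm2_gt0 x : (0 < norm2 x) = (x != 0).
Proof. by rewrite lt_neqAle norm2_ge0 andbT eq_sym norm2_eq0. Qed.

Lemma norm2Z (a : R) x : norm2 (a *: x) = `|a| * norm2 x.
Proof.
rewrite /norm2 dotvZl dotvZr mulrA -expr2 sqrtrM ?sqr_ge0//.
by rewrite sqrtr_sqr.
Qed.

Lemma norm2N x : norm2 (- x) = norm2 x.
Proof. by rewrite -scaleN1r norm2Z normrN1 mul1r. Qed.

Lemma norm2_0 : norm2 (0 : 'rV[R]_d) = 0.
Proof. by apply/eqP; rewrite norm2_eq0. Qed.

Lemma cauchy_schwarz x y : `|dotv x y| <= norm2 x * norm2 y.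
Proof.
have [->|y0] := eqVneq y 0; first by rewrite dotv0r normr0 norm2_0 mulr0.
have ny : 0 < norm2 y by rewrite norm2_gt0.
rewrite -ler_sqr ?nnegrE ?mulr_ge0 ?norm2_ge0// exprMn real_normK ?num_real//.
have := dotv_ge0 (dotv y y *: x - dotv x y *: y).
rewrite !(dotvBl, dotvBr, dotvZl, dotvZr) (dotvC y x) !norm2_sqr.
have yy : 0 < dotv y y by rewrite -norm2_sqr exprn_gt0.
move=> h; rewrite -(ler_pM2l yy); nra.
Qed.

Lemma dotv_le x y : dotv x y <= norm2 x * norm2 y.
Proof. exact: le_trans (ler_norm _) (cauchy_schwarz _ _). Qed.

Lemma norm2D x y : norm2 (x + y) <= norm2 x + norm2 y.
Proof.
rewrite -ler_sqr ?nnegrE ?addr_ge0 ?norm2_ge0// norm2_sqr.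
rewrite dotvDl !dotvDr (dotvC y x) sqrrD !norm2_sqr.
have := dotv_le x y; lra.
Qed.

Lemma normalize_norm2 x : x != 0 -> norm2 ((norm2 x)^-1 *: x) = 1.
Proof.
by move=> x0; rewrite norm2Z gtr0_norm ?invr_gt0 ?norm2_gt0// mulVf// norm2_eq0.
Qed.

Lemma dotv_self1 x : norm2 x = 1 -> dotv x x = 1.
Proof. by rewrite -norm2_sqr => ->; rewrite expr1n. Qed.

Lemma unit_vector_dim x : norm2 x = 1 -> (0 < d)%N.
Proof.
move=> x1; have : x != 0 by rewrite -norm2_gt0 x1.
rewrite lt0n; apply: contra_neq => d0; apply/rowP => i.
by exfalso; move: (ltn_ord i); rewrite {2}d0 ltn0.
Qed.

Lemma coord_le_norm2 x i : `|x 0 i| <= norm2 x.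
Proof.
rewrite -(ler_sqr (x := `|_|)) ?nnegrE ?norm2_ge0// norm2_sqr real_normK ?num_real//.
rewrite /dotv (bigD1 i)//= -expr2 lerDl; apply: sumr_ge0 => j _.
by rewrite -expr2 sqr_ge0.
Qed.

(** ** Orthogonal maps *)

Definition reflection v : 'M[R]_d := 1%:M - (2 / dotv v v) *: (v^T *m v).

Lemma mul_reflection v z :
  z *m reflection v = z - (2 / dotv v v * dotv z v) *: v.
Proof.
rewrite mulmxBr mulmx1 -scalemxAr mulmxA.
have -> : z *m v^T = (dotv z v)%:M.
  apply/matrixP => i j; rewrite !ord1 !mxE eqxx mulr1n.
  by apply: eq_bigr => k _; rewrite mxE.
by rewrite mul_scalar_mx scalerA.
Qed.

Lemma reflection_tr v : (reflection v)^T = reflection v.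
Proof.
by rewrite /reflection linearB/= tr_scalar_mx linearZ/= trmx_mul trmxK.
Qed.

Lemma reflection_orth v : reflection v *m (reflection v)^T = 1%:M.
Proof.
rewrite reflection_tr; apply/row_matrixP => i; rewrite !rowE.
set z := delta_mx _ _; rewrite mulmxA mulmx1 !mul_reflection dotvBl dotvZl.
have [->|v0] := eqVneq v 0; first by rewrite !scaler0 !subr0.
have vv : dotv v v != 0 by rewrite -norm2_sqr expf_eq0/= norm2_eq0.
rewrite -addrA -opprD -scalerDl.
set a := (X in X *: _); suff -> : a = 0 by rewrite scale0r subr0.
by rewrite /a; field.
Qed.

Lemma reflection_swap x y : norm2 x = norm2 y -> x *m reflection (x - y) = y.
Proof.
move=> xy; have [->|nxy] := eqVneq x y.
  by rewrite mul_reflection subrr scaler0 subr0.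
rewrite mul_reflection.
have xxyy : dotv x x = dotv y y by rewrite -!norm2_sqr xy.
have vv : dotv (x - y) (x - y) != 0.
  by rewrite -norm2_sqr expf_eq0/= norm2_eq0 subr_eq0.
suff -> : 2 / dotv (x - y) (x - y) * dotv x (x - y) = 1.
  by rewrite scale1r opprB addrC subrK.
have e : dotv (x - y) (x - y) = 2 * dotv x (x - y).
  by rewrite !dotvBl !dotvBr -xxyy (dotvC y x); ring.
by rewrite mulrAC -e divff.
Qed.

Lemma orthogonal_mul (U V : 'M[R]_d) :
  U *m U^T = 1%:M -> V *m V^T = 1%:M -> (U *m V) *m (U *m V)^T = 1%:M.
Proof. by move=> hU hV; rewrite trmx_mul mulmxA -(mulmxA U) hV mulmx1. Qed.

Lemma norm2_orthogonal (U : 'M[R]_d) x : U *m U^T = 1%:M ->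
  norm2 (x *m U) = norm2 x.
Proof. by move=> hU; rewrite /norm2 dotv_mul -mulmxA hU mulmx1. Qed.

(** Orthogonal maps act transitively on orthonormal pairs: one reflection moves
    [u'] to [u], and a second one, in a hyperplane that contains [u], moves the
    image of [h'] to [h]. *)
Lemma orthogonal_pair u h u' h' :
  norm2 u = 1 -> norm2 h = 1 -> dotv u h = 0 ->
  norm2 u' = 1 -> norm2 h' = 1 -> dotv u' h' = 0 ->
  exists U : 'M[R]_d, [/\ U *m U^T = 1%:M,
    forall z, dotv (z *m U) u = dotv z u' &
    forall z, dotv (z *m U) h = dotv z h'].
Proof.
move=> u1 h1 uh u'1 h'1 uh'.
pose A := reflection (u' - u); pose k := h' *m A.
have Au : u' *m A = u by apply: reflection_swap; rewrite u1.
have Ao : A *m A^T = 1%:M := reflection_orth _.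
have k1 : norm2 k = 1 by rewrite norm2_orthogonal.
have uk : dotv u k = 0 by rewrite -Au /k dotv_mul -mulmxA Ao mulmx1.
pose B := reflection (k - h).
have Bo : B *m B^T = 1%:M := reflection_orth _.
have Bk : k *m B = h by apply: reflection_swap; rewrite h1.
have Bu : u *m B = u.
  have ukh : dotv u (k - h) = 0 by rewrite dotvBr uk uh subrr.
  by rewrite mul_reflection ukh mulr0 scale0r subr0.
have ABo := orthogonal_mul Ao Bo.
exists (A *m B); split => // z; rewrite dotv_mul trmx_mul mulmxA.
  by rewrite -{1}Bu -(mulmxA u) Bo mulmx1 -{1}Au -(mulmxA u') Ao mulmx1.
by rewrite -{1}Bk -(mulmxA k) Bo mulmx1 -(mulmxA h') Ao mulmx1.
Qed.

Lemma orthogonal_vec u u' : norm2 u = norm2 u' ->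
  exists U : 'M[R]_d, U *m U^T = 1%:M /\
    forall z, dotv (z *m U) u = dotv z u'.
Proof.
move=> uu; exists (reflection (u' - u)); split; first exact: reflection_orth.
by move=> z; rewrite dotv_mul reflection_tr -{1}(reflection_swap (esym uu)) -mulmxA
  -{2}reflection_tr reflection_orth mulmx1.
Qed.

End EuclideanTheory.

(** * Borel measurability of vector-valued maps *)

Section BorelVectors.
Context {R : realType} {d : nat}.
Local Notation V := 'rV[R]_d.
Local Notation BV := (borel_rV R d).

Lemma continuous_borel_measurable (f : V -> R) :
  continuous f -> measurable_fun setT (f : BV -> R).
Proof.
move=> /continuousP cf; apply: (measurability _ (RGenOpens.measurableE R)).
move=> _ [_ [a [b ->] <-]]; rewrite setTI; apply: sub_sigma_algebra.
exact/cf/interval_open.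
Qed.

Lemma measurable_coord (i : 'I_d) : measurable_fun setT (fun z : BV => z 0 i : R).
Proof. by apply: continuous_borel_measurable => ?; exact: coord_continuous. Qed.

Lemma rV_ballP (x y : V) e : ball x e y <-> 0 < e /\ forall i, `|x 0 i - y 0 i| < e.
Proof.
split=> [[e0 b]|[e0 b]]; split=> // i; first by have := b 0 i.
by move=> j; rewrite (ord1 i); exact: b.
Qed.

(** Every open set is a union of balls with rational centre and radius, and such
    a ball is a finite intersection of conditions on the coordinates. *)
Lemma measurable_fun_coords {dT} {T : measurableType dT} (F : T -> BV) :
  (forall i, measurable_fun setT (fun w => (F w : V) 0 i)) ->
  measurable_fun setT F.
Proof.
move=> mF; apply: (@measurability _ _ _ _ setT F (@open V)) => //.
move=> _ [U oU <-]; rewrite setTI.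
pose c (p : {ffun 'I_d -> rat} * rat) : V := \row_i ratr (p.1 i).
pose B p := F @^-1` ball (c p) (ratr p.2).
have mB p : measurable (B p).
  have [p0|p0] := ltP 0 (ratr p.2 : R); last first.
    suff -> : B p = set0 by [].
    by rewrite -subset0 => w /rV_ballP[]; rewrite ltNge p0.
  have -> : B p = \big[setI/setT]_(i < d)
      ((fun w => (F w : V) 0 i) @^-1` ball ((c p) 0 i) (ratr p.2)).
    apply/seteqP; split=> w.
      by move=> /rV_ballP[_ h]; elim/big_ind: _ => // i _; exact: h.
    move=> h; apply/rV_ballP; split=> // i.
    by move: h; rewrite (bigD1 i)//= => -[].
  apply: bigsetI_measurable => i _; rewrite -[X in measurable X]setTI.
  by apply: mF => //; exact: measurable_ball.
suff -> : F @^-1` U = \bigcup_p (if `[< ball (c p) (ratr p.2) `<=` U >] then B p else set0).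
  apply: countable_bigcupT_measurable => [|p]; last by case: ifP.
  exact: countableP.
apply/seteqP; split=> [w Uw|w [p _]]; last by case: asboolP => // h; apply: h.
have /nbhs_ballP[e /= e0 heU] : nbhs (F w : V) U by exact: open_nbhs_nbhs.
have [q /andP[q0 qe]] := rat_in_itvoo (divr_gt0 e0 (ltr0n _ 2) : 0 < e / 2).
have rx (x : R) : exists t : rat, `|ratr t - x| < ratr q.
  have [t /andP[t1 t2]] := rat_in_itvoo (ltr_pwDr q0 (lexx x) : x < x + ratr q).
  by exists t; rewrite ger0_norm ?subr_ge0 ?ltW// ltrBlDl.
have [t ht] := choice (fun i : 'I_d => rx ((F w : V) 0 i)).
exists ([ffun i => t i], q) => //; case: asboolP => [_|[]].
  by apply/rV_ballP; split=> // i; rewrite mxE ffunE.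
move=> y /rV_ballP[_ hy]; apply: heU; apply/rV_ballP; split=> // i.
rewrite -(subrK (ratr (t i)) ((F w : V) 0 i)) -addrA.
apply: le_lt_trans (ler_normD _ _) _.
have := hy i; rewrite !mxE ffunE /= => h1; have := ht i; rewrite distrC => h2.
by move: qe; rewrite bnd_simp; lra.
Qed.

Context {dT : measure_display} {T : measurableType dT}.
Implicit Types (F G : T -> BV).

Lemma measurable_coord_comp F i : measurable_fun setT F ->
  measurable_fun setT (fun w => (F w : V) 0 i).
Proof. by move=> mF; exact: (measurableT_comp (measurable_coord i) mF). Qed.

Lemma measurable_dotv F G : measurable_fun setT F -> measurable_fun setT G ->
  measurable_fun setT (fun w => dotv (F w : V) (G w)).
Proof.
move=> mF mG; apply: measurable_sum => i.
by apply: measurable_funM; exact: measurable_coord_comp.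
Qed.

Lemma measurable_rVD F G : measurable_fun setT F -> measurable_fun setT G ->
  measurable_fun setT (fun w => (F w : V) + (G w : V) : BV).
Proof.
move=> mF mG; apply: measurable_fun_coords => i.
under eq_fun do rewrite mxE.
by apply: measurable_funD; exact: measurable_coord_comp.
Qed.

Lemma measurable_rVZ (a : R) F : measurable_fun setT F ->
  measurable_fun setT (fun w => a *: (F w : V) : BV).
Proof.
move=> mF; apply: measurable_fun_coords => i.
under eq_fun do rewrite mxE.
by apply: measurable_funM => //; exact: measurable_coord_comp.
Qed.

Lemma measurable_norm2 F : measurable_fun setT F ->
  measurable_fun setT (fun w => norm2 (F w : V)).
Proof.
move=> mF.
have ms : measurable_fun setT (@Num.sqrt R).
  by apply: continuous_measurable_fun; exact: sqrt_continuous.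
exact: (measurableT_comp ms (measurable_dotv mF mF)).
Qed.

Lemma measurable_mulmx F (U : 'M[R]_d) : measurable_fun setT F ->
  measurable_fun setT (fun w => (F w : V) *m U : BV).
Proof.
move=> mF; apply: measurable_fun_coords => i.
under eq_fun do rewrite mxE.
apply: measurable_sum => j; apply: measurable_funM => //.
exact: measurable_coord_comp.
Qed.

End BorelVectors.

(** * Expectation of bounded random variables *)

Section BoundedExpectation.
Context {dO : measure_display} {Omega : measurableType dO} {R : realType}.
Variable P : probability Omega R.
Implicit Types X Y : Omega -> R.

Definition bounded_rv X :=
  measurable_fun setT X /\ exists B : R, forall w, `|X w| <= B.

Definition Ex X : R := \int[P]_w X w.

Lemma bounded_rv_integrable X : bounded_rv X -> P.-integrable setT (EFin \o X).
Proof.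
move=> [mX [B hB]]; apply: measurable_bounded_integrable => //.
  rewrite -ge0_fin_numE ?measure_ge0//; exact: fin_num_measure.
exists B; split=> [|M BM w _ /=]; first exact: num_real.
exact: le_trans (hB w) (ltW BM).
Qed.

Lemma Ex_integral X : bounded_rv X -> (\int[P]_w (X w)%:E = (Ex X)%:E)%E.
Proof.
move=> /bounded_rv_integrable iX; rewrite fineK//.
exact: integrable_fin_num.
Qed.

Lemma bounded_rv_cst (a : R) : bounded_rv (fun=> a).
Proof. by split=> //; exists `|a|. Qed.

Lemma bounded_rvD X Y : bounded_rv X -> bounded_rv Y ->
  bounded_rv (fun w => X w + Y w).
Proof.
move=> [mX [A hA]] [mY [B hB]]; split; first exact: measurable_funD.
by exists (A + B) => w; apply: le_trans (ler_normD _ _) _; exact: lerD.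
Qed.

Lemma bounded_rvM X Y : bounded_rv X -> bounded_rv Y ->
  bounded_rv (fun w => X w * Y w).
Proof.
move=> [mX [A hA]] [mY [B hB]]; split; first exact: measurable_funM.
by exists (A * B) => w; rewrite normrM; exact: ler_pM.
Qed.

Lemma bounded_rvZ (a : R) X : bounded_rv X -> bounded_rv (fun w => a * X w).
Proof. by apply: bounded_rvM; exact: bounded_rv_cst. Qed.

Lemma bounded_rvN X : bounded_rv X -> bounded_rv (fun w => - X w).
Proof.
by move=> /(bounded_rvZ (-1)); under eq_fun do rewrite mulN1r.
Qed.

Lemma bounded_rvB X Y : bounded_rv X -> bounded_rv Y ->
  bounded_rv (fun w => X w - Y w).
Proof. by move=> hX /bounded_rvN; exact: bounded_rvD. Qed.

Lemma bounded_rv_sum (I : Type) (r : seq I) (X : I -> Omega -> R) :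
  (forall i, bounded_rv (X i)) -> bounded_rv (fun w => \sum_(i <- r) X i w).
Proof.
move=> hX; elim: r => [|i r ih].
  by under eq_fun do rewrite big_nil; exact: bounded_rv_cst.
by under eq_fun do rewrite big_cons; exact: bounded_rvD.
Qed.

Lemma bounded_rv_expR X : bounded_rv X -> bounded_rv (fun w => expR (X w)).
Proof.
move=> [mX [B hB]]; split; first apply: measurableT_comp => //.
exists (expR B) => w; rewrite ger0_norm ?expR_ge0// ler_expR.
exact: le_trans (ler_norm _) (hB w).
Qed.

Lemma Ex_cst (a : R) : Ex (fun=> a) = a.
Proof.
have P1 : P setT = 1%E := probability_setT P.
by rewrite /Ex Rintegral_cst// (_ : fine _ = 1) ?mulr1//; exact: (congr1 fine P1).
Qed.

Lemma ExD X Y : bounded_rv X -> bounded_rv Y ->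
  Ex (fun w => X w + Y w) = Ex X + Ex Y.
Proof. by move=> hX hY; apply: RintegralD => //; exact: bounded_rv_integrable. Qed.

Lemma ExZ (a : R) X : bounded_rv X -> Ex (fun w => a * X w) = a * Ex X.
Proof. by move=> hX; apply: RintegralZl => //; exact: bounded_rv_integrable. Qed.

Lemma ExN X : bounded_rv X -> Ex (fun w => - X w) = - Ex X.
Proof.
by move=> /(ExZ (-1)); under eq_fun do rewrite mulN1r; rewrite mulN1r.
Qed.

Lemma ExB X Y : bounded_rv X -> bounded_rv Y ->
  Ex (fun w => X w - Y w) = Ex X - Ex Y.
Proof. by move=> hX hY; rewrite ExD ?ExN//; exact: bounded_rvN. Qed.

Lemma Ex_sum (I : Type) (r : seq I) (X : I -> Omega -> R) :
  (forall i, bounded_rv (X i)) ->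
  Ex (fun w => \sum_(i <- r) X i w) = \sum_(i <- r) Ex (X i).
Proof.
move=> hX; elim: r => [|i r ih].
  by under eq_fun do rewrite big_nil; rewrite Ex_cst big_nil.
under eq_fun do rewrite big_cons.
by rewrite ExD ?big_cons ?ih//; exact: bounded_rv_sum.
Qed.

Lemma le_Ex X Y : bounded_rv X -> bounded_rv Y -> (forall w, X w <= Y w) ->
  Ex X <= Ex Y.
Proof.
by move=> hX hY XY; apply: le_Rintegral => //; exact: bounded_rv_integrable.
Qed.

End BoundedExpectation.

(** * Averages over the sphere *)

Section Sphere.
Context {R : realType} {d : nat} {dO : measure_display}.
Context {Omega : measurableType dO}.
Local Notation V := 'rV[R]_d.
Local Notation BV := (borel_rV R d).
Variables (P : probability Omega R) (Z : Omega -> BV).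
Hypothesis mZ : measurable_fun setT Z.
Hypothesis Z1 : forall w, norm2 (Z w : V) = 1.
Hypothesis Zinv : forall (U : 'M[R]_d) (A : set BV),
  U *m U^T = 1%:M -> measurable A ->
  P [set w | A ((Z w : V) *m U)] = P [set w | A (Z w)].
Implicit Types (F G : V -> R) (u h z : V).

Definition on_sphere F :=
  measurable_fun setT (F : BV -> R) /\ exists B : R, forall z, norm2 z = 1 -> `|F z| <= B.

Definition Es F : R := Ex P (fun w => F (Z w)).

Lemma on_sphere_rv F : on_sphere F -> bounded_rv (fun w => F (Z w)).
Proof.
move=> [mF [B hB]]; split; first exact: (measurableT_comp mF mZ).
by exists B => w; exact: hB.
Qed.

Lemma on_sphere_cst (a : R) : on_sphere (fun=> a).
Proof. by split=> //; exists `|a|. Qed.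

Lemma on_sphereD F G : on_sphere F -> on_sphere G -> on_sphere (fun z => F z + G z).
Proof.
move=> [mX [A hA]] [mY [B hB]]; split; first exact: measurable_funD.
exists (A + B) => z z1; apply: le_trans (ler_normD _ _) _.
by apply: lerD; [exact: hA|exact: hB].
Qed.

Lemma on_sphereM F G : on_sphere F -> on_sphere G -> on_sphere (fun z => F z * G z).
Proof.
move=> [mX [A hA]] [mY [B hB]]; split; first exact: measurable_funM.
by exists (A * B) => z z1; rewrite normrM; apply: ler_pM => //; [exact: hA|exact: hB].
Qed.

Lemma on_sphereZ (a : R) F : on_sphere F -> on_sphere (fun z => a * F z).
Proof. by apply: on_sphereM; exact: on_sphere_cst. Qed.

Lemma on_sphereN F : on_sphere F -> on_sphere (fun z => - F z).
Proof. by move=> /(on_sphereZ (-1)); under eq_fun do rewrite mulN1r. Qed.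

Lemma on_sphereB F G : on_sphere F -> on_sphere G -> on_sphere (fun z => F z - G z).
Proof. by move=> hF /on_sphereN; exact: on_sphereD. Qed.

Lemma on_sphereX n F : on_sphere F -> on_sphere (fun z => F z ^+ n).
Proof.
move=> hF; elim: n => [|n ih]; first by under eq_fun do rewrite expr0; exact: on_sphere_cst.
by under eq_fun do rewrite exprS; exact: on_sphereM.
Qed.

Lemma on_sphere_norm F : on_sphere F -> on_sphere (fun z => `|F z|).
Proof.
move=> [mF [B hB]]; split; first exact: measurableT_comp.
by exists B => z z1; rewrite normr_id; exact: hB.
Qed.

Lemma on_sphere_dot u : on_sphere (fun z => dotv z u).
Proof.
split; first exact: (@measurable_dotv _ _ _ _ (fun z : BV => z)).
by exists (norm2 u) => z z1; rewrite -[leRHS]mul1r -z1 cauchy_schwarz.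
Qed.

Lemma on_sphere_bool (b : V -> bool) : measurable_fun setT (b : BV -> bool) ->
  on_sphere (fun z => (b z)%:R).
Proof.
move=> mb; split.
  have -> : (fun z => (b z)%:R : R) = (fun z => if b z then 1 else 0).
    by apply/funext => z; case: (b z).
  exact: measurable_fun_ifT.
by exists 1 => z _; case: (b z); rewrite ?normr1 ?normr0.
Qed.

Lemma on_sphere_ge F (t : R) : on_sphere F -> on_sphere (fun z => (t <= F z)%R%:R).
Proof. by move=> [mF _]; apply: on_sphere_bool; exact: measurable_fun_ler. Qed.

Lemma on_sphere_le F (t : R) : on_sphere F -> on_sphere (fun z => (F z <= t)%R%:R).
Proof. by move=> [mF _]; apply: on_sphere_bool; exact: measurable_fun_ler. Qed.

Lemma on_sphere_expR F : on_sphere F -> on_sphere (fun z => expR (F z)).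
Proof.
move=> [mF [B hB]]; split; first exact: measurableT_comp.
exists (expR B) => z z1; rewrite ger0_norm ?expR_ge0// ler_expR.
exact: le_trans (ler_norm _) (hB z z1).
Qed.

Lemma Es_cst (a : R) : Es (fun=> a) = a.
Proof. exact: Ex_cst. Qed.

Lemma EsD F G : on_sphere F -> on_sphere G -> Es (fun z => F z + G z) = Es F + Es G.
Proof. by move=> hF hG; apply: ExD; exact: on_sphere_rv. Qed.

Lemma EsZ (a : R) F : on_sphere F -> Es (fun z => a * F z) = a * Es F.
Proof. by move=> hF; apply: ExZ; exact: on_sphere_rv. Qed.

Lemma EsB F G : on_sphere F -> on_sphere G -> Es (fun z => F z - G z) = Es F - Es G.
Proof. by move=> hF hG; apply: ExB; exact: on_sphere_rv. Qed.

Lemma Es_sum (I : Type) (r : seq I) (F : I -> V -> R) :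
  (forall i, on_sphere (F i)) ->
  Es (fun z => \sum_(i <- r) F i z) = \sum_(i <- r) Es (F i).
Proof. by move=> hF; apply: Ex_sum => i; exact: on_sphere_rv. Qed.

Lemma le_Es F G : on_sphere F -> on_sphere G ->
  (forall z, norm2 z = 1 -> F z <= G z) -> Es F <= Es G.
Proof. by move=> hF hG FG; apply: le_Ex => [||w]; [exact: on_sphere_rv..|exact: FG]. Qed.

Lemma Es_orthogonal F (U : 'M[R]_d) : on_sphere F -> U *m U^T = 1%:M ->
  Es (fun z => F (z *m U)) = Es F.
Proof.
move=> hF hU; have [mF _] := hF.
have mU : measurable_fun setT (fun w => (Z w : V) *m U : BV) by exact: measurable_mulmx.
pose phi1 : {mfun Omega >-> BV} := HB.pack Z (isMeasurableFun.Build _ _ _ _ _ mZ).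
pose phi2 : {mfun Omega >-> BV} :=
  HB.pack (fun w => (Z w : V) *m U : BV) (isMeasurableFun.Build _ _ _ _ _ mU).
rewrite /Es /Ex /Rintegral; congr fine.
have mEF : measurable_fun setT (EFin \o F : BV -> \bar R) by exact/measurable_EFinP.
have iF : P.-integrable setT ((EFin \o F) \o phi1).
  exact/bounded_rv_integrable/on_sphere_rv.
have iFU : P.-integrable setT ((EFin \o F) \o phi2).
  apply: (@bounded_rv_integrable _ _ _ _ (fun w => F ((Z w : V) *m U))).
  split; first exact: (measurableT_comp mF mU).
  by have [_ [B hB]] := hF; exists B => w; apply: hB; rewrite norm2_orthogonal.
transitivity (\int[pushforward P phi2]_(y in setT) (EFin \o F) y)%E.
  by rewrite integral_pushforward.
transitivity (\int[pushforward P phi1]_(y in setT) (EFin \o F) y)%E; last first.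
  by rewrite integral_pushforward.
by apply: eq_measure_integral => A mA _; exact: Zinv.
Qed.

(** Invariance under the orthogonal maps that move one orthonormal pair to another.
    The symmetries used below (sign changes, exchange, rotations of a plane) are all
    instances of it. *)
Lemma Es_pair (G : R -> R -> R) u h u' h' :
  norm2 u = 1 -> norm2 h = 1 -> dotv u h = 0 ->
  norm2 u' = 1 -> norm2 h' = 1 -> dotv u' h' = 0 ->
  on_sphere (fun z => G (dotv z u) (dotv z h)) ->
  Es (fun z => G (dotv z u') (dotv z h')) = Es (fun z => G (dotv z u) (dotv z h)).
Proof.
move=> u1 h1 uh u'1 h'1 uh' hG.
have [U [hU Uu Uh]] := orthogonal_pair u1 h1 uh u'1 h'1 uh'.
rewrite -(Es_orthogonal hG hU); congr Es; apply/funext => z.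
by rewrite Uu Uh.
Qed.

Lemma Es_vec (G : R -> R) u u' : norm2 u = norm2 u' ->
  on_sphere (fun z => G (dotv z u)) ->
  Es (fun z => G (dotv z u')) = Es (fun z => G (dotv z u)).
Proof.
move=> uu hG; have [U [hU Uu]] := orthogonal_vec uu.
by rewrite -(Es_orthogonal hG hU); congr Es; apply/funext => z; rewrite Uu.
Qed.

Lemma norm2_delta i : norm2 (delta_mx 0 i : V) = 1.
Proof. by rewrite /norm2 dotv_delta mxE !eqxx sqrtr1. Qed.

Lemma sphere_second_moment u : norm2 u = 1 -> Es (fun z => dotv z u ^+ 2) = d%:R^-1.
Proof.
move=> u1; have hF (v : V) : on_sphere (fun z => dotv z v ^+ 2).
  by apply: on_sphereX; exact: on_sphere_dot.
have d0 : (0 < d)%N := unit_vector_dim u1.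
have : Es (fun z => \sum_(i < d) dotv z (delta_mx 0 i) ^+ 2) = 1.
  rewrite -[RHS]Es_cst; congr (Ex P _); apply/funext => w.
  transitivity (norm2 (Z w : V) ^+ 2); last by rewrite Z1 expr1n.
  by rewrite norm2_sqr; apply: eq_bigr => i _; rewrite dotv_delta expr2.
rewrite Es_sum// (eq_bigr (fun=> Es (fun z => dotv z u ^+ 2))) => [|i _]; last first.
  by rewrite (Es_vec (G := fun t => t ^+ 2) (u := u))// u1 norm2_delta.
rewrite sumr_const card_ord => h.
have dn : d%:R != 0 :> R by rewrite pnatr_eq0 -lt0n.
by apply: (mulfI dn); rewrite mulfV// mulr_natl.
Qed.

Lemma dot_le1 z u : norm2 u = 1 -> norm2 z = 1 -> `|dotv z u| <= 1.
Proof. by move=> u1 z1; rewrite -[leRHS]mul1r -{1}z1 -u1 cauchy_schwarz. Qed.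

End Sphere.

(** ** Absolute moments of a coordinate *)

Section SphereMoments.
Context {R : realType} {d : nat} {dO : measure_display}.
Context {Omega : measurableType dO}.
Local Notation V := 'rV[R]_d.
Local Notation BV := (borel_rV R d).
Variables (P : probability Omega R) (Z : Omega -> BV).
Hypothesis mZ : measurable_fun setT Z.
Hypothesis Z1 : forall w, norm2 (Z w : V) = 1.
Hypothesis Zinv : forall (U : 'M[R]_d) (A : set BV),
  U *m U^T = 1%:M -> measurable A ->
  P [set w | A ((Z w : V) *m U)] = P [set w | A (Z w)].
Implicit Types (F G : V -> R) (u h z : V).
Local Notation Es := (Es P Z).

Let Es_pair := Es_pair mZ Z1 Zinv.
Let le_Es := le_Es P mZ Z1.

(** [C] and [S] are the cosine and the sine of an angle of rotation in the plane of
    [u] and [h]. *)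
Lemma Es_rotate (G : R -> R -> R) (C S : R) u h : C ^+ 2 + S ^+ 2 = 1 ->
  norm2 u = 1 -> norm2 h = 1 -> dotv u h = 0 ->
  on_sphere (fun z : V => G (dotv z u) (dotv z h)) ->
  Es (fun z => G (C * dotv z u + S * dotv z h) (C * dotv z h - S * dotv z u)) =
  Es (fun z => G (dotv z u) (dotv z h)).
Proof.
move=> CS u1 h1 uh hG.
have uu : dotv u u = 1 by exact: dotv_self1.
have hh : dotv h h = 1 by exact: dotv_self1.
have n1 : norm2 (C *: u + S *: h) = 1.
  rewrite /norm2 [X in Num.sqrt X](_ : _ = 1) ?sqrtr1//.
  rewrite !(dotvDl, dotvDr, dotvZl, dotvZr) (dotvC h u) uh uu hh -[RHS]CS; ring.
have n2 : norm2 (C *: h - S *: u) = 1.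
  rewrite /norm2 [X in Num.sqrt X](_ : _ = 1) ?sqrtr1//.
  rewrite !(dotvDl, dotvDr, dotvNl, dotvNr, dotvZl, dotvZr) (dotvC h u) uh uu hh -[RHS]CS; ring.
have n12 : dotv (C *: u + S *: h) (C *: h - S *: u) = 0.
  rewrite !(dotvDl, dotvDr, dotvNl, dotvNr, dotvZl, dotvZr) (dotvC h u) uh uu hh; ring.
rewrite -(Es_pair u1 h1 uh n1 n2 n12 hG); congr (Ex P _); apply/funext => w.
by rewrite dotvBr dotvDr !dotvZr.
Qed.

Lemma mul_le_abs (x y X Y : R) : `|x| <= X -> `|y| <= Y -> x * y <= X * Y.
Proof.
move=> hx hy; apply: le_trans (ler_norm _) _; rewrite normrM; exact: ler_pM.
Qed.

Lemma abs_mul_le (x y X Y : R) : `|x| <= X -> `|y| <= Y -> `|x * y| <= X * Y.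
Proof. by move=> hx hy; rewrite normrM; exact: ler_pM. Qed.

(** First-order expansion of [a |a| b] along a rotation of angle [arcsin S]. *)
Lemma rotate_cubic_le (a b C S : R) : `|a| <= 1 -> `|b| <= 1 ->
  0 <= C -> 0 <= S <= 1 -> C ^+ 2 + S ^+ 2 = 1 ->
  (C * a + S * b) * `|C * a + S * b| * (C * b - S * a) <=
  a * `|a| * b + S * (2 * (`|a| * b ^+ 2) - `|a| ^+ 3) + 30 * S ^+ 2.
Proof.
move=> a1 b1 C0 /andP[S0 S1] CS.
have C1 : 0 <= 1 - C <= S ^+ 2 by apply/andP; split; nra.
have SS : S ^+ 2 <= S by nra.
pose r1 := - (1 - C) * a; pose r3 := - (1 - C) * b.
have C1' : `|- (1 - C)| <= S ^+ 2 by rewrite normrN ger0_norm; lra.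
have hr1 : `|r1| <= S ^+ 2 by rewrite -[S ^+ 2]mulr1; exact: abs_mul_le.
have hr3 : `|r3| <= S ^+ 2 by rewrite -[S ^+ 2]mulr1; exact: abs_mul_le.
have hSb : `|S * b| <= S by rewrite normrM (ger0_norm S0) ler_piMr.
have hSa : `|S * a| <= S by rewrite normrM (ger0_norm S0) ler_piMr.
pose e := S * b + r1.
have he : `|e| <= 2 * S by apply: le_trans (ler_normD _ _) _; lra.
pose r2 := r3 - S * a.
have hr2 : `|r2| <= 2 * S.
  by apply: le_trans (ler_normB _ _) _; lra.
have -> : C * a + S * b = a + e by rewrite /e /r1; ring.
have -> : C * b - S * a = b + r2 by rewrite /r2 /r3; ring.
pose q := (a + e) * `|a + e| - a * `|a| - 2 * `|a| * e.
have hq : `|q| <= 4 * S ^+ 2.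
  have : `|q| <= e ^+ 2.
    rewrite /q ler_norml; apply/andP.
    have [a0|a0] := leP 0 a; have [ae0|ae0] := leP 0 (a + e);
      rewrite ?(ger0_norm a0) ?(ltr0_norm a0) ?(ger0_norm ae0) ?(ltr0_norm ae0);
      split; nra.
  move/le_trans; apply; rewrite -(real_normK (num_real e)).
  have : `|e| ^+ 2 <= (2 * S) ^+ 2 by rewrite ler_sqr ?nnegrE// ; lra.
  by rewrite exprMn; lra.
have aa : `|a * `|a| | <= 1 by rewrite -[leRHS]mulr1; apply: abs_mul_le; rewrite ?normr_id.
have -> : (a + e) * `|a + e| * (b + r2) =
   a * `|a| * b + S * (2 * (`|a| * b ^+ 2) - a * a * `|a|)
   + (q * (b + r2) + (a * `|a|) * r3 + 2 * (`|a| * (r1 * b)) +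
     2 * (`|a| * (r1 * r2)) + 2 * (`|a| * (S * b * r2))).
  by rewrite /q /e /r2; ring.
have -> : `|a| ^+ 3 = a * a * `|a|.
  by rewrite -expr2 -(real_normK (num_real a)) [RHS]mulrC -exprS.
have aid : `| `|a| | <= 1 by rewrite normr_id.
have br : `|b + r2| <= 3 by apply: le_trans (ler_normD _ _) _; lra.
have b_1 := mul_le_abs hq br.
have b_2 := mul_le_abs aa hr3.
have b_3 := mul_le_abs aid (abs_mul_le hr1 b1).
have b_4 := mul_le_abs aid (abs_mul_le hr1 hr2).
have b_5 := mul_le_abs aid (abs_mul_le hSb hr2).
have S3 : S ^+ 2 * (2 * S) <= 2 * S ^+ 2 by nra.
have S4 : S * (2 * S) = 2 * S ^+ 2 by ring.
rewrite S4 in b_5; move: b_1 b_2 b_3 b_4 b_5.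
set t1 := q * _; set t2 := a * `|a| * r3; set t3 := `|a| * (r1 * b).
set t4 := `|a| * (r1 * r2); set t5 := `|a| * (S * b * r2); lra.
Qed.

Let on_sphere_abs (u : V) : on_sphere (fun z => `|dotv z u|).
Proof. by apply: on_sphere_norm; exact: on_sphere_dot. Qed.

(** The derivative of [E (a |a| b)] under rotations of the plane of [u] and [h]
    vanishes. *)
Lemma sphere_abs_cubed_le u h :
  norm2 u = 1 -> norm2 h = 1 -> dotv u h = 0 ->
  Es (fun z => `|dotv z u| ^+ 3) <= 2 * Es (fun z => `|dotv z u| * dotv z h ^+ 2).
Proof.
move=> u1 h1 uh.
have h3 : on_sphere (fun z : V => `|dotv z u| ^+ 3).
  by apply: on_sphereX; exact: on_sphere_abs.
have h2 : on_sphere (fun z : V => `|dotv z u| * dotv z h ^+ 2).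
  by apply: on_sphereM => //; apply: on_sphereX; exact: on_sphere_dot.
pose G (a b : R) := a * `|a| * b.
have hG (v k : V) : on_sphere (fun z => G (dotv z v) (dotv z k)).
  apply: on_sphereM; last exact: on_sphere_dot.
  by apply: on_sphereM => //; exact: on_sphere_dot.
set A := Es _; set B := Es _.
suff AB (S : R) : 0 < S -> S <= 1 -> A <= 2 * B + 30 * S.
  apply/ler_addgt0Pr => e e0.
  have m0 : 0 < Num.min 1 (e / 30) by rewrite lt_min ltr01/= divr_gt0.
  apply: le_trans (AB _ m0 _) _; first by rewrite ge_min lexx.
  by rewrite lerD2l mulrC -ler_pdivlMr// ge_min lexx orbT.
move=> S0 S1; pose C := Num.sqrt (1 - S ^+ 2).
have CS : C ^+ 2 + S ^+ 2 = 1 by rewrite sqr_sqrtr ?subrK// subr_ge0; nra.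
have := Es_rotate CS u1 h1 uh (hG u h).
have hl : on_sphere (fun z : V => S * (2 * (`|dotv z u| * dotv z h ^+ 2) - `|dotv z u| ^+ 3)).
  by apply: on_sphereZ; apply: on_sphereB => //; exact: on_sphereZ.
have hr : on_sphere (fun z : V => G (dotv z u) (dotv z h) +
    S * (2 * (`|dotv z u| * dotv z h ^+ 2) - `|dotv z u| ^+ 3) + 30 * S ^+ 2).
  by apply: on_sphereD; [exact: on_sphereD|exact: on_sphere_cst].
have hl' : on_sphere (fun z : V =>
    G (C * dotv z u + S * dotv z h) (C * dotv z h - S * dotv z u)).
  rewrite [X in on_sphere X](_ : _ = fun z => G (dotv z (C *: u + S *: h))
      (dotv z (C *: h - S *: u)))//.
  by apply/funext => z; rewrite dotvBr dotvDr !dotvZr.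
have := le_Es hl' hr.
have eS : Es (fun z => S * (2 * (`|dotv z u| * dotv z h ^+ 2) - `|dotv z u| ^+ 3)) =
    S * (2 * B - A).
  have h2' : on_sphere (fun z : V => 2 * (`|dotv z u| * dotv z h ^+ 2)).
    exact: on_sphereZ.
  rewrite (EsZ _ mZ Z1); last exact: on_sphereB.
  by rewrite (EsB _ mZ Z1 h2' h3) (EsZ _ mZ Z1 _ h2).
rewrite (EsD _ mZ Z1); [|exact: on_sphereD|exact: on_sphere_cst].
rewrite (EsD _ mZ Z1 (hG u h) hl) eS Es_cst => + e; rewrite e => hle.
have : 0 <= S * (2 * B - A + 30 * S).
  suff : 0 <= S * (2 * B - A) + 30 * S ^+ 2 by lra.
  rewrite -(lerD2l (Es (fun z => G (dotv z u) (dotv z h)))) addr0 addrA.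
  apply: hle => z z1; apply: rotate_cubic_le => //.
  - exact: dot_le1.
  - exact: dot_le1.
  - exact: sqrtr_ge0.
  - by rewrite (ltW S0).
by rewrite pmulr_rge0//; lra.
Qed.

(** Both [E |a|] and [E |a|^3] are controlled by the sum of [E (|a| z_i^2)] over an
    orthonormal basis that contains [u], which gives
    [E |a|^3 <= 2 / d * E |a|]; integrate [|a| (|a| - k)^2 >= 0] with
    [k = sqrt (2 / d)]. *)
Lemma sphere_abs_ge u : norm2 u = 1 ->
  (Num.sqrt (2 * d%:R))^-1 <= Es (fun z => `|dotv z u|).
Proof.
move=> u1; pose i0 := Ordinal (unit_vector_dim u1).
have d0 : 0 < d%:R :> R by rewrite ltr0n (unit_vector_dim u1).
pose e := delta_mx 0 i0 : V; have e1 : norm2 e = 1 := norm2_delta i0.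
have ue : norm2 e = norm2 u by rewrite e1 u1.
have -> : Es (fun z => `|dotv z u|) = Es (fun z => `|dotv z e|).
  exact: (Es_vec mZ Z1 Zinv ue (on_sphere_abs e)).
have h2 (i : 'I_d) : on_sphere (fun z : V => `|dotv z e| * dotv z (delta_mx 0 i) ^+ 2).
  by apply: on_sphereM => //; apply: on_sphereX; exact: on_sphere_dot.
have h3 : on_sphere (fun z : V => `|dotv z e| ^+ 3) by exact: on_sphereX.
set m := Es _; pose m3 := Es (fun z => `|dotv z e| ^+ 3).
have m3m : d%:R * m3 <= 2 * m.
  have -> : m = Es (fun z => \sum_(i < d) `|dotv z e| * dotv z (delta_mx 0 i) ^+ 2).
    congr (Ex P _); apply/funext => w; rewrite -mulr_sumr.
    rewrite -[LHS]mulr1 -(expr1n _ 2) -(Z1 w) norm2_sqr; congr (_ * _).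
    by apply: eq_bigr => i _; rewrite dotv_delta expr2.
  rewrite (Es_sum _ mZ Z1)// mulr_sumr mulr_natl -{1}(card_ord d) -sumr_const.
  apply: ler_sum => i _; have [->|ii] := eqVneq i i0.
    have m30 : 0 <= m3.
      rewrite -(Es_cst P Z 0); apply: (le_Es (on_sphere_cst 0) h3) => z _.
      by rewrite exprn_ge0.
    rewrite (_ : Es _ = m3); first lra.
    by congr (Ex P _); apply/funext => w; rewrite -/e -(real_normK (num_real (dotv _ _))) exprS.
  by apply: sphere_abs_cubed_le; rewrite ?norm2_delta// dotv_delta mxE eqxx (negPf ii).
have m2 : Es (fun z => `|dotv z e| ^+ 2) = d%:R^-1.
  rewrite -(sphere_second_moment mZ Z1 Zinv e1); congr (Ex P _); apply/funext => w.
  by rewrite real_normK ?num_real.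
pose k : R := Num.sqrt (2 / d%:R).
have k0 : 0 < k by rewrite sqrtr_gt0 divr_gt0.
have kk : k ^+ 2 = 2 / d%:R by rewrite sqr_sqrtr// divr_ge0// ltW.
have key : 0 <= m3 - 2 * k * d%:R^-1 + k ^+ 2 * m.
  have hX : on_sphere (fun z : V => `|dotv z e| ^+ 2) by exact: on_sphereX.
  have hX' := on_sphereZ (2 * k) hX.
  have hm := on_sphereZ (k ^+ 2) (on_sphere_abs e).
  rewrite -m2 /m3 /m -(EsZ _ mZ Z1 _ hX) -(EsZ _ mZ Z1 _ (on_sphere_abs e)).
  rewrite -(EsB _ mZ Z1 h3 hX') -(EsD _ mZ Z1 (on_sphereB h3 hX') hm).
  have hD : on_sphere (fun z : V =>
      `|dotv z e| ^+ 3 - 2 * k * `|dotv z e| ^+ 2 + k ^+ 2 * `|dotv z e|).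
    by apply: on_sphereD; [apply: on_sphereB => //|]; exact: on_sphereZ.
  rewrite -(Es_cst P Z 0); apply: (le_Es (on_sphere_cst 0) hD) => z _.
  set t := `|_|; have t0 : 0 <= t by exact: normr_ge0.
  have -> : t ^+ 3 - 2 * k * t ^+ 2 + k ^+ 2 * t = t * (t - k) ^+ 2 by ring.
  by rewrite mulr_ge0// sqr_ge0.
have km : k / 2 <= m.
  have dk : d%:R * k ^+ 2 = 2 by rewrite kk mulrCA divff ?mulr1// gt_eqF.
  have : 0 <= d%:R * (m3 - 2 * k * d%:R^-1 + k ^+ 2 * m) by rewrite mulr_ge0// ltW.
  rewrite mulrDr mulrBr mulrA dk mulrCA mulfV ?gt_eqF// mulr1; lra.
apply: le_trans km; rewrite le_eqVlt; apply/orP; left; apply/eqP.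
apply: (@mulIf _ (Num.sqrt (2 * d%:R))); first by rewrite sqrtr_eq0 -ltNge mulr_gt0.
rewrite mulVf ?sqrtr_eq0 -?ltNge ?mulr_gt0//.
rewrite mulrAC /k -sqrtrM ?divr_ge0 ?ltW//.
have -> : 2 / d%:R * (2 * d%:R) = 2 ^+ 2 :> R by field; rewrite gt_eqF.
by rewrite sqrtr_sqr ger0_norm// divff.
Qed.

End SphereMoments.

(** * Elementary inequalities for exponential and trigonometric functions *)

Section Elementary.
Context {R : realType}.
Implicit Types x y t : R.

Lemma ge0_derive_ge0 (f df : R -> R) :
  (forall y, is_derive y 1 f (df y)) -> (forall y, 0 <= y -> 0 <= df y) ->
  forall x, 0 <= x -> f 0 <= f x.
Proof.
move=> hf hdf x x0.
have cf : {within `[0, x], continuous f}.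
  by apply: derivable_within_continuous => y _; exact: ex_derive.
have [c] := MVT_segment x0 (fun y _ => hf y) cf.
rewrite in_itv/= => /andP[c0 _] e.
by rewrite -subr_ge0 e subr0 mulr_ge0// hdf.
Qed.

Lemma sin_le_id x : 0 <= x -> sin x <= x.
Proof.
move=> x0; have := @ge0_derive_ge0 (fun y => y - sin y) (fun y => 1 - cos y).
move=> /(_ _ _ x x0); rewrite sin0 subrr subr_ge0; apply => //.
Qed.

Lemma sinh_le_xcosh x : 0 <= x ->
  expR x - expR (- x) <= x * (expR x + expR (- x)).
Proof.
move=> x0; rewrite -subr_ge0.
pose f y := y * (expR y + expR (- y)) - (expR y - expR (- y)).
have := @ge0_derive_ge0 f (fun y => y * (expR y - expR (- y))).
move=> /(_ _ _ x x0); rewrite /f oppr0 mul0r subrr subr0; apply.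
- move=> y; apply: is_derive_eq.
  by rewrite /GRing.scale/=; ring.
- by move=> y y0; rewrite mulr_ge0// subr_ge0 ler_expR; lra.
Qed.

(** [cosh x * exp (- x^2 / 2)] decreases on the half line, since [sinh <= x cosh]. *)
Lemma cosh_le_gauss x : expR x + expR (- x) <= 2 * expR (x ^+ 2 / 2).
Proof.
wlog x0 : x / 0 <= x.
  move=> h; have [/h//|/ltW x0] := leP 0 x.
  by have := h (- x); rewrite oppr_ge0 opprK sqrrN addrC; apply.
rewrite -ler_pdivrMr ?expR_gt0// -expRN.
pose f y := - ((expR y + expR (- y)) * expR (- (y ^+ 2 / 2))).
have := @ge0_derive_ge0 f (fun y =>
  expR (- (y ^+ 2 / 2)) * (y * (expR y + expR (- y)) - (expR y - expR (- y)))).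
move=> /(_ _ _ x x0); rewrite /f oppr0 expr0n mul0r oppr0 expR0 mulr1 lerN2.
rewrite (_ : 1 + 1 = 2)//; apply.
- move=> y; apply: is_derive_eq.
  by rewrite /GRing.scale/=; field.
- by move=> y y0; rewrite mulr_ge0 ?expR_ge0// subr_ge0 sinh_le_xcosh.
Qed.

Lemma abs_sin_mul_le (n : nat) x : `|sin (n%:R * x)| <= n%:R * `|sin x|.
Proof.
elim: n => [|n ih]; first by rewrite !mul0r sin0 normr0.
rewrite -natr1 !mulrDl !mul1r sinD; apply: le_trans (ler_normD _ _) _.
by apply: lerD; rewrite normrM; [apply: le_trans ih; rewrite ler_piMr// cos_max|
  rewrite ler_piMl// cos_max].
Qed.

(** Solve [cos (3 x) = 0] for [x = pi / 6]. *)
Lemma sin_pi_div6 : sin (pi / 6) = 1 / 2 :> R.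
Proof.
set x := pi / 6; have x3 : x + x + x = pi / 2 by rewrite /x; field.
have p0 := @pi_gt0 R.
have s0 : 0 < sin x by apply: sin_gt0_pi; rewrite /x; lra.
have := cos2Dsin2 x; have := @cos_pihalf R; rewrite -x3 !cosD sinD => h e.
have c0 : 0 < cos x by apply: cos_gt0_pihalf; rewrite /x; lra.
have : cos x * (1 - 4 * sin x ^+ 2) = 0.
  by rewrite -h -{1}e; ring.
move/eqP; rewrite mulf_eq0 gt_eqF//= => /eqP h2.
have : (1 - 2 * sin x) * (1 + 2 * sin x) = 0 by rewrite -h2; ring.
by move/eqP; rewrite mulf_eq0 => /orP[/eqP|/eqP]; lra.
Qed.

(** Sampling a sinusoid [b cos - a sin] at the points [y - D], [y], [y + t]. *)
Lemma sinusoid_recurrence (a b y D t : R) :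
  sin D * (b * cos (y + t) - a * sin (y + t)) =
  sin (t + D) * (b * cos y - a * sin y) -
  sin t * (b * cos (y - D) - a * sin (y - D)).
Proof. by rewrite !(sinD, cosD, cosN, sinN); ring. Qed.

Definition sinusoid (a b D : R) (k : nat) : R :=
  b * cos (k%:R * D) - a * sin (k%:R * D).

(** Sampled at more than [N] points per half period, a sinusoid that has changed
    sign keeps its new sign for the next [N] samples. *)
Lemma sinusoid_same_sign (a b : R) (N j i : nat) :
  let c := sinusoid a b (pi / N.+1%:R) in
  (0 <= c j) != (0 <= c j.+1) -> (j < i <= N)%N -> (0 <= c i) = (0 <= c j.+1).
Proof.
move=> c cj /andP[ji iN]; pose D : R := pi / N.+1%:R.
have N0 : 0 < N.+1%:R :> R by rewrite ltr0n.
have p0 := @pi_gt0 R.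
pose l := (i - j.+1)%N; have il : i = (j.+1 + l)%N by rewrite subnKC.
have := @sinusoid_recurrence a b (j.+1%:R * D) D (l%:R * D).
have -> : j.+1%:R * D - D = j%:R * D by rewrite -natr1; ring.
rewrite -mulrDl -natrD -il.
rewrite -/(sinusoid a b D i) -/(sinusoid a b D j) -/(sinusoid a b D j.+1).
rewrite -/(c i) -/(c j) -/(c j.+1) => e.
have sD : 0 < sin D.
  apply: sin_gt0_pi; rewrite divr_gt0//= ltr_pdivrMr// ltr_pMr// ltr1n.
  by rewrite ltnS; apply: leq_trans iN; apply: leq_ltn_trans ji.
have lN : (l.+1 < N.+1)%N by rewrite ltnS; apply: leq_trans iN; rewrite il; lia.
have pos (n : nat) : (n < N.+1)%N -> n%:R * D < pi.
  by move=> nN; rewrite /D mulrA ltr_pdivrMr// mulrC ltr_pM2l// ltr_nat.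
have D0 : 0 < D by rewrite divr_gt0.
have lD0 : 0 <= l%:R * D by apply: mulr_ge0 => //; exact: ltW.
have sl : 0 <= sin (l%:R * D).
  apply: sin_ge0_pi; rewrite lD0/= ltW// pos//.
  exact: ltn_trans lN.
have sl1 : 0 < sin (l%:R * D + D).
  apply: sin_gt0_pi; apply/andP; split; first exact: ltr_wpDl.
  by rewrite -[X in _ + X]mul1r -mulrDl natr1 pos.
move: cj; have [c0|c0] := leP 0 (c j); have [c1|c1] := leP 0 (c j.+1) => // _.
- apply/negbTE; rewrite -ltNge -(pmulr_rlt0 _ sD) e subr_lt0.
  by apply: lt_le_trans (mulr_ge0 sl c0); rewrite pmulr_rlt0.
- rewrite -(pmulr_rge0 _ sD) e subr_ge0; apply: le_trans (mulr_ge0 (ltW sl1) c1).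
  by apply: mulr_ge0_le0 => //; exact: ltW.
Qed.

Lemma sum_bool_le1 (b : nat -> bool) (N : nat) :
  (forall j k, (j < k)%N -> (k < N)%N -> b j -> ~~ b k) ->
  \sum_(k < N) (b k)%:R <= 1 :> R.
Proof.
elim: N => [|N ih] h; first by rewrite big_ord0.
rewrite big_ord_recr/=; case bN: (b N); last first.
  by rewrite addr0; apply: ih => j k jk kN; apply: h => //; exact: ltnW.
rewrite big1 ?add0r// => i _; case bi: (b i) => //.
by have := h i N (ltn_ord i) (ltnSn N) bi; rewrite bN.
Qed.

Lemma sinusoid_sign_changes (a b : R) (N : nat)
    (c := sinusoid a b (pi / N.+1%:R)) :
  \sum_(k < N) ((0 <= c k) != (0 <= c k.+1))%R%:R <= 1 :> R.
Proof.
apply: (@sum_bool_le1 (fun k => (0 <= c k) != (0 <= c k.+1))).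
move=> j k jk kN cj; rewrite negbK.
rewrite (@sinusoid_same_sign _ _ _ j k) ?jk 1?ltnW//.
by rewrite (@sinusoid_same_sign _ _ _ j k.+1)// kN andbT ltnW.
Qed.

Definition clamp (t x : R) : R := Num.max (- t) (Num.min x t).

Lemma clamp_homo t : {homo clamp t : x y / x <= y}.
Proof.
move=> x y xy; rewrite /clamp ge_max le_max lexx/= le_max le_min !ge_min.
by rewrite xy lexx !orbT.
Qed.

Lemma clamp_id t x : `|x| <= t -> clamp t x = x.
Proof. by rewrite ler_norml => /andP[h1 h2]; rewrite /clamp min_l// max_r. Qed.

Lemma abs_clamp_le t x : 0 <= t -> `|clamp t x| <= t.
Proof.
move=> t0; rewrite ler_norml /clamp le_max lexx/= ge_max ge_min lexx orbT andbT.
by rewrite ge0_cp.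
Qed.

End Elementary.

(** * Thin strips of the sphere *)

Section SphereStrip.
Context {R : realType} {d : nat} {dO : measure_display}.
Context {Omega : measurableType dO}.
Local Notation V := 'rV[R]_d.
Local Notation BV := (borel_rV R d).
Variables (P : probability Omega R) (Z : Omega -> BV).
Hypothesis mZ : measurable_fun setT Z.
Hypothesis Z1 : forall w, norm2 (Z w : V) = 1.
Hypothesis Zinv : forall (U : 'M[R]_d) (A : set BV),
  U *m U^T = 1%:M -> measurable A ->
  P [set w | A ((Z w : V) *m U)] = P [set w | A (Z w)].
Implicit Types (F G : V -> R) (u h z : V).
Local Notation Es := (Es P Z).

Let Es_rotate := Es_rotate mZ Z1 Zinv.
Let le_Es := le_Es P mZ Z1.

Lemma on_sphere_sign_ne (F G : V -> R) : on_sphere F -> on_sphere G ->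
  on_sphere (fun z => ((0 <= F z) != (0 <= G z))%R%:R).
Proof.
move=> [mF _] [mG _].
have mb (H : BV -> R) : measurable_fun setT H ->
    measurable_fun setT (fun z : BV => 0 <= H z).
  by move=> mH; exact: measurable_fun_ler.
apply: on_sphere_bool.
have -> : (fun z : BV => (0 <= F z) != (0 <= G z)) =
   (fun z : BV => if 0 <= F z then ~~ (0 <= G z) else 0 <= G z).
  by apply/funext => z; case: (0 <= F z); case: (0 <= G z).
apply: measurable_fun_ifT; [exact: mb| |exact: mb].
by apply: measurable_neg; exact: mb.
Qed.

Lemma on_sphere_sign (F : V -> R) : on_sphere F -> on_sphere (fun z => sign_pm (F z)).
Proof.
move=> [mF _]; split; last first.
  by exists 1 => z _; rewrite /sign_pm; case: ifP; rewrite ?normrN ?normr1.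
by apply: measurable_fun_ifT => //; exact: measurable_fun_ler.
Qed.

Lemma on_sphere_clamp (t : R) (F : V -> R) : 0 <= t -> on_sphere F ->
  on_sphere (fun z => clamp t (F z)).
Proof.
move=> t0 [mF _]; split; last by exists t => z _; exact: abs_clamp_le.
by apply: measurable_maxr => //; exact: measurable_minr.
Qed.

(** Two linear forms at angle [D] have different signs with probability at most
    [1 / N] if [N + 1] times [D] is a half turn: rotate them [N] times. *)
Lemma sign_change_prob u h (N : nat) (D := pi / N.+1%:R : R) :
  norm2 u = 1 -> norm2 h = 1 -> dotv u h = 0 ->
  N%:R * Es (fun z => ((0 <= dotv z h) !=
     (0 <= cos D * dotv z h - sin D * dotv z u))%R%:R) <= 1.
Proof.
move=> u1 h1 uh; pose G a b : R := ((0 <= b) != (0 <= cos D * b - sin D * a))%R%:R.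
have hG : on_sphere (fun z : V => G (dotv z u) (dotv z h)).
  apply: on_sphere_sign_ne; first exact: on_sphere_dot.
  by apply: on_sphereB; apply: on_sphereZ; exact: on_sphere_dot.
pose c z := sinusoid (dotv z u) (dotv z h) D.
have hc k : on_sphere (fun z : V => c z k).
  by apply: on_sphereB; apply: on_sphereM; (exact: on_sphere_dot || exact: on_sphere_cst).
have hk k := on_sphere_sign_ne (hc k) (hc k.+1).
have e (k : nat) : Es (fun z => G (dotv z u) (dotv z h)) =
    Es (fun z => ((0 <= c z k) != (0 <= c z k.+1))%R%:R).
  rewrite -(Es_rotate (cos2Dsin2 (k%:R * D)) u1 h1 uh hG).
  congr (Ex P _); apply/funext => w; rewrite /G /c /sinusoid.
  set a := dotv _ u; set b := dotv _ h.
  pose F (x y : R) : R := ((0 <= x) != (0 <= y))%R%:R.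
  by rewrite -!/(F _ _); congr F; rewrite ?mulrSr -?natr1 ?mulrDl ?mul1r ?(sinD, cosD); ring.
rewrite mulr_natl -[X in _ *+ X](card_ord N) -sumr_const.
rewrite (eq_bigr (fun k : 'I_N => Es (fun z => ((0 <= c z k) != (0 <= c z k.+1))%R%:R))); last first.
  by move=> k _; exact: e.
rewrite -(Es_sum P mZ Z1)//.
rewrite -[leRHS](Es_cst P Z 1); apply: le_Es; [|exact: on_sphere_cst|].
  split; last first.
    exists 1 => z _; rewrite ger0_norm.
      exact: (sinusoid_sign_changes (dotv z u) (dotv z h) N).
    exact: sumr_ge0.
  by apply: measurable_sum => k; have [] := hk k.
by move=> z _; exact: (sinusoid_sign_changes (dotv z u) (dotv z h) N).
Qed.

Let sign_mul_abs (x : R) : sign_pm x * x = `|x|.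
Proof.
by rewrite /sign_pm; case: leP => x0; rewrite ?mul1r ?mulN1r ?(ger0_norm x0) ?(ltr0_norm x0).
Qed.

(** Let [T] be the clamp at [t + S], so that [T] is the identity on the part of the
    strip that rotations of sine [S] can reach. The mean of
    [sign b * (T (C a + S b) - T (C a - S b))] is at least [2 S] times the mass of
    [|b|] in the strip. Undoing both rotations turns it into the mean of [T a] times a
    difference of two signs, which is nonzero only when two linear forms at angle
    [pi / N.+1] have different signs. *)
Lemma strip_step u h (N : nat) (t : R) (S := sin (pi / N.+1%:R / 2)) :
  0 <= t -> norm2 u = 1 -> norm2 h = 1 -> dotv u h = 0 -> (0 < N)%N ->
  N%:R * S * Es (fun z => `|dotv z h| * (`|dotv z u| <= t)%R%:R) <= t + S.
Proof.
move=> t0 u1 h1 uh N0; pose th : R := pi / N.+1%:R / 2; pose C := cos th.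
have p0 := @pi_gt0 R.
have th0 : 0 < th by rewrite !divr_gt0.
have thp : th < pi / 2.
  by rewrite ltr_pM2r ?invr_gt0// ltr_pdivrMr// ltr_pMr// ltr1n.
have S0 : 0 < S.
  by apply: sin_gt0_pi; apply/andP; split=> //; apply: (lt_trans thp); lra.
have CS : C ^+ 2 + S ^+ 2 = 1 by exact: cos2Dsin2.
have CNS : C ^+ 2 + (- S) ^+ 2 = 1 by rewrite sqrrN.
pose T := clamp (t + S); have tS0 : 0 <= t + S by rewrite addr_ge0// ltW.
have ha : on_sphere (fun z : V => dotv z u) := on_sphere_dot u.
have hb : on_sphere (fun z : V => dotv z h) := on_sphere_dot h.
have hp : on_sphere (fun z : V => C * dotv z h + S * dotv z u).
  by apply: on_sphereD; exact: on_sphereZ.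
have hm : on_sphere (fun z : V => C * dotv z h - S * dotv z u).
  by apply: on_sphereB; exact: on_sphereZ.
have hp' : on_sphere (fun z : V => C * dotv z u + S * dotv z h).
  by apply: on_sphereD; exact: on_sphereZ.
have hm' : on_sphere (fun z : V => C * dotv z u - S * dotv z h).
  by apply: on_sphereB; exact: on_sphereZ.
pose G1 a b : R := sign_pm (C * b + S * a) * T a.
pose G2 a b : R := sign_pm (C * b - S * a) * T a.
pose G3 a b : R := ((0 <= C * b + S * a) != (0 <= C * b - S * a))%R%:R.
have hT := on_sphere_clamp tS0 ha.
have hG1 : on_sphere (fun z : V => G1 (dotv z u) (dotv z h)).
  by apply: on_sphereM => //; exact: on_sphere_sign.
have hG2 : on_sphere (fun z : V => G2 (dotv z u) (dotv z h)).
  by apply: on_sphereM => //; exact: on_sphere_sign.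
have hG3 : on_sphere (fun z : V => G3 (dotv z u) (dotv z h)).
  exact: on_sphere_sign_ne.
have e1 := Es_rotate CS u1 h1 uh hG1.
have e2 := Es_rotate CNS u1 h1 uh hG2.
have e3 := Es_rotate CS u1 h1 uh hG3.
have E3 : N%:R * Es (fun z => G3 (dotv z u) (dotv z h)) <= 1.
  rewrite -e3; apply: le_trans (sign_change_prob N u1 h1 uh).
  rewrite le_eqVlt; apply/orP; left; apply/eqP; congr (_ * Ex P _).
  apply/funext => w; rewrite /G3; set a := dotv _ u; set b := dotv _ h.
  have D2 : pi / N.+1%:R = th + th :> R by rewrite /th -splitr.
  pose F (x y : R) : R := ((0 <= x) != (0 <= y))%R%:R.
  rewrite -!/(F _ _); congr F.
    by rewrite -[RHS]mul1r -CS; ring.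
  by rewrite D2 sinD cosD -/C -/S; ring.
pose X z : R := sign_pm (dotv z h) *
   (T (C * dotv z u + S * dotv z h) - T (C * dotv z u - S * dotv z h)).
have hX : on_sphere X.
  apply: on_sphereM; first exact: on_sphere_sign.
  by apply: on_sphereB; exact: on_sphere_clamp.
have eX : Es X = Es (fun z => T (dotv z u) *
   (sign_pm (C * dotv z h + S * dotv z u) - sign_pm (C * dotv z h - S * dotv z u))).
  transitivity (Es (fun z => G1 (dotv z u) (dotv z h)) - Es (fun z => G2 (dotv z u) (dotv z h))).
    have hr1 : on_sphere (fun z : V => G1 (C * dotv z u + S * dotv z h)
        (C * dotv z h - S * dotv z u)).
      rewrite /G1; apply: on_sphereM; last exact: on_sphere_clamp.
      by apply: on_sphere_sign; apply: on_sphereD; exact: on_sphereZ.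
    have hr2 : on_sphere (fun z : V => G2 (C * dotv z u + - S * dotv z h)
        (C * dotv z h - - S * dotv z u)).
      have ? : on_sphere (fun z : V => C * dotv z u + - S * dotv z h).
        by apply: on_sphereD; exact: on_sphereZ.
      have ? : on_sphere (fun z : V => C * dotv z h - - S * dotv z u).
        by apply: on_sphereB; exact: on_sphereZ.
      rewrite /G2; apply: on_sphereM; last exact: on_sphere_clamp.
      by apply: on_sphere_sign; apply: on_sphereB; exact: on_sphereZ.
    rewrite -e1 -e2 -(EsB P mZ Z1 hr1 hr2).
    congr (Ex P _); apply/funext => w; rewrite /X /G1 /G2.
    set a := dotv _ u; set b := dotv _ h.
    have -> : C * (C * b - S * a) + S * (C * a + S * b) = b.
      by rewrite -[RHS]mul1r -CS; ring.
    have -> : C * (C * b - - S * a) - S * (C * a + - S * b) = b.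
      by rewrite -[RHS]mul1r -CS; ring.
    by rewrite mulNr mulrBr.
  rewrite -(EsB P mZ Z1)//; congr (Ex P _); apply/funext => w.
  by rewrite /G1 /G2 -mulrBl mulrC.
have le1 : 2 * S * Es (fun z => `|dotv z h| * (`|dotv z u| <= t)%R%:R) <= Es X.
  have hM : on_sphere (fun z : V => `|dotv z h| * (`|dotv z u| <= t)%R%:R).
    by apply: on_sphereM; [exact: on_sphere_norm|apply: on_sphere_le; exact: on_sphere_norm].
  rewrite -(EsZ P mZ Z1)//; apply: le_Es => //; first exact: on_sphereZ.
  move=> z z1; have b1 := dot_le1 h1 z1; rewrite /X.
  set a := dotv z u; set b := dotv z h.
  have mono : 0 <= sign_pm b * (T (C * a + S * b) - T (C * a - S * b)).
    rewrite /sign_pm; case: (leP 0 b) => b0.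
      rewrite mul1r subr_ge0; apply: clamp_homo.
      by rewrite lerD2l ge0_cp// mulr_ge0// ltW.
    rewrite mulN1r opprB subr_ge0; apply: clamp_homo.
    by rewrite lerD2l; have := ltW b0; nra.
  case: (leP `|a| t) => at_; last by rewrite !mulr0.
  have Ca : `|C * a| <= t.
    by rewrite normrM; apply: le_trans at_; rewrite ler_piMl// cos_max.
  have Sb : `|S * b| <= S by rewrite normrM (gtr0_norm S0) ler_piMr// ltW.
  rewrite /T !clamp_id.
  - have -> : sign_pm b * (C * a + S * b - (C * a - S * b)) = 2 * S * (sign_pm b * b) by ring.
    by rewrite sign_mul_abs mulr1.
  - by apply: le_trans (ler_normB _ _) _; exact: lerD.
  - by apply: le_trans (ler_normD _ _) _; exact: lerD.
have le2 : Es X <= 2 * (t + S) * Es (fun z => G3 (dotv z u) (dotv z h)).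
  rewrite eX -(EsZ P mZ Z1)//; apply: le_Es.
  - by apply: on_sphereM => //; apply: on_sphereB; exact: on_sphere_sign.
  - exact: on_sphereZ.
  move=> z z1; rewrite /G3 /sign_pm.
  have := abs_clamp_le (dotv z u) tS0; rewrite -/T ler_norml => /andP[T1 T2].
  by case: (0 <= C * dotv z h + S * dotv z u); case: (0 <= C * dotv z h - S * dotv z u) => /=; lra.
set M := Es _ in le1 *; set E := Es _ in E3 le2.
have N0' : 0 < N%:R :> R by rewrite ltr0n.
have : N%:R * (2 * S * M) <= N%:R * (2 * (t + S) * E).
  by rewrite ler_pM2l//; exact: le_trans le2.
have : 2 * (t + S) * (N%:R * E) <= 2 * (t + S) * 1 by rewrite ler_wpM2l// mulr_ge0.
set NE := N%:R * E; have -> : N%:R * (2 * (t + S) * E) = 2 * (t + S) * NE by rewrite /NE; ring.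
lra.
Qed.

(** The bound is linear in the width of the strip with a constant free of the
    dimension: the density of [a] is of order [sqrt d], but [|b|] is of order
    [1 / sqrt d]. It is the limit of the preceding one for small angles; taking
    [3 n] parts of a half turn makes [sin (pi / 6) = 1 / 2] available to bound
    [n * sin (pi / (6 n))] from below. *)
Lemma sphere_strip u h (t : R) :
  0 <= t -> norm2 u = 1 -> norm2 h = 1 -> dotv u h = 0 ->
  Es (fun z => `|dotv z h| * (`|dotv z u| <= t)%R%:R) <= 2 / 3 * t.
Proof.
move=> t0 u1 h1 uh; set M := Es _.
have ha : on_sphere (fun z : V => dotv z u) := on_sphere_dot u.
have hb : on_sphere (fun z : V => dotv z h) := on_sphere_dot h.
have hM : on_sphere (fun z : V => `|dotv z h| * (`|dotv z u| <= t)%R%:R).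
  by apply: on_sphereM; [exact: on_sphere_norm|apply: on_sphere_le; exact: on_sphere_norm].
have M1 : M <= 1.
  rewrite -[leRHS](Es_cst P Z 1); apply: le_Es => //; first exact: on_sphere_cst.
  move=> z z1; have := dot_le1 h1 z1.
  by case: (_ <= t); rewrite ?mulr1 ?mulr0.
suff key (n : nat) : (0 < n)%N -> 3 / 2 * M <= t + 2 / n%:R.
  apply/ler_addgt0Pr => e e0.
  have [n ne] : exists n : nat, 2 / e < n.+1%:R.
    by exists (Num.truncn (2 / e)); rewrite truncnS_gt.
  have := key n.+1 isT.
  have : 2 / n.+1%:R <= e by rewrite ler_pdivrMr// mulrC -ler_pdivrMr// ltW.
  set x := 2 / _; lra.
move=> n0; pose N := (3 * n).-1.
have NS : N.+1 = (3 * n)%N by rewrite prednK// muln_gt0.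
have Npos : (0 < N)%N by rewrite /N; lia.
have := strip_step t0 u1 h1 uh Npos; rewrite -/M NS.
set S := sin _ => hS; have p0 := @pi_gt0 R.
have n0' : 0 < n%:R :> R by rewrite ltr0n.
have th : pi / (3 * n)%:R / 2 = pi / 6 / n%:R :> R.
  by rewrite natrM; field; rewrite gt_eqF.
have S0 : 0 <= S.
  apply: sin_ge0_pi; rewrite th; apply/andP; split.
    by rewrite !divr_ge0// ltW.
  rewrite ler_pdivrMr// ler_pdivrMr// -mulrA ler_peMr ?ltW//.
  have : 1 <= n%:R :> R by rewrite ler1n.
  lra.
have nS : 1 / 2 <= n%:R * S.
  rewrite -sin_pi_div6; have -> : pi / 6 = n%:R * (pi / (3 * n)%:R / 2) :> R.
    by rewrite th [RHS]mulrC divfK// gt_eqF.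
  by apply: le_trans (ler_norm _) _; apply: le_trans (abs_sin_mul_le _ _) _; rewrite -/S ger0_norm.
have Sn : S <= 1 / n%:R.
  apply: le_trans (sin_le_id _) _; first by rewrite !divr_ge0// ltW.
  rewrite th ler_pM2r ?invr_gt0//; have := @pihalf_lt2 R; lra.
have NE : N%:R = 3 * n%:R - 1 :> R.
  by rewrite -natrM -NS -natr1 addrK.
rewrite NE in hS; have SM : S * M <= S by rewrite ler_piMr.
have M0 : 0 <= M.
  rewrite -[leLHS](Es_cst P Z 0); apply: (le_Es (on_sphere_cst _) hM) => z _.
  by rewrite mulr_ge0.
have : 1 / 2 * M <= n%:R * S * M by rewrite ler_wpM2r.
have -> : 2 / n%:R = 2 * (1 / n%:R) :> R by rewrite mulrA mulr1.
have : (3 * n%:R - 1) * S * M = 3 * (n%:R * S * M) - S * M by ring.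
lra.
Qed.

(** Exchanging the roles of [u] and [h] on the part where [|b| > t] only helps:
    [(|a| - |b|) (1_{|a| <= t} - 1_{|b| <= t}) <= 0]. *)
Lemma sphere_strip_self u h (t : R) :
  0 <= t -> norm2 u = 1 -> norm2 h = 1 -> dotv u h = 0 ->
  Es (fun z => `|dotv z u| * (`|dotv z u| <= t)%R%:R) <= 2 / 3 * t.
Proof.
move=> t0 u1 h1 uh; apply: le_trans (sphere_strip t0 u1 h1 uh).
pose G (a b : R) : R := (`|a| - `|b|) * (`|a| <= t)%R%:R.
have hn (v : V) : on_sphere (fun z => `|dotv z v|).
  by apply: on_sphere_norm; exact: on_sphere_dot.
have hle (v : V) := on_sphere_le t (hn v).
have hG (v k : V) : on_sphere (fun z => G (dotv z v) (dotv z k)).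
  by apply: on_sphereM => //; exact: on_sphereB.
have hu : dotv h u = 0 by rewrite dotvC.
have swap := Es_pair mZ Z1 Zinv u1 h1 uh h1 u1 hu (hG u h).
have : Es (fun z => G (dotv z u) (dotv z h)) + Es (fun z => G (dotv z h) (dotv z u)) <= 0.
  rewrite -(EsD P mZ Z1)// -[leRHS](Es_cst P Z 0); apply: le_Es.
  - exact: on_sphereD.
  - exact: on_sphere_cst.
  move=> z _; rewrite /G; case: (leP `|dotv z u| t) => h3; case: (leP `|dotv z h| t) => h4 /=; lra.
rewrite swap; have -> : Es (fun z => G (dotv z u) (dotv z h)) =
   Es (fun z => `|dotv z u| * (`|dotv z u| <= t)%R%:R) -
   Es (fun z => `|dotv z h| * (`|dotv z u| <= t)%R%:R).
  rewrite -(EsB P mZ Z1); [|exact: on_sphereM..].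
  by congr (Ex P _); apply/funext => w; rewrite /G mulrBl.
lra.
Qed.

End SphereStrip.

(** * Laplace transform and correlation with a noisy sign *)

Section SphereLaplace.
Context {R : realType} {d : nat} {dO : measure_display}.
Context {Omega : measurableType dO}.
Local Notation V := 'rV[R]_d.
Local Notation BV := (borel_rV R d).
Variables (P : probability Omega R) (Z : Omega -> BV).
Hypothesis mZ : measurable_fun setT Z.
Hypothesis Z1 : forall w, norm2 (Z w : V) = 1.
Hypothesis Zinv : forall (U : 'M[R]_d) (A : set BV),
  U *m U^T = 1%:M -> measurable A ->
  P [set w | A ((Z w : V) *m U)] = P [set w | A (Z w)].
Implicit Types (F G : V -> R) (u h z : V).
Local Notation Es := (Es P Z).

Let le_Es := le_Es P mZ Z1.

Lemma diag_sign_orthogonal (s : {ffun 'I_d -> bool}) :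
  let D := diag_mx (\row_i (-1) ^+ s i) : 'M[R]_d in D *m D^T = 1%:M.
Proof.
rewrite /= tr_diag_mx mulmx_diag -diag_const_mx; congr diag_mx.
by apply/rowP => i; rewrite !mxE -expr2 sqrr_sign.
Qed.

(** Rotating [v] onto the diagonal direction makes all the coordinates equal;
    averaging over the signs of the coordinates of [z] then leaves a product of
    hyperbolic cosines. *)
Lemma sphere_laplace v :
  Es (fun z => expR (dotv z v)) <= expR (norm2 v ^+ 2 / (2 * d%:R)).
Proof.
have [d0|d0] := posnP d.
  have zv (z : V) : dotv z v = 0.
    by rewrite /dotv big1// => i; move: (ltn_ord i); rewrite {2}d0 ltn0.
  rewrite {1}(_ : (fun z => expR (dotv z v)) = fun=> 1); last first.
    by apply/funext => z; rewrite zv expR0.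
  by rewrite Es_cst; apply: le_trans (expR_ge1Dx _); rewrite lerDl divr_ge0// sqr_ge0.
have dR : 0 < d%:R :> R by rewrite ltr0n.
pose k : R := norm2 v / Num.sqrt d%:R.
have k2 : k ^+ 2 = norm2 v ^+ 2 / d%:R.
  by rewrite /k expr_div_n (sqr_sqrtr (ltW dR)).
pose v0 : V := const_mx k.
have nv0 : norm2 v0 = norm2 v.
  rewrite /norm2 [X in Num.sqrt X](_ : _ = norm2 v ^+ 2).
    by rewrite sqrtr_sqr ger0_norm ?norm2_ge0.
  rewrite /dotv (eq_bigr (fun=> k ^+ 2)); last by move=> i _; rewrite mxE expr2.
  by rewrite sumr_const card_ord k2 -[LHS]mulr_natr divfK// gt_eqF.
have hv (y : V) : on_sphere (fun z => expR (dotv z y)).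
  by apply: on_sphere_expR; exact: on_sphere_dot.
rewrite (Es_vec mZ Z1 Zinv nv0 (hv v0)).
pose D (s : {ffun 'I_d -> bool}) : 'M[R]_d := diag_mx (\row_i (-1) ^+ s i).
have hs s : Es (fun z => expR (dotv (z *m D s) v0)) = Es (fun z => expR (dotv z v0)).
  exact: (Es_orthogonal mZ Z1 Zinv (hv v0) (diag_sign_orthogonal s)).
have hD s : on_sphere (fun z : V => expR (dotv (z *m D s) v0)).
  by under eq_fun do rewrite dotv_mul; exact: hv.
set E := Es _; set B := expR _.
have : 2 ^+ d * E <= 2 ^+ d * B; last by rewrite ler_pM2l// exprn_gt0.
have -> : 2 ^+ d * E = Es (fun z => \sum_s expR (dotv (z *m D s) v0)).
  rewrite (Es_sum P mZ Z1)// (eq_bigr (fun=> E)); last by move=> s _; exact: hs.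
  by rewrite sumr_const card_ffun card_bool card_ord -[RHS]mulr_natl natrX.
rewrite -[leRHS](Es_cst P Z); apply: le_Es; [|exact: on_sphere_cst|].
  split; first by apply: measurable_sum => s; have [] := hD s.
  exists (\sum_(s : {ffun 'I_d -> bool}) expR (norm2 v0)) => z z1.
  rewrite ger0_norm; last by apply: sumr_ge0 => s _; exact: expR_ge0.
  apply: ler_sum => s _; rewrite ler_expR; apply: le_trans (dotv_le _ _) _.
  by rewrite norm2_orthogonal ?z1 ?mul1r//; exact: diag_sign_orthogonal.
move=> z z1.
have -> : \sum_s expR (dotv (z *m D s) v0) =
    \sum_(s : {ffun 'I_d -> bool}) \prod_(i < d) expR ((-1) ^+ s i * (k * z 0 i)).
  apply: eq_bigr => s _; rewrite /dotv expR_sum; apply: eq_bigr => i _.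
  by congr expR; rewrite mul_mx_diag !mxE; ring.
rewrite -(bigA_distr_bigA (fun (i : 'I_d) (b : bool) => expR ((-1) ^+ b * (k * z 0 i)))).
have -> : 2 ^+ d * B = \prod_(i < d) (2 * expR ((k * z 0 i) ^+ 2 / 2)).
  rewrite big_split/= prodr_const card_ord; congr (_ * _).
  rewrite -expR_sum; congr expR.
  transitivity (k ^+ 2 / 2 * norm2 z ^+ 2).
    by rewrite z1 k2; field; rewrite gt_eqF.
  by rewrite norm2_sqr /dotv mulr_sumr; apply: eq_bigr => i _; ring.
apply: ler_prod => i _; rewrite big_bool/= expr1 expr0 mulN1r mul1r.
by rewrite addr_ge0 ?expR_ge0//= addrC; exact: cosh_le_gauss.
Qed.

Variables (s : V -> R) (t : R) (u : V).
Hypothesis ms : measurable_fun setT (s : BV -> R).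
Hypothesis s_pm1 : forall z, s z = 1 \/ s z = - 1.
Hypothesis t0 : 0 <= t.
Hypothesis u1 : norm2 u = 1.
Hypothesis s_pos : forall z, norm2 z = 1 -> 0 <= dotv z u -> s z = 1.
Hypothesis s_neg : forall z, norm2 z = 1 -> dotv z u < - t -> s z = - 1.

Lemma on_sphere_pm1 : on_sphere s.
Proof.
by split=> //; exists 1 => z _; have [->|->] := s_pm1 z; rewrite ?normrN normr1.
Qed.

(** A sign pattern that agrees with the sign of [dotv z u] outside a thin strip
    keeps most of its correlation with [u]. *)
Lemma sign_correlation_along h : norm2 h = 1 -> dotv u h = 0 ->
  (Num.sqrt (2 * d%:R))^-1 - 2 / 3 * t <= Es (fun z => s z * dotv z u).
Proof.
move=> h1 uh; have hs := on_sphere_pm1.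
have ha (v : V) : on_sphere (fun z => `|dotv z v|).
  by apply: on_sphere_norm; exact: on_sphere_dot.
pose G a : R := `|a| * ((- t <= a)%R%:R * (a < 0)%R%:R).
have hG (v : V) : on_sphere (fun z => G (dotv z v)).
  apply: on_sphereM => //; apply: on_sphereM; first exact/on_sphere_ge/on_sphere_dot.
  apply: on_sphere_bool; apply: measurable_fun_ltr => //.
  by have [] := @on_sphere_dot R d v.
have hM : on_sphere (fun z : V => `|dotv z u| * (`|dotv z u| <= t)%R%:R).
  by apply: on_sphereM => //; exact: on_sphere_le.
have refl : Es (fun z => G (dotv z (- u))) = Es (fun z => G (dotv z u)).
  by apply: (Es_vec mZ Z1 Zinv (G := G)) => //; rewrite norm2N.
have strip : 2 * Es (fun z => G (dotv z u)) <= 2 / 3 * t.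
  apply: le_trans (sphere_strip_self mZ Z1 Zinv t0 u1 h1 uh).
  rewrite mulrDl mul1r -{2}refl -(EsD P mZ Z1)//; apply: le_Es => //.
    exact: on_sphereD.
  move=> z _; rewrite /G dotvNr; set a := dotv z u; rewrite normrN ler_norml.
  rewrite !lerN2 oppr_lt0.
  by case: (leP (- t) a) => h2; case: (leP a t) => h3; case: (ltP a 0) => h4;
    case: (ltP 0 a) => h5; have := normr_ge0 a => /=; lra.
have := sphere_abs_ge mZ Z1 Zinv u1.
have : Es (fun z => `|dotv z u|) - 2 * Es (fun z => G (dotv z u)) <=
    Es (fun z => s z * dotv z u).
  have h2G : on_sphere (fun z : V => 2 * G (dotv z u)) by exact: on_sphereZ.
  rewrite -(EsZ P mZ Z1 _ (hG u)) -(EsB P mZ Z1 (ha u) h2G); apply: le_Es.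
  - exact: on_sphereB.
  - by apply: on_sphereM => //; exact: on_sphere_dot.
  move=> z z1; rewrite /G; have := s_pos z1; have := s_neg z1; have := s_pm1 z.
  set a := dotv z u => hpm hn hp.
  have [a0|a0] := leP 0 a; first by rewrite hp// (ger0_norm a0) !mulr0; lra.
  rewrite (ltr0_norm a0); have [ta|ta] := leP (- t) a.
    by case: hpm => ->; rewrite /= ?mulr1; lra.
  by rewrite hn//=; lra.
lra.
Qed.

(** The exact sign of [dotv z u] has correlation zero with [h], by the symmetry
    [h -> - h]. The pattern [s] differs from it only on the half strip [- t <= a < 0],
    and the positive part of [b] carries half of the mass of [|b|] there. *)
Lemma sign_correlation_across h : norm2 h = 1 -> dotv u h = 0 ->
  Es (fun z => s z * dotv z h) <= t / 3.
Proof.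
move=> h1 uh; have hs := on_sphere_pm1.
have ha (v : V) : on_sphere (fun z => dotv z v) := on_sphere_dot v.
have hn (v : V) : on_sphere (fun z => `|dotv z v|) by apply: on_sphere_norm.
have hlt (v : V) : on_sphere (fun z : V => (dotv z v < 0)%R%:R).
  by apply: on_sphere_bool; apply: measurable_fun_ltr => //; have [] := ha v.
(* [G] is twice the positive part of [b] on the half strip where [s] may be wrong. *)
pose I a : R := (- t <= a)%R%:R * (a < 0)%R%:R.
have hI (v : V) : on_sphere (fun z => I (dotv z v)).
  by apply: on_sphereM => //; exact/on_sphere_ge.
pose G a b : R := (`|b| + b) * I a.
pose H a b : R := sign_pm a * b.
have hG (v k : V) : on_sphere (fun z => G (dotv z v) (dotv z k)).
  by apply: on_sphereM => //; exact: on_sphereD.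
have hH (v k : V) : on_sphere (fun z => H (dotv z v) (dotv z k)).
  by apply: on_sphereM => //; exact: on_sphere_sign.
have u1' : norm2 (- u) = 1 by rewrite norm2N.
have h1' : norm2 (- h) = 1 by rewrite norm2N.
have uh1 : dotv u (- h) = 0 by rewrite dotvNr uh oppr0.
have uh2 : dotv (- u) h = 0 by rewrite dotvNl uh oppr0.
have uh3 : dotv (- u) (- h) = 0 by rewrite dotvNl uh1 oppr0.
have H0 : Es (fun z => H (dotv z u) (dotv z h)) = 0.
  have := Es_pair mZ Z1 Zinv u1 h1 uh u1 h1' uh1 (hH u h).
  have -> : Es (fun z => H (dotv z u) (dotv z (- h))) =
      Es (fun z => -1 * H (dotv z u) (dotv z h)).
    by congr (Ex P _); apply/funext => w; rewrite dotvNr /H mulrN mulN1r.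
  by rewrite (EsZ P mZ Z1)//; lra.
have G4 : 4 * Es (fun z => G (dotv z u) (dotv z h)) <=
    2 * Es (fun z => `|dotv z h| * (`|dotv z u| <= t)%R%:R).
  have e1 := Es_pair mZ Z1 Zinv u1 h1 uh u1 h1' uh1 (hG u h).
  have e2 := Es_pair mZ Z1 Zinv u1 h1 uh u1' h1 uh2 (hG u h).
  have e3 := Es_pair mZ Z1 Zinv u1 h1 uh u1' h1' uh3 (hG u h).
  have -> : 4 * Es (fun z => G (dotv z u) (dotv z h)) =
     Es (fun z => (G (dotv z u) (dotv z h) + G (dotv z u) (dotv z (- h))) +
                  (G (dotv z (- u)) (dotv z h) + G (dotv z (- u)) (dotv z (- h)))).
    rewrite (EsD P mZ Z1); [|exact: on_sphereD..].
    by rewrite !(EsD P mZ Z1)// e1 e2 e3; lra.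
  have hM : on_sphere (fun z : V => `|dotv z h| * (`|dotv z u| <= t)%R%:R).
    by apply: on_sphereM => //; exact: on_sphere_le.
  rewrite -(EsZ P mZ Z1)//; apply: le_Es.
  - by apply: on_sphereD; exact: on_sphereD.
  - exact: on_sphereZ.
  move=> z _; rewrite /G /I !dotvNr; set a := dotv z u; set b := dotv z h.
  rewrite normrN ler_norml !lerN2 oppr_lt0.
  by case: (leP (- t) a) => h2; case: (leP a t) => h3; case: (ltP a 0) => h4;
    case: (ltP 0 a) => h5; have := normr_ge0 b => /=; lra.
have := sphere_strip mZ Z1 Zinv t0 u1 h1 uh.
have : Es (fun z => s z * dotv z h) <=
   Es (fun z => H (dotv z u) (dotv z h)) + Es (fun z => G (dotv z u) (dotv z h)).
  rewrite -(EsD P mZ Z1)//; apply: le_Es.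
  - exact: on_sphereM.
  - exact: on_sphereD.
  move=> z z1; rewrite /G /H /I /sign_pm.
  have := s_pos z1; have := s_neg z1; have := s_pm1 z.
  set a := dotv z u; set b := dotv z h => hpm hn' hp.
  have [a0|a0] := leP 0 a; first by rewrite hp//= ; lra.
  have [ta|ta] := leP (- t) a; last by rewrite hn'//=; lra.
  by have := ler_norm b; have := ler_norm (- b); rewrite normrN;
    case: hpm => -> /=; lra.
rewrite H0; lra.
Qed.

End SphereLaplace.

(** * Smooth convex functions with a nearest minimizer *)

Section Calculus.
Context {R : realType} {d : nat}.
Local Notation V := 'rV[R]_d.
Implicit Types (f : V -> R) (x y h : V).

Lemma derive_grad f x h : differentiable f x -> 'D_h f x = dotv (grad f x) h.
Proof.
move=> df; rewrite deriveE// {1}(row_sum_delta h) linear_sum; apply: eq_bigr => i _.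
by rewrite linearZ/= -deriveE// mxE mulrC.
Qed.

Lemma is_derive_line f x h (t : R) : (forall y, differentiable f y) ->
  is_derive t 1 (fun s : R => f (x + s *: h)) (dotv (grad f (x + t *: h)) h).
Proof.
move=> df; pose y := x + t *: h.
have e : (fun s : R => s^-1 *: (((fun s : R => f (x + s *: h)) \o shift t) (s *: 1) -
    f (x + t *: h))) = (fun s : R => s^-1 *: ((f \o shift y) (s *: h) - f y)).
  apply/funext => s /=; congr (_ *: (f _ - _)).
  by rewrite /y [s *: 1]mulr1 scalerDl addrCA.
have dy : derivable f y h by exact: diff_derivable.
apply: DeriveDef; first by rewrite /derivable e.
by rewrite /derive e -/(derive f y h) derive_grad.
Qed.

Lemma continuous_sumr (I : Type) (r : seq I) (F : I -> V -> R) :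
  (forall i, continuous (F i)) -> continuous (fun x => \sum_(i <- r) F i x).
Proof.
move=> cF; elim: r => [|i r ih] x.
  rewrite (_ : (fun x => _) = cst 0); first exact: cst_continuous.
  by apply/funext => y; rewrite big_nil.
rewrite (_ : (fun x => _) = (fun x => F i x + \sum_(j <- r) F j x)).
  by apply: continuousD; [exact: cF|exact: ih].
by apply/funext => y; rewrite big_cons.
Qed.

Lemma continuous_norm2B x : continuous (fun z : V => norm2 (x - z)).
Proof.
have cdot : continuous (fun z : V => dotv (x - z) (x - z)); last first.
  by move=> z; exact: (continuous_comp (cdot z) (@sqrt_continuous R _)).
apply: continuous_sumr => i z.
have cB : {for z, continuous (fun z : V => (x - z) 0 i)}.
  rewrite (_ : (fun z => _) = (fun z : V => x 0 i - z 0 i)).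
    by apply: continuousB; [exact: cst_continuous|exact: coord_continuous].
  by apply/funext => y; rewrite !mxE.
exact: continuousM.
Qed.

Section Smooth.
Variables (f : V -> R) (L : R).
Hypothesis df : forall x, differentiable f x.
Hypothesis Lf : forall x y, norm2 (grad f x - grad f y) <= L * norm2 (x - y).

Let grad_line x h (t : R) : 0 <= t ->
  `|dotv (grad f (x + t *: h)) h - dotv (grad f x) h| <= L * t * norm2 h ^+ 2.
Proof.
move=> t0; rewrite -dotvBl; apply: le_trans (cauchy_schwarz _ _) _.
have -> : L * t * norm2 h ^+ 2 = L * norm2 (x + t *: h - x) * norm2 h.
  by rewrite addrC addKr norm2Z ger0_norm//; ring.
by rewrite ler_wpM2r ?norm2_ge0.
Qed.

(** Along the segment from [x] to [x + h], the quadratic minus [e] times the deviation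
    from the tangent is nondecreasing for every [|e| <= 1]; take [e = 1] and
    [e = - 1]. *)
Lemma smooth_bounds x h :
  `|f (x + h) - f x - dotv (grad f x) h| <= L / 2 * norm2 h ^+ 2.
Proof.
have key (e : R) : `|e| <= 1 ->
    0 <= L / 2 * norm2 h ^+ 2 - e * (f (x + h) - f x - dotv (grad f x) h).
  move=> e1; pose g t : R := L / 2 * norm2 h ^+ 2 * t ^+ 2 -
    e * (f (x + t *: h) - t * dotv (grad f x) h).
  have := @ge0_derive_ge0 _ g (fun t => L * t * norm2 h ^+ 2 -
    e * (dotv (grad f (x + t *: h)) h - dotv (grad f x) h)).
  move=> /(_ _ _ 1 ler01); rewrite /g expr0n/= mulr0 mul0r subr0 scale0r addr0.
  rewrite expr1n mulr1 mul1r scale1r sub0r => H.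
  suff : - (e * f x) <= L / 2 * norm2 h ^+ 2 - e * (f (x + h) - dotv (grad f x) h) by lra.
  apply: H => [t|t t0].
    have H1 := is_derive_line x h t df.
    by apply: is_derive_eq; rewrite /GRing.scale/=; field.
  rewrite /= subr_ge0; apply: le_trans (ler_norm _) _; rewrite normrM.
  by apply: le_trans (grad_line x h t0); rewrite ler_piMl.
have := key 1; have := key (-1); rewrite normrN normr1 lexx => /(_ isT) h1 /(_ isT) h2.
by rewrite ler_norml; apply/andP; split; lra.
Qed.

Lemma smooth_le x h : f (x + h) <= f x + dotv (grad f x) h + L / 2 * norm2 h ^+ 2.
Proof. by have := smooth_bounds x h; rewrite ler_norml => /andP[_]; lra. Qed.

Hypothesis L0 : 0 < L.
Hypothesis cf : convex_function [set: convex_lmodType V] f.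

Lemma convex_tangent_le x y : f x + dotv (grad f x) (y - x) <= f y.
Proof.
pose h := y - x; apply/ler_addgt0Pr => e e0.
pose B := L / 2 * norm2 h ^+ 2 + 1.
have B0 : 0 < B by rewrite ltr_wpDl// mulr_ge0 ?sqr_ge0// divr_ge0// ltW.
pose t := Num.min 1 (e / B).
have t0 : 0 < t by rewrite lt_min ltr01 divr_gt0.
have t1 : t <= 1 by rewrite ge_min lexx.
have tB : t * B <= e by rewrite -ler_pdivlMr// ge_min lexx orbT.
have cv : f (x + t *: h) <= t * f y + (1 - t) * f x.
  have := cf (Itv01 (ltW t0) t1) (in_setT y) (in_setT x).
  rewrite convRE/= /onem; apply: le_trans; rewrite le_eqVlt; apply/orP; left.
  by apply/eqP; congr f; rewrite /conv/= /onem /h scalerBr scalerBl scale1r addrCA addrC.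
have := smooth_bounds x (t *: h); rewrite ler_norml => /andP[lo _].
rewrite norm2Z exprMn (gtr0_norm t0) dotvZr in lo.
have : t * (f x + dotv (grad f x) h - f y - t * B) <= 0.
  by rewrite /B; nra.
by rewrite pmulr_rle0//; lra.
Qed.

Lemma smooth_descent x : f (x - L^-1 *: grad f x) <= f x - (2 * L)^-1 * norm2 (grad f x) ^+ 2.
Proof.
have := smooth_le x (- (L^-1 *: grad f x)).
rewrite dotvNr dotvZr norm2N norm2Z exprMn -norm2_sqr.
rewrite (gtr0_norm (_ : 0 < L^-1)) ?invr_gt0//.
set n := norm2 _ ^+ 2 => h; apply: le_trans h _.
by rewrite le_eqVlt; apply/orP; left; apply/eqP; field; rewrite gt_eqF.
Qed.

Lemma grad_argmin x : argmin f x -> grad f x = 0.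
Proof.
move=> /(_ (x - L^-1 *: grad f x)) h; have := le_trans h (smooth_descent x).
rewrite -subr_ge0 addrAC subrr sub0r oppr_ge0 pmulr_rle0 ?invr_gt0 ?mulr_gt0//.
move=> n0; apply/eqP; rewrite -norm2_eq0 -sqrf_eq0; apply/eqP/le_anti.
by rewrite n0 sqr_ge0.
Qed.

(** Comparing the tangent at [x] with the quadratic upper bound at the minimizer
    [p], both taken at [p + L^-1 grad f x]. *)
Lemma grad_dot_argmin x p : argmin f p ->
  f x - f p + (2 * L)^-1 * norm2 (grad f x) ^+ 2 <= dotv (grad f x) (x - p).
Proof.
move=> mp; set g := grad f x.
have := convex_tangent_le x (p + L^-1 *: g); rewrite -/g.
have := smooth_le p (L^-1 *: g); rewrite grad_argmin// dotv0l addr0.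
rewrite norm2Z exprMn (gtr0_norm (_ : 0 < L^-1)) ?invr_gt0//.
have -> : dotv g (p + L^-1 *: g - x) = L^-1 * norm2 g ^+ 2 - dotv g (x - p).
  by rewrite !(dotvBr, dotvDr, dotvZr) norm2_sqr; ring.
set n := norm2 g ^+ 2; set fp := f (_ + _) => h1 h2.
have -> : (2 * L)^-1 * n = L^-1 * n - L / 2 * (L^-1 ^+ 2 * n).
  by field; rewrite gt_eqF.
lra.
Qed.

Lemma gap_le_argmin x p : argmin f p -> f x - f p <= L / 2 * norm2 (x - p) ^+ 2.
Proof.
move=> mp; have := smooth_le p (x - p).
by rewrite grad_argmin// dotv0l addr0 addrC subrK; lra.
Qed.

Lemma minval_argmin p : argmin f p -> minval f = f p.
Proof.
move=> mp; apply/le_anti/andP; split.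
  by apply: ge_inf; [exists (f p) => _ [y _ <-]; exact: mp|exists p].
by apply: lb_le_inf; [exists (f p), p|move=> _ [y _ <-]; exact: mp].
Qed.

(** A minimizer nearer to [x] than [a] lies in a bounded part of the closed set
    [f <= f a], on which the distance to [x] attains its minimum. *)
Lemma proj_argminP x : argmin f !=set0 ->
  argmin f (proj_argmin f x) /\
  forall w, argmin f w -> norm2 (x - proj_argmin f x) <= norm2 (x - w).
Proof.
move=> [a ma].
pose N := [set z | argmin f z /\
    forall w, argmin f w -> norm2 (x - z) <= norm2 (x - w)].
suff ex : exists z, N z by exact: (@xgetPex _ 0 N ex).
pose r := norm2 (x - a).
pose box := [set z : V | forall i, (z ord0 i) \in `[x ord0 i - r, x ord0 i + r]].
pose A := box `&` [set z : V | f z <= f a].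
have ff : continuous f by move=> z; exact: differentiable_continuous.
have cA : compact A.
  have cl : closed [set z : V | f z <= f a].
    by move/continuous_closedP : ff => /(_ _ (@closed_le R (f a))).
  apply: compact_closedI cl.
  apply: (@rV_compact _ _ (fun i => `[x ord0 i - r, x ord0 i + r]%classic)) => i.
  exact: segment_compact.
have near_box w : norm2 (x - w) <= r -> box w.
  move=> wr i; have := le_trans (coord_le_norm2 (x - w) i) wr.
  by rewrite !mxE in_itv/= ler_norml => /andP[h1 h2]; apply/andP; split; lra.
have A0 : A !=set0 by exists a; split=> //=; exact: near_box.
have [p pA pmin] := EVT_min_rV A0 cA (continuous_subspaceT (@continuous_norm2B x)).
have [pb fp] : A p by exact: set_mem.
have mp : argmin f p by move=> y; exact: le_trans fp (ma y).
have Aa : A a by split=> //=; exact: near_box.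
exists p; split=> // w mw; have [wr|rw] := leP (norm2 (x - w)) r.
  by apply: pmin; apply/mem_set; split; [exact: near_box|exact: mw].
by apply: le_trans (ltW rw); apply: pmin; exact/mem_set.
Qed.

End Smooth.
End Calculus.

(** * One descent step and the number of steps *)

Section Descent.
Context {R : realType}.

(** [x / (21 / 5 - 2 x)] is the factor by which the thickness of the strip can tilt
    the estimate; the loss of twice this factor must leave room for the curvature
    [2 x (c - x)]. *)
Lemma alignment_budget (x c : R) : 0 <= x -> x <= c -> c <= 1 ->
  2 * x * (c - x) <= c - 2 * (x / (21 / 5 - 2 * x)).
Proof.
move=> x0 xc c1; have q0 : 0 < 21 / 5 - 2 * x by lra.
set e := x / _; have eE : e * (21 / 5 - 2 * x) = x by rewrite divfK// gt_eqF.
have [x2|x2] := leP (2 * x) 1.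
  have : 2 * e <= x by nra.
  by nra.
have : 2 * e <= 1 - 2 * x + 2 * x ^+ 2.
  have c3 : 0 <= (1 - x) ^+ 3 by rewrite exprn_ge0//; lra.
  rewrite -(ler_pM2r q0) -mulrA eE -subr_ge0.
  have -> : (1 - 2 * x + 2 * x ^+ 2) * (21 / 5 - 2 * x) - 2 * x =
    4 * (1 - x) ^+ 3 + (x ^+ 2 + (1 - x) ^+ 2) / 5 by field.
  apply: addr_ge0; first exact: mulr_ge0.
  by apply: divr_ge0 => //; apply: addr_ge0; exact: sqr_ge0.
nra.
Qed.

(** [u] is the direction of the gradient, [v] the direction away from the
    minimizers, [c] the cosine of their angle, and [x] the curvature ratio that
    limits both the accuracy of the estimate [g] and, through [b], the rate that is
    needed. *)
Lemma estimate_alignment (d : nat) (u v g : 'rV[R]_d) (x b eta gamma : R)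
    (c := dotv u v) (y := norm2 (g - dotv g u *: u)) :
  norm2 u = 1 -> norm2 v = 1 -> norm2 g <= 1 ->
  0 <= x -> x <= c -> b <= 2 * x * (c - x) ->
  0 < eta -> eta <= 1 / 2 -> 0 <= gamma -> gamma <= eta ^+ 2 / 4 ->
  1 - dotv g u <= x / (21 / 5 - 2 * x) * y + gamma ->
  b - eta <= dotv g v.
Proof.
move=> u1 v1 g1 x0 xc bx e0 e1 ga0 gae; set ep := x / _ => H.
have uu := dotv_self1 u1; have vv := dotv_self1 v1.
have c1 : c <= 1 by have := dotv_le u v; rewrite u1 v1 mulr1.
have c0 : 0 <= c by exact: le_trans xc.
set q := dotv g u in y H.
have y0 : 0 <= y := norm2_ge0 _.
have qy : q ^+ 2 + y ^+ 2 <= 1.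
  rewrite /y norm2_sqr !(dotvBl, dotvBr, dotvZl, dotvZr) uu (dotvC u g) -/q.
  have := ler_sqr (x := norm2 g) (y := 1); rewrite nnegrE norm2_ge0 nnegrE ler01 => /(_ isT isT).
  by rewrite g1 norm2_sqr expr1n => h; lra.
pose w := v - c *: u.
have w2 : norm2 w ^+ 2 = 1 - c ^+ 2.
  rewrite norm2_sqr !(dotvBl, dotvBr, dotvZl, dotvZr) uu vv (dotvC v u) -/c; ring.
have gv : q * c - y * norm2 w <= dotv g v.
  have := cauchy_schwarz (g - q *: u) w; rewrite -/y ler_norml => /andP[+ _].
  by rewrite /w !(dotvBl, dotvBr, dotvZl, dotvZr) uu -/q -/c; lra.
have q0 : 0 < 21 / 5 - 2 * x by lra.
have ep0 : 0 <= ep by rewrite divr_ge0// ltW.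
have epE : ep * (21 / 5 - 2 * x) = x by rewrite divfK// gt_eqF.
have epx : 2 * ep <= x by nra.
have s1 : norm2 w <= 1 - c ^+ 2 / 2.
  rewrite -ler_sqr ?nnegrE ?norm2_ge0// ?w2; nra.
have y2 : y <= 2 * ep + 3 / 4 * eta.
  rewrite leNgt; apply/negP => hy.
  have q1 : q <= 1 by nra.
  have : y ^+ 2 <= 2 * (ep * y + gamma) by nra.
  have : 0 < 2 * ep + 3 / 4 * eta by lra.
  have : (3 / 4 * eta) * (3 / 4 * eta) <= y * (y - 2 * ep) by apply: ler_pM; lra.
  have : 0 < eta ^+ 2 by rewrite exprn_gt0.
  by lra.
have ge : gamma <= eta / 8 by nra.
have s2 : c * ep + norm2 w <= 1 by nra.
have := alignment_budget x0 xc c1; rewrite -/ep => bud.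
have h1 : c * (1 - ep * y - gamma) <= q * c by rewrite [leRHS]mulrC ler_wpM2l//; lra.
have h2 : (c * ep + norm2 w) * y <= y by rewrite ler_piMl.
have h3 : c * gamma <= gamma by rewrite ler_piMl.
have h4 : (c * ep + norm2 w) * y = c * ep * y + y * norm2 w by ring.
have h5 : c * (1 - ep * y - gamma) = c - c * ep * y - c * gamma by ring.
lra.
Qed.

Lemma le_ceil_nat (t : R) : t <= (ceil_nat t)%:R.
Proof.
rewrite /ceil_nat; apply: le_trans (ceil_ge t) _.
rewrite natr_absz ger0_norm ?le_max ?lexx//.
by rewrite ler_int le_max lexx orbT.
Qed.

(** Far from the minimizers the distance decreases by at least [alpha (b - eta) / 3]
    per step, and near them it cannot leave the ball of radius [alpha (1 + rho)]. The
    cube in the number of steps exceeds what this linear decrease requires, by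
    [X - X^3 / (3 Y^2) <= 2 Y / 3], the tangent inequality of the cube at [Y]. *)
Lemma descent_recursion (alpha eta b : R) (D : nat -> R) (K : nat)
    (rho := (1 - eta ^+ 2) / (b - eta)) :
  0 < alpha -> 0 < eta -> eta < b -> b <= 1 / 2 ->
  (forall k, 0 <= D k) ->
  (forall k, (k < K)%N -> D k.+1 <= D k + alpha) ->
  (forall k, (k < K)%N -> alpha * rho <= D k ->
     D k.+1 ^+ 2 <= D k ^+ 2 - 2 * alpha * (b - eta) * D k + alpha ^+ 2) ->
  (D 0%N - alpha * eta) ^+ 3 / ((alpha * rho) ^+ 2 * (alpha * (b - eta))) <= K%:R ->
  D K <= alpha * (1 + rho).
Proof.
move=> al0 e0 eb b2 D0 D1 D2 hK.
pose A := b - eta; have A0 : 0 < A by rewrite subr_gt0.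
have Arho : A * rho = 1 - eta ^+ 2 by rewrite mulrC divfK// gt_eqF.
have rho0 : 0 < rho by rewrite divr_gt0//; nra.
have A2 : A <= 1 / 2 by rewrite /A; lra.
have rho1 : 3 / 2 <= rho.
  have : A * rho <= 1 / 2 * rho by rewrite ler_pM2r.
  by rewrite Arho; nra.
have dec k : (k < K)%N -> alpha * rho <= D k -> D k.+1 <= D k - alpha * A / 3.
  move=> kK hk; have := D2 k kK hk; rewrite -/A => h.
  have DA : 3 / 4 * alpha <= A * D k.
    have : A * (alpha * rho) <= A * D k by rewrite ler_pM2l.
    have -> : A * (alpha * rho) = alpha * (1 - eta ^+ 2) by rewrite -Arho; ring.
    apply: le_trans; rewrite mulrC ler_pM2l//; nra.
  have DA2 : 0 <= D k - alpha * A / 3.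
    suff : alpha * A / 3 <= alpha * rho by lra.
    by rewrite -mulrA ler_pM2l//; lra.
  rewrite -ler_sqr ?nnegrE//; apply: le_trans h _.
  have : alpha * (3 / 4 * alpha) <= alpha * (A * D k) by rewrite ler_pM2l.
  have := sqr_ge0 (alpha * A); nra.
have stay k : (k < K)%N -> D k <= alpha * (1 + rho) -> D k.+1 <= alpha * (1 + rho).
  move=> kK hk; have [h|h] := leP (alpha * rho) (D k).
    by apply: le_trans (dec k kK h) _; have := mulr_ge0 (ltW al0) (ltW A0); lra.
  by apply: le_trans (D1 k kK) _; lra.
rewrite leNgt; apply/negP => DK.
have above j : (j <= K)%N -> alpha * (1 + rho) < D (K - j)%N.
  elim: j => [|j ih] jK; first by rewrite subn0.
  have Kj : (K - j = (K - j.+1).+1)%N by rewrite subnSK.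
  rewrite ltNge; apply/negP => h.
  have : (K - j.+1 < K)%N by rewrite ltn_subrL (leq_ltn_trans _ jK).
  move=> /stay/(_ h); rewrite -Kj leNgt; apply/negP; rewrite negbK; exact/ih/ltnW.
have total k : (k <= K)%N -> D k <= D 0%N - k%:R * (alpha * A / 3).
  elim: k => [|k ih] kK; first by rewrite mul0r subr0.
  have := above (K - k)%N (leq_subr _ _); rewrite subKn 1?ltnW// => hk.
  have ge : alpha * rho <= D k by lra.
  by have := dec k kK ge; have := ih (ltnW kK); rewrite -natr1; lra.
have := total K (leqnn _).
set X := D 0%N - alpha * eta; set Y := alpha * rho.
have Y0 : 0 < Y by rewrite mulr_gt0.
have X0 : 0 <= X.
  have := above K (leqnn _); rewrite subnn /X.
  have : alpha * eta <= alpha * 1 by rewrite ler_pM2l//; lra.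
  have := mulr_ge0 (ltW al0) (ltW rho0); lra.
have hX : X ^+ 3 / (3 * Y ^+ 2) <= K%:R * (alpha * A / 3).
  have pos : 0 < alpha * A / 3 by rewrite divr_gt0// mulr_gt0.
  have := hK; rewrite -(ler_pM2r pos); apply: le_trans.
  rewrite -/X -/Y -/A le_eqVlt; apply/orP; left; apply/eqP; field.
  by rewrite !gt_eqF.
have cubic : X - X ^+ 3 / (3 * Y ^+ 2) <= 2 / 3 * Y.
  have Y2 : 0 < 3 * Y ^+ 2 by rewrite mulr_gt0// exprn_gt0.
  rewrite lerBlDl -lerBlDr ler_pdivlMr//.
  have : 0 <= (X - Y) ^+ 2 * (X + 2 * Y) by rewrite mulr_ge0 ?sqr_ge0//; lra.
  by nra.
have : alpha * eta <= alpha * 1 by rewrite ler_pM2l//; lra.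
rewrite -/Y in DK; move: DK; rewrite mulrDr mulr1 -/Y => DK h1 h2.
have : D 0%N = X + alpha * eta by rewrite subrK.
lra.
Qed.

End Descent.

(** * Independence *)

Section Independence.
Context {dO : measure_display} {Omega : measurableType dO} {R : realType}.
Variable P : probability Omega R.

(** The law of the pair is the product of the two laws. *)
Lemma independent_pair_integral d1 d2 (T1 : measurableType d1)
    (T2 : measurableType d2) (X : Omega -> T1) (Y : Omega -> T2)
    (F : T1 * T2 -> \bar R) :
  measurable_fun setT X -> measurable_fun setT Y ->
  measurable_fun setT F -> (forall t, 0 <= F t)%E ->
  (forall A B, measurable A -> measurable B ->
     P ((X @^-1` A) `&` (Y @^-1` B)) = P (X @^-1` A) * P (Y @^-1` B))%E ->
  (\int[P]_w F (X w, Y w) = \int[P]_w \int[P]_v F (X w, Y v))%E.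
Proof.
move=> mX mY mF F0 ind.
pose X' : {mfun Omega >-> T1} := HB.pack X (isMeasurableFun.Build _ _ _ _ _ mX).
pose Y' : {mfun Omega >-> T2} := HB.pack Y (isMeasurableFun.Build _ _ _ _ _ mY).
have mXY : measurable_fun setT (fun w => (X w, Y w)) by exact: measurable_fun_pair.
pose XY : {mfun Omega >-> (T1 * T2)%type} :=
  HB.pack (fun w => (X w, Y w)) (isMeasurableFun.Build _ _ _ _ _ mXY).
pose m1 := distribution P X'; pose m2 := distribution P Y'.
transitivity (\int[distribution P XY]_t F t)%E.
  by rewrite ge0_integral_pushforward.
transitivity (\int[m1 \x m2]_t F t)%E.
  apply/esym/eq_measure_integral => A mA _.
  by apply: product_measure_unique => // B C mB mC; exact: ind.
rewrite fubini_tonelli1// ge0_integral_pushforward//=; last 2 first.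
  by apply: measurable_fun_fubini_tonelli_F.
  by move=> t _; apply: integral_ge0.
apply: eq_integral => w _; rewrite /fubini_F ge0_integral_pushforward//.
exact: (measurableT_comp mF (pair1_measurable _)).
Qed.

(** Both sides are finite measures in [A] that agree on a generating set closed
    under intersection. *)
Lemma independent_generated (G : set (set Omega)) (B : set Omega) :
  G `<=` measurable -> setI_closed G -> measurable B ->
  (forall A, G A -> P (A `&` B) = P A * P B)%E ->
  forall A, <<s G >> A -> (P (A `&` B) = P A * P B)%E.
Proof.
move=> Gm GI mB h A GA.
pose r : {nonneg R} := NngNum (fine_ge0 (measure_ge0 P B)).
pose m1 : {measure set Omega -> \bar R} := mrestr P mB.
pose m2 : {measure set Omega -> \bar R} := mscale r P.
have m2E C : m2 C = (P C * P B)%E.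
  rewrite /m2 /= /mscale/= fineK ?fin_num_measure//; exact: muleC.
have GT : [set X | G X /\ X `<=` setT] = G.
  by apply/seteqP; split=> [X []|X]//.
have := @g_sigma_algebra_measure_unique_trace _ _ _ G setT measurableT.
rewrite GT => /(_ R Gm GI m1 m2); rewrite m2E => H.
rewrite -m2E; apply: H => //.
- by rewrite /m1/= /mrestr setTI; rewrite probability_setT mul1e.
- by move=> C GC; rewrite m2E; exact: h.
- by rewrite /m1/= /mrestr setTI ltey_eq fin_num_measure.
Qed.

Variables (I : finType) (F : I -> set (set Omega)).
Hypothesis Fm : forall i, F i `<=` measurable.
Hypothesis FT : forall i, F i setT.
Hypothesis FI : forall i, setI_closed (F i).
Hypothesis Find : mutually_independent P F.
Implicit Types J K : {set I}.

(** The intersections of events of the members of the block [J]: a generating set of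
    [block J] closed under intersection. *)
Definition rectangles J : set (set Omega) :=
  [set A | exists2 E : I -> set Omega, (forall i, F i (E i)) &
     A = \big[setI/setT]_(i in J) E i].

Lemma rectangles_measurable J : rectangles J `<=` measurable.
Proof. by move=> _ [E FE ->]; apply: bigsetI_measurable => i _; exact: Fm. Qed.

Lemma rectangles_setI J : setI_closed (rectangles J).
Proof.
move=> _ _ [E FE ->] [E' FE' ->]; exists (fun i => E i `&` E' i).
  by move=> i; exact: FI.
by rewrite big_split.
Qed.

Lemma family_rectangles J i : i \in J -> F i `<=` rectangles J.
Proof.
move=> iJ A FA; exists (fun k => if k == i then A else setT).
  by move=> k; case: eqP => [->|].
rewrite (bigD1 i)//= eqxx big1 ?setIT// => k /andP[_ /negPf ->].
by [].
Qed.

Lemma rectangles_independent J K A B : (forall i, i \in J -> i \notin K) ->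
  rectangles J A -> rectangles K B -> (P (A `&` B) = P A * P B)%E.
Proof.
move=> JK [E FE ->] [E' FE' ->].
have dJK : fintype.disjoint (mem J) (mem K).
  by rewrite disjoint_subset; apply/fintype.subsetP => i /JK.
pose H i := if i \in J then E i else E' i.
have FH i : F i (H i) by rewrite /H; case: ifP.
have eJ : \big[setI/setT]_(i in J) E i = \big[setI/setT]_(i in J) H i.
  by apply: eq_bigr => i iJ; rewrite /H iJ.
have eK : \big[setI/setT]_(i in K) E' i = \big[setI/setT]_(i in K) H i.
  by apply: eq_bigr => i iK; rewrite /H; case: ifP => // /JK; rewrite iK.
have FH' L := Find (J := L) (fun i _ => FH i).
have eU : \big[setI/setT]_(i in J) H i `&` \big[setI/setT]_(i in K) H i =
    \big[setI/setT]_(i in J :|: K) H i.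
  by rewrite big_setU//; exact: setIid.
rewrite eJ eK eU; apply: (etrans (FH' _)).
transitivity (\prod_(i in [predU J & K]) P (H i))%E.
  by apply: eq_bigl => i; rewrite !inE.
rewrite bigU//=.
by congr (_ * _)%E; apply/esym; exact: FH'.
Qed.

Definition block J : set (set Omega) :=
  <<s [set A | exists2 i, i \in J & F i A] >>.

Lemma block_sub_rectangles J : block J `<=` <<s rectangles J >>.
Proof.
apply: smallest_sub; first exact: smallest_sigma_algebra.
by move=> A [i iJ FA]; apply: sub_sigma_algebra; exact: family_rectangles FA.
Qed.

Lemma blocks_independent J K A B : (forall i, i \in J -> i \notin K) ->
  block J A -> block K B -> (P (A `&` B) = P A * P B)%E.
Proof.
move=> JK /block_sub_rectangles hA /block_sub_rectangles hB.
have sm L : <<s rectangles L >> `<=` @measurable _ Omega.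
  apply: smallest_sub; first exact: sigma_algebra_measurable.
  exact: rectangles_measurable.
have step C : rectangles J C -> (P (C `&` B) = P C * P B)%E.
  move=> hC; rewrite setIC muleC.
  apply: (independent_generated (G := rectangles K)) => //.
  - exact: rectangles_measurable.
  - exact: rectangles_setI.
  - exact: rectangles_measurable hC.
  by move=> D hD; rewrite setIC muleC; exact: rectangles_independent JK hC hD.
apply: (independent_generated (G := rectangles J)) => //.
- exact: rectangles_measurable.
- exact: rectangles_setI.
- exact: sm hB.
Qed.

End Independence.

(** * Sub-Gaussian fluctuations of the one-bit responses *)

Section FreshProduct.
Context {dO dS : measure_display} {Omega : measurableType dO} {R : realType}.
Context {S : measurableType dS} {d m : nat}.
Local Notation V := 'rV[R]_d.
Local Notation BV := (borel_rV R d).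
Variable P : probability Omega R.
Variables (past : set (set Omega)) (X : Omega -> BV).
Variables (Z : 'I_m -> Omega -> BV) (W : 'I_m -> Omega -> S).

Definition fresh_family (a : option ('I_m + 'I_m)) : set (set Omega) :=
  match a with
  | None => past
  | Some (inl i) => sigma_of (Z i)
  | Some (inr i) => sigma_of (W i)
  end.

Hypothesis past_sigma : sigma_algebra setT past.
Hypothesis past_measurable : past `<=` measurable.
Hypothesis mX : forall A, measurable A -> past (X @^-1` A).
Hypothesis mZ : forall i, measurable_fun setT (Z i).
Hypothesis mW : forall i, measurable_fun setT (W i).
Hypothesis fresh : mutually_independent P fresh_family.

Let fresh_measurable a : fresh_family a `<=` measurable.
Proof.
case: a => [[i|i]|] //= _ [A mA <-]; [exact: mZ|exact: mW].
Qed.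

Let sigma_ofT dT (T : measurableType dT) (Y : Omega -> T) : sigma_of Y setT.
Proof. by exists setT => //; rewrite setTI. Qed.

Let sigma_ofI dT (T : measurableType dT) (Y : Omega -> T) : setI_closed (sigma_of Y).
Proof.
move=> _ _ [A mA <-] [B mB <-]; exists (A `&` B); first exact: measurableI.
by rewrite !setTI.
Qed.

Let fresh_setT a : fresh_family a setT.
Proof.
case: a => [[i|i]|] /=; [exact: sigma_ofT..|].
by have [? + _] := past_sigma => /(_ set0); rewrite setD0; apply.
Qed.

Let fresh_setI a : setI_closed (fresh_family a).
Proof.
case: a => [[i|i]|] /=; [exact: sigma_ofI..|].
move=> A B pA pB.
pose T1 := g_sigma_algebraType past.
have e : <<s past >> = past by apply: sigma_algebra_id.
rewrite -e; apply: (@measurableI _ T1); exact: sub_sigma_algebra.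
Qed.

(** Each pair [(Z i, W i)] is independent of the past and of the other pairs, so
    the factors of the product can be integrated one by one. *)
Lemma fresh_product_le (psi : 'I_m -> BV * (BV * S) -> R) (B : R) :
  (forall i, measurable_fun setT (psi i)) -> (forall i t, 0 <= psi i t) -> 0 <= B ->
  (forall i x, \int[P]_w (psi i (x, (Z i w, W i w)))%:E <= B%:E)%E ->
  (\int[P]_w (\prod_(i < m) psi i (X w, (Z i w, W i w)))%:E <= (B ^+ m)%:E)%E.
Proof.
move=> mpsi psi0 B0 hB.
pose Fj j w := \prod_(i < m | (i < j)%N) psi i (X w, (Z i w, W i w)).
have Fj0 j w : 0 <= Fj j w by apply: prodr_ge0.
have Fm w : \prod_(i < m) psi i (X w, (Z i w, W i w)) = Fj m w.
  by apply: eq_bigl => i; rewrite ltn_ord.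
under eq_integral do rewrite Fm.
have : (m <= m)%N by [].
elim: {1 3 4}m => [_|j ih jm].
  under eq_integral => w _ do rewrite /Fj big_pred0//.
  have P1 : P setT = 1%E := probability_setT P.
  by rewrite expr0 integral_cst// mul1e; rewrite [leLHS]P1.
pose i0 := Ordinal jm.
pose J : {set option ('I_m + 'I_m)} := [set a : option ('I_m + 'I_m) | match a with
  | None => true | Some (inl i) => (i < j)%N | Some (inr i) => (i < j)%N end]%SET.
pose K : {set option ('I_m + 'I_m)} := [set Some (inl i0); Some (inr i0)]%SET.
have JK a : a \in J -> a \notin K.
  by rewrite !inE; case: a => [[i|i]|] //= ij; apply/negP;
    rewrite ?orbF ?orFb => /eqP[e]; move: ij; rewrite e ltnn.
pose OJ := g_sigma_algebraType [set A | exists2 a, a \in J & fresh_family a A].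
pose OK := g_sigma_algebraType [set A | exists2 a, a \in K & fresh_family a A].
have mXJ : measurable_fun setT (X : OJ -> BV).
  move=> _ A mA; rewrite setTI; apply: sub_sigma_algebra.
  by exists None; rewrite ?inE//; exact: mX.
have mZJ (i : 'I_m) : (i < j)%N -> measurable_fun setT (Z i : OJ -> BV).
  move=> ij _ A mA; apply: sub_sigma_algebra.
  by exists (Some (inl i)); rewrite ?inE//; exists A.
have mWJ (i : 'I_m) : (i < j)%N -> measurable_fun setT (W i : OJ -> S).
  move=> ij _ A mA; apply: sub_sigma_algebra.
  by exists (Some (inr i)); rewrite ?inE//; exists A.
have mZK : measurable_fun setT (Z i0 : OK -> BV).
  move=> _ A mA; apply: sub_sigma_algebra.
  by exists (Some (inl i0)); rewrite ?inE ?eqxx//; exists A.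
have mWK : measurable_fun setT (W i0 : OK -> S).
  move=> _ A mA; apply: sub_sigma_algebra.
  by exists (Some (inr i0)); rewrite ?inE ?eqxx ?orbT//; exists A.
have mFJ : measurable_fun setT (Fj j : OJ -> R).
  pose g (i : 'I_m) (w : OJ) : R := if (i < j)%N then psi i (X w, (Z i w, W i w)) else 1.
  have -> : Fj j = fun w => \prod_(i < m) g i w.
    by apply/funext => w; rewrite /Fj big_mkcond.
  apply: measurable_prod => i _; rewrite /g; have [ij|_] := boolP (i < j)%N => //.
  apply: (measurableT_comp (mpsi i)); apply: measurable_fun_pair => //.
  by apply: measurable_fun_pair; [exact: mZJ|exact: mWJ].
have sub (L : {set option ('I_m + 'I_m)}) : <<s [set A | exists2 a, a \in L & fresh_family a A] >> `<=` @measurable _ Omega.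
  apply: smallest_sub; first exact: sigma_algebra_measurable.
  by move=> A [a _]; exact: fresh_measurable.
have mXo : measurable_fun setT X by move=> _ A mA; rewrite setTI; exact/past_measurable/mX.
have mFo : measurable_fun setT (Fj j) by move=> _ A mA; exact: (@sub J _ (mFJ measurableT A mA)).
pose G (t : (BV * R) * (BV * S)) : \bar R := (`|t.1.2| * psi i0 (t.1.1, t.2))%:E.
have FS w : Fj j.+1 w = Fj j w * psi i0 (X w, (Z i0 w, W i0 w)).
  rewrite /Fj (bigD1 i0)//= mulrC; congr (_ * _); apply: eq_bigl => i.
  by rewrite ltnS ltn_neqAle andbC -val_eqE.
have mG : measurable_fun setT G.
  apply/measurable_EFinP; apply: measurable_funM.
    apply: measurableT_comp => //.
    exact: (measurableT_comp measurable_snd measurable_fst).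
  apply: (measurableT_comp (mpsi i0)); apply: measurable_fun_pair => //.
  exact: (measurableT_comp measurable_fst measurable_fst).
have mXF : measurable_fun setT (fun w => (X w, Fj j w)) by exact: measurable_fun_pair.
have mZW : measurable_fun setT (fun w => (Z i0 w, W i0 w)) by exact: measurable_fun_pair.
have G0 t : (0 <= G t)%E by rewrite lee_fin mulr_ge0.
have ind A C : measurable A -> measurable C ->
    (P (((fun w => (X w, Fj j w)) @^-1` A) `&` ((fun w => (Z i0 w, W i0 w)) @^-1` C)) =
     P ((fun w => (X w, Fj j w)) @^-1` A) * P ((fun w => (Z i0 w, W i0 w)) @^-1` C))%E.
  move=> mA mC; apply: (blocks_independent fresh_measurable fresh_setT fresh_setI fresh JK).
    have : measurable_fun setT ((fun w => (X w, Fj j w)) : OJ -> BV * R).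
      exact: measurable_fun_pair.
    by move=> /(_ measurableT _ mA); rewrite setTI.
  have : measurable_fun setT ((fun w => (Z i0 w, W i0 w)) : OK -> BV * S).
    exact: measurable_fun_pair.
  by move=> /(_ measurableT _ mC); rewrite setTI.
have key := independent_pair_integral mXF mZW mG G0 ind.
have -> : (\int[P]_w (Fj j.+1 w)%:E = \int[P]_w G ((X w, Fj j w), (Z i0 w, W i0 w)))%E.
  by apply: eq_integral => w _; rewrite /G/= FS ger0_norm.
rewrite key; apply: (@le_trans _ _ (\int[P]_w (B%:E * (Fj j w)%:E))%E).
  apply: ge0_le_integral => //.
  - by move=> w _; apply: integral_ge0.
  - have mH : measurable_fun setT (fun q : Omega * Omega =>
        G ((X q.1, Fj j q.1), (Z i0 q.2, W i0 q.2))).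
      apply: (measurableT_comp mG); apply: measurable_fun_pair.
        exact: (measurableT_comp mXF measurable_fst).
      exact: (measurableT_comp mZW measurable_snd).
    exact: (measurable_fun_fubini_tonelli_F (m2 := P) _ mH (fun q => G0 _)).
  - by apply: measurable_funeM; exact/measurable_EFinP.
  move=> w _; rewrite /G/= ger0_norm//.
  under eq_integral do rewrite EFinM.
  rewrite ge0_integralZl//; last 3 first.
  - apply/measurable_EFinP; apply: (measurableT_comp (mpsi i0)).
    by apply: measurable_fun_pair.
  - by move=> v _; rewrite lee_fin.
  - by rewrite lee_fin.
  by rewrite muleC lee_wpmul2r// lee_fin.
rewrite ge0_integralZl//; last 2 first.
- by apply/measurable_EFinP.
- by move=> w _; rewrite lee_fin.
by rewrite exprS EFinM lee_wpmul2l// ?lee_fin// ih// ltnW.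
Qed.

End FreshProduct.

(** ** The response to a query and its mean *)

Section Response.
Context {R : realType} {d : nat} {dO dS : measure_display}.
Context {Omega : measurableType dO} {S : measurableType dS}.
Local Notation V := 'rV[R]_d.
Local Notation BV := (borel_rV R d).
Variables (P : probability Omega R) (Z : Omega -> BV) (W : Omega -> S).
Variables (Cf : S -> V -> V -> R) (r : R).
Hypothesis mZ : measurable_fun setT Z.
Hypothesis Z1 : forall w, norm2 (Z w : V) = 1.
Hypothesis mW : measurable_fun setT W.
Hypothesis Cf1 : forall s x y, Cf s x y = 1 \/ Cf s x y = -1.
Hypothesis mCf : measurable_fun setT (fun q : S * borel_rV R d * borel_rV R d =>
  Cf q.1.1 q.1.2 q.2).
Implicit Types (x y z h : V).

Definition response x z (s : S) : V := Cf s x (x + r *: z) *: z.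

Definition mean_response x : V := \row_j Ex P (fun w => response x (Z w) (W w) 0 j).

Lemma measurable_oracle_response :
  measurable_fun setT (fun t : BV * (BV * S) => Cf t.2.2 t.1 ((t.1 : V) + r *: (t.2.1 : V))).
Proof.
have m1 : measurable_fun setT (fun t : BV * (BV * S) => t.1) by exact: measurable_fst.
have m2 : measurable_fun setT (fun t : BV * (BV * S) => t.2.1).
  exact: (measurableT_comp measurable_fst measurable_snd).
have m3 : measurable_fun setT (fun t : BV * (BV * S) => t.2.2).
  exact: (measurableT_comp measurable_snd measurable_snd).
apply: (measurableT_comp mCf
  (g := fun t : BV * (BV * S) => (t.2.2, t.1, (t.1 : V) + r *: (t.2.1 : V) : BV))).
apply: measurable_fun_pair; first exact: measurable_fun_pair.
by apply: measurable_rVD => //; exact: measurable_rVZ.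
Qed.

Lemma measurable_response :
  measurable_fun setT (fun t : BV * (BV * S) => response t.1 t.2.1 t.2.2 : BV).
Proof.
apply: measurable_fun_coords => j; under eq_fun do rewrite mxE.
apply: measurable_funM; first exact: measurable_oracle_response.
apply: (@measurable_coord_comp _ _ _ _ (fun t : BV * (BV * S) => t.2.1)).
exact: (measurableT_comp measurable_fst measurable_snd).
Qed.

Lemma norm2_response x z s : norm2 (response x z s) = norm2 z.
Proof.
by rewrite norm2Z; have [->|->] := Cf1 s x (x + r *: z); rewrite ?normrN normr1 mul1r.
Qed.

Let mZW : measurable_fun setT (fun w => (Z w, W w)).
Proof. exact: measurable_fun_pair. Qed.

Lemma measurable_response_at x : measurable_fun setT (fun w => response x (Z w) (W w) : BV).
Proof.
have mx : measurable_fun setT (fun w => ((x : BV), (Z w, W w))).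
  exact: measurable_fun_pair.
exact: (measurableT_comp measurable_response mx).
Qed.

Lemma bounded_response x h : bounded_rv (fun w => dotv (response x (Z w) (W w)) h).
Proof.
split; first by apply: measurable_dotv => //; exact: measurable_response_at.
exists (norm2 h) => w; apply: le_trans (cauchy_schwarz _ _) _.
by rewrite norm2_response Z1 mul1r.
Qed.

Lemma bounded_response_coord x j : bounded_rv (fun w => response x (Z w) (W w) 0 j).
Proof.
rewrite (_ : (fun w => _) = fun w => dotv (response x (Z w) (W w)) (delta_mx 0 j)).
  exact: bounded_response.
by apply/funext => w; rewrite dotv_delta.
Qed.

Lemma dotv_mean_response x h :
  dotv (mean_response x) h = Ex P (fun w => dotv (response x (Z w) (W w)) h).
Proof.
rewrite /dotv (Ex_sum P); last first.
  move=> j; rewrite [X in bounded_rv X](_ : _ =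
    fun w => h 0 j * response x (Z w) (W w) 0 j).
    exact/bounded_rvZ/bounded_response_coord.
  by apply/funext => w; rewrite mulrC.
apply: eq_bigr => j _; rewrite mxE mulrC -ExZ; last exact: bounded_response_coord.
by congr (Ex P _); apply/funext => w; rewrite mulrC.
Qed.

Lemma norm2_mean_response x : norm2 (mean_response x) <= 1.
Proof.
have [->|n0] := eqVneq (mean_response x) 0; first by rewrite norm2_0.
have npos : 0 < norm2 (mean_response x) by rewrite norm2_gt0.
rewrite -(ler_pM2l npos) mulr1 -expr2 norm2_sqr {1}dotv_mean_response.
rewrite -[leRHS](Ex_cst P); apply: le_Ex.
- exact: bounded_response.
- exact: bounded_rv_cst.
by move=> w; apply: le_trans (dotv_le _ _) _; rewrite norm2_response Z1 mul1r.
Qed.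

Lemma measurable_mean_response : measurable_fun setT (mean_response : BV -> BV).
Proof.
apply: measurable_fun_coords => j; under eq_fun do rewrite mxE.
pose F (t : BV * Omega) : \bar R := (1 + response t.1 (Z t.2) (W t.2) 0 j)%:E.
have mt : measurable_fun setT (fun t : BV * Omega => (t.1, (Z t.2, W t.2))).
  apply: measurable_fun_pair; first exact: measurable_fst.
  exact: (measurableT_comp mZW measurable_snd).
have mF : measurable_fun setT F.
  apply/measurable_EFinP; apply: measurable_funD => //.
  exact: (measurable_coord_comp j (measurableT_comp measurable_response mt)).
have F0 t : (0 <= F t)%E.
  rewrite lee_fin; have := coord_le_norm2 (response t.1 (Z t.2) (W t.2)) j.
  by rewrite norm2_response Z1 ler_norml => /andP[]; lra.
(* The coordinates are at least - 1, so that F is nonnegative, as Tonelli asks. *)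
have mI := measurable_fun_fubini_tonelli_F (m2 := P) _ mF F0.
have -> : (fun x : BV => Ex P (fun w => response x (Z w) (W w) 0 j)) =
    (fun x => fine (fubini_F P F x) - 1).
  apply/funext => x; rewrite /fubini_F.
  have hb := bounded_response_coord x j.
  have b1 := bounded_rvD (bounded_rv_cst 1) hb.
  have -> : (\int[P]_y F (x, y))%E = (Ex P (fun w => 1 + response x (Z w) (W w) 0 j))%:E.
    by rewrite -Ex_integral.
  by rewrite /= ExD// ?Ex_cst ?[1 + _]addrC ?addrK//; exact: bounded_rv_cst.
apply: measurable_funB => //.
exact: (measurableT_comp (fine_measurable measurableT) mI).
Qed.

Section Law.
Hypothesis Zinv : forall (U : 'M[R]_d) (A : set BV),
  U *m U^T = 1%:M -> measurable A ->
  P [set w | A ((Z w : V) *m U)] = P [set w | A (Z w)].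

(** Jensen's inequality bounds [exp (- E T)] by [E exp (- T)]; the product of the
    two Laplace transforms of [T] is at most the square of their mean, in which the
    answers of the oracle have disappeared. *)
Lemma response_laplace x v :
  Ex P (fun w => expR (dotv (response x (Z w) (W w) - mean_response x) v)) <=
  expR (norm2 v ^+ 2 / d%:R).
Proof.
pose T w := dotv (response x (Z w) (W w)) v.
have bT : bounded_rv T := bounded_response x v.
pose mu := Ex P T.
have beT := bounded_rv_expR bT; have beN := bounded_rv_expR (bounded_rvN bT).
pose B := Ex P (fun w => expR (- T w)).
have A0 : 0 <= Ex P (fun w => expR (T w)).
  by rewrite -[leLHS](Ex_cst P); apply: (le_Ex P (bounded_rv_cst 0) beT) => w; exact: expR_ge0.
have jensen : expR (- mu) <= B.
  have : 1 <= expR mu * B.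
    rewrite -ExZ// -[leLHS](_ : Ex P (fun w => 1 + (mu - T w)) = 1).
      have bl : bounded_rv (fun w => mu - T w).
        by apply: bounded_rvB => //; exact: bounded_rv_cst.
      apply: le_Ex.
      - by apply: bounded_rvD => //; exact: bounded_rv_cst.
      - exact: bounded_rvZ.
      by move=> w; rewrite -expRD; exact: expR_ge1Dx.
    rewrite ExD; [|exact: bounded_rv_cst|by apply: bounded_rvB => //; exact: bounded_rv_cst].
    by rewrite ExB ?Ex_cst//; [rewrite subrr addr0|exact: bounded_rv_cst].
  by rewrite expRN -ler_pdivrMl ?expR_gt0// mulr1.
have -> : Ex P (fun w => expR (dotv (response x (Z w) (W w) - mean_response x) v)) =
    expR (- mu) * Ex P (fun w => expR (T w)).
  rewrite -ExZ//; congr (Ex P _); apply/funext => w.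
  by rewrite dotvBl dotv_mean_response -/mu addrC expRD.
have AB : Ex P (fun w => expR (T w)) + B <= 2 * expR (norm2 v ^+ 2 / (2 * d%:R)).
  rewrite /B -ExD//.
  have hv (y : V) : on_sphere (fun z => expR (dotv z y)).
    by apply: on_sphere_expR; exact: on_sphere_dot.
  have -> : Ex P (fun w => expR (T w) + expR (- T w)) =
     Es P Z (fun z => expR (dotv z v) + expR (dotv z (- v))).
    congr (Ex P _); apply/funext => w; rewrite /T dotvNr dotvZl.
    by have [->|->] := Cf1 (W w) x (x + r *: (Z w : V)); rewrite ?mul1r// mulN1r opprK addrC.
  rewrite (EsD P mZ Z1)//; have := sphere_laplace mZ Z1 Zinv v.
  by have := sphere_laplace mZ Z1 Zinv (- v); rewrite norm2N; lra.
set a := Ex P (fun w => expR (T w)) in A0 AB *.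
set E := expR _ in AB; have E0 : 0 <= E by exact: expR_ge0.
apply: (@le_trans _ _ (B * a)); first by rewrite ler_wpM2r.
have B0 : 0 <= B by apply: le_trans jensen; exact: expR_ge0.
have -> : expR (norm2 v ^+ 2 / d%:R) = E ^+ 2.
  rewrite /E -expRM_natl; congr expR.
  have [->|d0] := eqVneq (d%:R : R) 0; first by rewrite mulr0 invr0 !mulr0.
  by field.
have : (a + B) ^+ 2 <= (2 * E) ^+ 2 by rewrite ler_sqr ?nnegrE ?addr_ge0 ?mulr_ge0.
have := sqr_ge0 (a - B); nra.
Qed.

End Law.

Variables (Q : probability S R) (f : V -> R) (p : R).
Hypothesis WQ : forall A, measurable A -> P (W @^-1` A) = Q A.
Hypothesis ZW : forall A B, measurable A -> measurable B ->
  (P ((Z @^-1` A) `&` (W @^-1` B)) = P (Z @^-1` A) * P (W @^-1` B))%E.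
Hypothesis acc : forall x y, Q (correct_answer f Cf x y) = p%:E.

Lemma mean_answer x y :
  Ex P (fun w => Cf (W w) x y) = (2 * p - 1) * sign_pm (f y - f x).
Proof.
set s := sign_pm _; have s1 : s = 1 \/ s = -1.
  by rewrite /s /sign_pm; case: ifP; [left|right].
have mC : measurable_fun setT (fun t : S => Cf t x y).
  have mt : measurable_fun setT (fun t : S => (t, (x : BV), (y : BV))).
    by apply: measurable_fun_pair => //; exact: measurable_fun_pair.
  exact: (measurableT_comp mCf mt).
have mcorr : measurable (correct_answer f Cf x y).
  have := mC measurableT _ (measurable_set1 s); rewrite setTI.
  by congr (measurable _).
have mWc : measurable (W @^-1` correct_answer f Cf x y).
  by rewrite -[X in measurable X]setTI; exact: mW.
pose ind := \1_(W @^-1` correct_answer f Cf x y) : Omega -> R.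
have indE w : ind w = (w \in W @^-1` correct_answer f Cf x y)%:R by exact: indicE.
have bind : bounded_rv ind.
  split; first exact: measurable_indic.
  by exists 1 => w; rewrite indE; case: (_ \in _); rewrite ?normr1 ?normr0.
have -> : Ex P (fun w => Cf (W w) x y) = Ex P (fun w => s * (2 * ind w - 1)).
  congr (Ex P _); apply/funext => w; rewrite indE.
  case: (boolP (w \in _)) => [/set_mem/= |/negP wn].
    by rewrite /correct_answer/= -/s => ->; ring.
  have ns : Cf (W w) x y <> s by move=> e; apply: wn; exact/mem_set.
  case: s1 ns => -> ns; case: (Cf1 (W w) x y) => e; rewrite e in ns *.
  - by case: ns.
  - by rewrite /= mulr0; ring.
  - by rewrite /= mulr0; ring.
  - by case: ns.
rewrite ExZ; last first.
  by apply: bounded_rvB; [exact: bounded_rvZ|exact: bounded_rv_cst].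
rewrite ExB ?Ex_cst; [|exact: bounded_rvZ|exact: bounded_rv_cst].
rewrite ExZ// mulrC; congr ((2 * _ - 1) * _).
have Pc : P (W @^-1` correct_answer f Cf x y) = p%:E by rewrite WQ// acc.
rewrite /Ex /Rintegral integral_indic// setIT; exact: (congr1 fine Pc).
Qed.

Hypothesis cf : continuous f.

Definition comparison x z : R := sign_pm (f (x + r *: z) - f x).

Lemma measurable_comparison x : measurable_fun setT (comparison x : BV -> R).
Proof.
have mf : measurable_fun setT (f : BV -> R) := continuous_borel_measurable cf.
have mxz : measurable_fun setT (fun z : BV => (x : BV) + r *: (z : V) : BV).
  by apply: measurable_rVD => //; exact: measurable_rVZ.
have mg : measurable_fun setT (fun z : BV => f (x + r *: (z : V)) - f x).
  by apply: measurable_funB => //; exact: (measurableT_comp mf mxz).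
apply: measurable_fun_ifT => //; exact: measurable_fun_ler.
Qed.

Lemma comparison_pm1 x z : comparison x z = 1 \/ comparison x z = -1.
Proof. by rewrite /comparison /sign_pm; case: ifP; [left|right]. Qed.

(** Integrating over the seed first, with the direction fixed, replaces the answer by
    [2 p - 1] times the exact comparison. The factor leaves the integral over the
    direction because [p] is the same for all queries. *)
Lemma mean_response_correlation x h :
  dotv (mean_response x) h =
  (2 * p - 1) * Es P Z (fun z => comparison x z * dotv z h).
Proof.
have hs : on_sphere (fun z => comparison x z * dotv z h).
  apply: on_sphereM; last exact: on_sphere_dot.
  by apply: on_sphere_pm1; [exact: measurable_comparison|exact: comparison_pm1].
pose F (t : BV * S) : \bar R := (norm2 (t.1 : V) * norm2 h +
  dotv (response x t.1 t.2) h)%:E.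
have mt : measurable_fun setT (fun t : BV * S => ((x : BV), t)).
  by apply: measurable_fun_pair.
have mF : measurable_fun setT F.
  apply/measurable_EFinP; apply: measurable_funD.
    by apply: measurable_funM => //; apply: measurable_norm2; exact: measurable_fst.
  by apply: measurable_dotv => //; exact: (measurableT_comp measurable_response mt).
have F0 t : (0 <= F t)%E.
  rewrite lee_fin; have := cauchy_schwarz (response x t.1 t.2) h.
  by rewrite norm2_response ler_norml => /andP[]; lra.
have key := independent_pair_integral mZ mW mF F0 ZW.
have bl : bounded_rv (fun w => norm2 h + dotv (response x (Z w) (W w)) h).
  by apply: bounded_rvD; [exact: bounded_rv_cst|exact: bounded_response].
have e1 : (\int[P]_w F (Z w, W w) = (norm2 h + dotv (mean_response x) h)%:E)%E.
  rewrite dotv_mean_response -[X in (X + _)%:E](Ex_cst P).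
  rewrite -ExD; [|exact: bounded_rv_cst|exact: bounded_response].
  by rewrite -Ex_integral//; apply: eq_integral => w _; rewrite /F/= Z1 mul1r.
have bC y : bounded_rv (fun w => Cf (W w) x y).
  split; last by exists 1 => w; have [->|->] := Cf1 (W w) x y; rewrite ?normrN normr1.
  have mw : measurable_fun setT (fun w => (W w, (x : BV), (y : BV))).
    by apply: measurable_fun_pair => //; exact: measurable_fun_pair.
  exact: (measurableT_comp mCf mw).
have e2 w : (\int[P]_v F (Z w, W v) =
    (norm2 h + (2 * p - 1) * (comparison x (Z w) * dotv (Z w : V) h))%:E)%E.
  have bv := bC (x + r *: (Z w : V)).
  transitivity (\int[P]_v (norm2 h +
      dotv (Z w : V) h * Cf (W v) x (x + r *: (Z w : V)))%:E)%E.
    by apply: eq_integral => v _; rewrite /F/= Z1 mul1r dotvZl mulrC.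
  rewrite Ex_integral; last by apply: bounded_rvD; [exact: bounded_rv_cst|exact: bounded_rvZ].
  rewrite ExD; [|exact: bounded_rv_cst|exact: bounded_rvZ].
  by rewrite Ex_cst ExZ// mean_answer /comparison; congr (_ + _)%:E; ring.
have brv : bounded_rv (fun w => (2 * p - 1) * (comparison x (Z w) * dotv (Z w : V) h)).
  by apply: bounded_rvZ; exact: (on_sphere_rv mZ Z1 hs).
move: key; rewrite e1; under eq_integral do rewrite e2.
rewrite Ex_integral; last by apply: bounded_rvD => //; exact: bounded_rv_cst.
rewrite ExD ?Ex_cst//; last exact: bounded_rv_cst.
rewrite ExZ; last exact: (on_sphere_rv mZ Z1 hs).
by move=> [] /addrI.
Qed.

End Response.

(** * Uniform deviation over the sparse ball *)

Section SoftThreshold.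
Context {R : realType}.
Variables (theta : R) (J : nat).
Hypothesis theta0 : 0 < theta.

(** The exponent of the atom [j] is the tangent to [t^2 / 8] at [j theta]; the excess
    of [t^2 / 8] over [(|t| - theta)^2 / 8] makes up for the gap between consecutive
    tangents. The weights keep the mixture integrable against a Gaussian. *)
Definition atom_weight (a : option ('I_J * bool)) : R :=
  if a is Some (j, _) then expR (- (j.+1%:R * theta) ^+ 2 / 8) else 1.

Definition atom_slope (a : option ('I_J * bool)) : R :=
  if a is Some (j, b) then (-1) ^+ b * (j.+1%:R * theta / 4) else 0.

Definition soft_mixture (t : R) : R :=
  \sum_a atom_weight a * expR (atom_slope a * t).

Definition excess (t : R) : R := Num.max 0 (`|t| - theta).

Let term_ge0 a t : 0 <= atom_weight a * expR (atom_slope a * t).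
Proof. by case: a => [[j b]|]; rewrite mulr_ge0 ?expR_ge0. Qed.

Lemma atom_weight_ge0 a : 0 <= atom_weight a.
Proof. by case: a => [[j b]|] //=; exact: expR_ge0. Qed.

Lemma soft_mixture_ge0 t : 0 <= soft_mixture t.
Proof. by apply: sumr_ge0. Qed.

(** The atom with [j] the integer part of [|t| / theta] and the sign of [t] alone is
    large enough; the constant atom serves when [|t| < theta]. *)
Lemma expR_excess_le t : `|t| < J.+1%:R * theta ->
  expR (excess t ^+ 2 / 8) <= soft_mixture t.
Proof.
move=> tJ; have [tt|tt] := ltP `|t| theta.
  have -> : excess t = 0 by rewrite /excess max_l// subr_le0 ltW.
  rewrite expr0n mul0r expR0 /soft_mixture (bigD1 None)//= mul0r expR0 mulr1.
  by rewrite lerDl sumr_ge0.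
pose k := Num.truncn (`|t| / theta).
have tq0 : 0 <= `|t| / theta by rewrite divr_ge0// ltW.
have /andP[kt tk] := truncn_itv tq0; rewrite -/k in kt tk.
have k0 : (0 < k)%N.
  have : 1 < k.+1%:R :> R by apply: le_lt_trans tk; rewrite ler_pdivlMr// mul1r.
  by rewrite ltr1n.
have kJ : (k.-1 < J)%N.
  rewrite prednK// -ltnS -(ltr_nat R); apply: le_lt_trans kt _.
  by rewrite ltr_pdivrMr.
pose j := Ordinal kJ; have jk : j.+1 = k by rewrite /= prednK.
rewrite /soft_mixture (bigD1 (Some (j, t < 0)))//=.
apply: (@le_trans _ _ (expR (- (j.+1%:R * theta) ^+ 2 / 8) *
    expR ((-1) ^+ (t < 0)%R * (j.+1%:R * theta / 4) * t))); last by rewrite lerDl sumr_ge0.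
rewrite -expRD ler_expR jk.
have -> : (-1) ^+ (t < 0)%R * (k%:R * theta / 4) * t = k%:R * theta / 4 * `|t|.
  by case: (ltP t 0) => t0; rewrite ?(ltr0_norm t0) ?(ger0_norm t0) ?expr1 ?expr0; ring.
rewrite /excess max_r ?subr_ge0//; set a := `|t| in kt tk tt *.
have h1 : k%:R * theta <= a by rewrite -ler_pdivlMr.
have h2 : a < k%:R * theta + theta by move: tk; rewrite -natr1 ltr_pdivrMr// mulrDl mul1r.
set K := k%:R * theta in h1 h2 *.
have K0 : 0 <= K by rewrite mulr_ge0// ltW.
have : (a - theta) ^+ 2 <= K ^+ 2 by rewrite ler_sqr ?nnegrE ?subr_ge0//; lra.
nra.
Qed.

Lemma geometric_sum_le (q : R) (N : nat) : 0 <= q -> q <= 1 / 4 ->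
  \sum_(j < N) q ^+ j.+1 <= 4 / 3 * q.
Proof.
move=> q0 q4.
suff : (1 - q) * \sum_(j < N) q ^+ j.+1 = q - q ^+ N.+1.
  have : 0 <= q ^+ N.+1 by rewrite exprn_ge0.
  have : 0 <= \sum_(j < N) q ^+ j.+1 by apply: sumr_ge0 => j _; rewrite exprn_ge0.
  set x := \sum_(_ < _) _; nra.
elim: N => [|N ih]; first by rewrite big_ord0 mulr0 subrr.
by rewrite big_ord_recr/= mulrDr ih (exprS q N.+1); ring.
Qed.

Lemma soft_mixture_laplace (u : R) : 0 < u -> u <= 1 / 2 ->
  expR (- (theta ^+ 2 / 16)) = u ^+ 2 ->
  \sum_a atom_weight a * expR (atom_slope a ^+ 2) <= 1 + 2 * u.
Proof.
move=> u0 u2 hu.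
have e (j : 'I_J) b : atom_weight (Some (j, b)) * expR (atom_slope (Some (j, b)) ^+ 2) <=
    (u ^+ 2) ^+ j.+1.
  have sq (y : R) : ((-1) ^+ b * y) ^+ 2 = y ^+ 2 by rewrite exprMn sqrr_sign mul1r.
  rewrite -hu -expRM_natl /= -expRD ler_expR sq.
  set x : R := j.+1%:R; have x1 : 1 <= x by rewrite ler1n.
  have -> : - (x * theta) ^+ 2 / 8 + (x * theta / 4) ^+ 2 = - (x ^+ 2 * theta ^+ 2 / 16) by field.
  have : 0 <= theta ^+ 2 by exact: sqr_ge0.
  nra.
rewrite (bigD1 None)//= expr0n/= expR0 mulr1 lerD2l.
rewrite (reindex_omap Some (fun x => x))/=; last by case.
rewrite (eq_bigl xpredT) => [|x]; last by rewrite eqxx.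
rewrite (eq_bigr (fun x : 'I_J * bool =>
    atom_weight (Some (x.1, x.2)) * expR (atom_slope (Some (x.1, x.2)) ^+ 2))); last by case.
rewrite -(pair_bigA _ (fun j b => atom_weight (Some (j, b)) * expR (atom_slope (Some (j, b)) ^+ 2)))/=.
apply: (@le_trans _ _ (\sum_(j < J) 2 * (u ^+ 2) ^+ j.+1)).
  apply: ler_sum => j _; rewrite big_bool/=; have := e j true; have := e j false => /=; lra.
rewrite -mulr_sumr; have q4 : u ^+ 2 <= 1 / 4 by nra.
have := geometric_sum_le J (sqr_ge0 u) q4; nra.
Qed.

(** Each coordinate of [n] is at most [theta] plus its excess. The first part is paid
    with the l1 norm of [h] and the second with its l2 norm, and the sum of the
    squared excesses is at most [8] times the logarithm of the product. This replaces
    a union bound over a net of the sparse ball. *)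
Lemma soft_mixture_dual d (n h : 'rV[R]_d) (s T : R) :
  (forall i, `|n 0 i| < J.+1%:R * theta) ->
  norm1 h <= Num.sqrt s -> norm2 h <= 1 ->
  \prod_i soft_mixture (n 0 i) <= expR T -> 0 <= T ->
  dotv n h <= theta * Num.sqrt s + Num.sqrt (8 * T).
Proof.
move=> nJ h1 h2 PT T0.
pose p : 'rV[R]_d := \row_i excess (n 0 i); pose a : 'rV[R]_d := \row_i `|h 0 i|.
have pn : norm2 p <= Num.sqrt (8 * T).
  rewrite /norm2; apply: ler_wsqrtr.
  suff : dotv p p / 8 <= T by rewrite ler_pdivrMr// mulrC.
  rewrite -ler_expR; apply: le_trans PT.
  rewrite /dotv mulr_suml expR_sum; apply: ler_prod => i _; rewrite expR_ge0/=.
  by rewrite mxE -expr2; exact: expR_excess_le.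
have an : norm2 a = norm2 h.
  rewrite /norm2 /dotv; congr Num.sqrt; apply: eq_bigr => i _.
  by rewrite !mxE -normrM ger0_norm// -expr2 sqr_ge0.
apply: (@le_trans _ _ (theta * norm1 h + dotv p a)).
  rewrite /norm1 /dotv mulr_sumr -big_split/=; apply: ler_sum => i _; rewrite !mxE.
  rewrite -mulrDl; apply: le_trans (ler_norm _) _; rewrite normrM ler_wpM2r//.
  by rewrite /excess -lerBlDl le_max lexx orbT.
apply: lerD; first by rewrite ler_pM2l.
apply: le_trans (dotv_le _ _) _; rewrite an; apply: le_trans pn.
by rewrite ler_piMr ?norm2_ge0.
Qed.

Section Tail.
Context {d : nat} {dO : measure_display} {Omega : measurableType dO}.
Local Notation V := 'rV[R]_d.
Local Notation BV := (borel_rV R d).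
Variables (P : probability Omega R) (n : Omega -> BV).
Hypothesis mn : measurable_fun setT n.
Hypothesis subgaussian : forall v : V,
  (\int[P]_w (expR (dotv (n w : V) v))%:E <= (expR (norm2 v ^+ 2))%:E)%E.

Definition potential (x : V) : R := \prod_i soft_mixture (x 0 i).

Lemma potential_ge0 x : 0 <= potential x.
Proof. by apply: prodr_ge0 => i _; exact: soft_mixture_ge0. Qed.

Let slopes (g : {ffun 'I_d -> option ('I_J * bool)}) : V := \row_i atom_slope (g i).

Lemma potential_expand x : potential x =
  \sum_(g : {ffun 'I_d -> option ('I_J * bool)})
    (\prod_i atom_weight (g i)) * expR (dotv x (slopes g)).
Proof.
rewrite /potential /soft_mixture bigA_distr_bigA; apply: eq_bigr => g _.
rewrite big_split/=; congr (_ * _); rewrite -expR_sum; congr expR.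
by apply: eq_bigr => i _; rewrite mxE mulrC.
Qed.

Lemma measurable_potential : measurable_fun setT (fun w => potential (n w)).
Proof.
under eq_fun do rewrite potential_expand.
apply: measurable_sum => g; apply: measurable_funM => //.
by apply: measurableT_comp => //; exact: measurable_dotv.
Qed.

(** Expanded over the coordinates, the potential is a positive combination of
    exponentials of linear forms in [n], to each of which the sub-Gaussian bound
    applies. *)
Lemma integral_potential (u : R) : 0 < u -> u <= 1 / 2 ->
  expR (- (theta ^+ 2 / 16)) = u ^+ 2 ->
  (\int[P]_w (potential (n w))%:E <= (expR (2 * u * d%:R))%:E)%E.
Proof.
move=> u0 u2 hu.
have w0 (g : {ffun 'I_d -> option ('I_J * bool)}) : 0 <= \prod_i atom_weight (g i).
  by apply: prodr_ge0 => i _; exact: atom_weight_ge0.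
have mE v : measurable_fun setT (fun w => (expR (dotv (n w : V) v))%:E).
  apply/measurable_EFinP; apply: measurableT_comp => //.
  exact: measurable_dotv.
under eq_integral do rewrite potential_expand -sumEFin.
rewrite ge0_integral_sum//; last 2 first.
- by move=> g; under eq_fun do rewrite EFinM; exact: measurable_funeM.
- by move=> g w _; rewrite lee_fin mulr_ge0// expR_ge0.
apply: (@le_trans _ _ (\sum_(g : {ffun 'I_d -> option ('I_J * bool)})
   ((\prod_i atom_weight (g i)) * expR (norm2 (slopes g) ^+ 2))%:E)%E).
  apply: lee_sum => g _; under eq_integral do rewrite EFinM.
  rewrite ge0_integralZl//; last by rewrite lee_fin.
  by rewrite EFinM lee_wpmul2l// lee_fin.
rewrite sumEFin lee_fin.
rewrite (eq_bigr (fun g : {ffun 'I_d -> option ('I_J * bool)} =>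
    \prod_i (atom_weight (g i) * expR (atom_slope (g i) ^+ 2)))); last first.
  move=> g _; rewrite big_split/= norm2_sqr /dotv expR_sum; congr (_ * _).
  by apply: eq_bigr => i _; rewrite !mxE expr2.
rewrite -(bigA_distr_bigA (fun _ a => atom_weight a * expR (atom_slope a ^+ 2))).
rewrite prodr_const card_ord expRM_natr; apply: lerXn2r; rewrite ?nnegrE ?expR_ge0//.
  by apply: sumr_ge0 => a _; rewrite mulr_ge0 ?atom_weight_ge0 ?expR_ge0.
apply: le_trans (expR_ge1Dx _); exact: soft_mixture_laplace.
Qed.

Lemma potential_tail (u T : R) : 0 < u -> u <= 1 / 2 ->
  expR (- (theta ^+ 2 / 16)) = u ^+ 2 ->
  (P [set w | (expR T < potential (n w))%R] <= (expR (2 * u * d%:R - T))%:E)%E.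
Proof.
move=> u0 u2 hu; set A := [set _ | _].
have mA : measurable A.
  have := @measurable_fun_ltr _ _ _ setT (cst (expR T)) _ (measurable_cst _) measurable_potential.
  by move=> /(_ measurableT [set true]); rewrite setTI; apply.
have PA : (P A = \int[P]_w (\1_A w : R)%:E)%E by rewrite integral_indic// setIT.
have := integral_potential u0 u2 hu.
have : ((expR T)%:E * P A <= \int[P]_w (potential (n w))%:E)%E.
  have mI : measurable_fun setT (fun w => (\1_A w : R)%:E).
    by apply/measurable_EFinP; exact: measurable_indic.
  have e0 : (0 <= (expR T)%:E)%E by rewrite lee_fin expR_ge0.
  rewrite PA -ge0_integralZl//.
  apply: ge0_le_integral => //.
  - by apply: measurable_funeM.
  - by apply/measurable_EFinP; exact: measurable_potential.
  move=> w _; rewrite -EFinM lee_fin indicE.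
  case: (boolP (w \in A)) => [/set_mem/ltW|_]; first by rewrite mulr1.
  by rewrite mulr0 potential_ge0.
move=> /le_trans h /h h2.
have -> : expR (2 * u * d%:R - T) = (expR T)^-1 * expR (2 * u * d%:R).
  by rewrite expRD expRN mulrC.
by rewrite EFinM lee_pdivlMl// expR_gt0.
Qed.

End Tail.
End SoftThreshold.

(** * One iteration outside the exceptional event *)

Section OneStep.
Context {R : realType} {d : nat}.
Local Notation V := 'rV[R]_d.
Implicit Types (u h g : V).

Lemma norm2_le_norm1 (x : V) : norm2 x <= norm1 x.
Proof.
have n0 : 0 <= norm1 x by apply: sumr_ge0.
rewrite -ler_sqr ?nnegrE ?norm2_ge0// norm2_sqr expr2 {2}/norm1 mulr_sumr.
apply: ler_sum => i _; apply: le_trans (ler_norm _) _; rewrite normrM.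
by rewrite ler_wpM2r// /norm1 (bigD1 i)//= lerDl sumr_ge0.
Qed.

(** As the l1 norm dominates the l2 norm, the sparsity condition forces [1 <= s]. *)
Lemma sparse_gradient_dim (x : V) (s : R) : x != 0 -> s < d%:R ->
  norm1 x <= Num.sqrt s * norm2 x -> (1 < d)%N.
Proof.
move=> x0 sd h; have n0 : 0 < norm2 x by rewrite norm2_gt0.
have : 1 <= Num.sqrt s.
  by rewrite -(ler_pM2r n0) mul1r; apply: le_trans h; exact: norm2_le_norm1.
move=> s1; have s1' : 1 <= s.
  have s0 : 0 <= s by rewrite leNgt; apply/negP => /ltW/ler0_sqrtr e; rewrite e ler10 in s1.
  by rewrite -(sqr_sqrtr s0) expr_ge1// sqrtr_ge0.
by rewrite -(ltr_nat R); exact: le_lt_trans sd.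
Qed.

Lemma exists_orthogonal u : (1 < d)%N -> exists2 h, norm2 h = 1 & dotv u h = 0.
Proof.
move=> d1; pose i : 'I_d := Ordinal (ltnW d1); pose j : 'I_d := Ordinal d1.
pose w : V := u 0 j *: delta_mx 0 i - u 0 i *: delta_mx 0 j.
have uw : dotv u w = 0 by rewrite dotvBr !dotvZr !dotv_delta; ring.
have [w0|w0] := eqVneq w 0.
  exists (delta_mx 0 i); first exact: norm2_delta.
  have := congr1 (fun z : V => z 0 j) w0; rewrite /w !mxE !eqxx /= mulr0 mulr1 sub0r.
  by move=> /eqP; rewrite oppr_eq0 dotv_delta => /eqP.
exists ((norm2 w)^-1 *: w); first exact: normalize_norm2.
by rewrite dotvZr uw mulr0.
Qed.

Section Correlation.
Context {dO : measure_display} {Omega : measurableType dO}.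
Local Notation BV := (borel_rV R d).
Variables (P : probability Omega R) (Z : Omega -> BV).
Hypothesis mZ : measurable_fun setT Z.
Hypothesis Z1 : forall w, norm2 (Z w : V) = 1.
Hypothesis Zinv : forall (U : 'M[R]_d) (A : set BV),
  U *m U^T = 1%:M -> measurable A ->
  P [set w | A ((Z w : V) *m U)] = P [set w | A (Z w)].
Variables (s : V -> R) (t : R) (u : V).
Hypothesis ms : measurable_fun setT (s : BV -> R).
Hypothesis s_pm1 : forall z, s z = 1 \/ s z = - 1.
Hypothesis t0 : 0 <= t.
Hypothesis u1 : norm2 u = 1.
Hypothesis s_pos : forall z, norm2 z = 1 -> 0 <= dotv z u -> s z = 1.
Hypothesis s_neg : forall z, norm2 z = 1 -> dotv z u < - t -> s z = - 1.
Hypothesis d1 : (1 < d)%N.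

(** Split [g] into its component along [u], which keeps only the fraction [dotv g u] of
    the correlation of [u], and an orthogonal rest, which gains at most [t / 3] per
    unit of length. *)
Lemma correlation_gap g : dotv g u <= 1 ->
  ((Num.sqrt (2 * d%:R))^-1 - 2 / 3 * t) * (1 - dotv g u)
    - t / 3 * norm2 (g - dotv g u *: u) <=
  Es P Z (fun z => s z * dotv z u) - Es P Z (fun z => s z * dotv z g).
Proof.
move=> gu; set q := dotv g u in gu *; set k := g - q *: u.
have hs := on_sphere_pm1 ms s_pm1.
have hd (v : V) : on_sphere (fun z => s z * dotv z v).
  by apply: on_sphereM => //; exact: on_sphere_dot.
have -> : Es P Z (fun z => s z * dotv z g) =
    q * Es P Z (fun z => s z * dotv z u) + Es P Z (fun z => s z * dotv z k).
  rewrite -(EsZ P mZ Z1 _ (hd u)) -(EsD P mZ Z1 (on_sphereZ q (hd u)) (hd k)).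
  congr (Ex P _); apply/funext => w; rewrite /k dotvBr dotvZr; ring.
have [h h1 uh] := exists_orthogonal u d1.
have along := sign_correlation_along mZ Z1 Zinv ms s_pm1 t0 u1 s_pos s_neg h1 uh.
have across : Es P Z (fun z => s z * dotv z k) <= t / 3 * norm2 k.
  have [->|k0] := eqVneq k 0.
    rewrite norm2_0 mulr0 (_ : (fun z => _) = fun=> 0) ?Es_cst//.
    by apply/funext => z; rewrite dotv0r mulr0.
  have nk : 0 < norm2 k by rewrite norm2_gt0.
  have uk : dotv u ((norm2 k)^-1 *: k) = 0.
    by rewrite dotvZr /k dotvBr dotvZr dotv_self1// (dotvC u) -/q mulr1 subrr mulr0.
  have := sign_correlation_across mZ Z1 Zinv ms s_pm1 t0 u1 s_pos s_neg
    (normalize_norm2 k0) uk.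
  have -> : (fun z => s z * dotv z k) =
      fun z => norm2 k * (s z * dotv z ((norm2 k)^-1 *: k)).
    by apply/funext => z; rewrite dotvZr; field; rewrite gt_eqF.
  move=> bound; rewrite (EsZ P mZ Z1 _ (hd _)) [leRHS]mulrC.
  by rewrite ler_pM2l.
have : ((Num.sqrt (2 * d%:R))^-1 - 2 / 3 * t) * (1 - q) <=
    Es P Z (fun z => s z * dotv z u) * (1 - q) by rewrite ler_wpM2r// subr_ge0.
lra.
Qed.

End Correlation.

Variables (f : V -> R) (L nu : R) (x p : V).
Hypothesis df : forall y, differentiable f y.
Hypothesis Lf : forall y z, norm2 (grad f y - grad f z) <= L * norm2 (y - z).
Hypothesis L0 : 0 < L.
Hypothesis cf : convex_function [set: convex_lmodType V] f.
Hypothesis nu0 : 0 < nu.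
Hypothesis mp : argmin f p.
Hypothesis rsc : nu / 2 * norm2 (x - p) ^+ 2 <= f x - f p.
Hypothesis xp : x != p.
Local Notation Delta := (norm2 (x - p)).
Local Notation G := (norm2 (grad f x)).

Let Delta0 : 0 < Delta.
Proof. by rewrite norm2_gt0 subr_eq0. Qed.

Lemma grad_dot_lower : nu / 2 * Delta ^+ 2 + (2 * L)^-1 * G ^+ 2 <= dotv (grad f x) (x - p).
Proof. by apply: le_trans (grad_dot_argmin df Lf L0 cf x mp); rewrite lerD2r. Qed.

Lemma grad_neq0 : 0 < G.
Proof.
rewrite norm2_gt0; apply/eqP => g0; have := grad_dot_lower.
rewrite g0 dotv0l norm2_0 expr0n mulr0 addr0 leNgt mulr_gt0 ?exprn_gt0//.
by rewrite divr_gt0.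
Qed.

(** The growth of [f] contributes [X] to the lower bound on the cosine [c], and its
    smoothness contributes [G / (2 L Delta)]; twice the product of the two is
    [nu / (2 L)]. *)
Lemma curvature_ratio (X := nu * Delta / (2 * G))
    (c := dotv (G^-1 *: grad f x) (Delta^-1 *: (x - p))) :
  [/\ 0 <= X, X <= c & nu / (2 * L) <= 2 * X * (c - X)].
Proof.
have G0 := grad_neq0; pose Y := G / (2 * L * Delta).
have X0 : 0 < X by rewrite divr_gt0// mulr_gt0.
have Y0 : 0 < Y by rewrite divr_gt0// !mulr_gt0.
have XY : 2 * X * Y = nu / (2 * L) by rewrite /X /Y; field; rewrite !gt_eqF.
have XYc : X + Y <= c.
  have := grad_dot_lower; have GD : 0 < (G * Delta)^-1 by rewrite invr_gt0 mulr_gt0.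
  rewrite -(ler_pM2r GD) => bound; rewrite /c dotvZl dotvZr mulrA -invfM mulrC.
  apply: le_trans bound; rewrite le_eqVlt; apply/orP; left; apply/eqP.
  by rewrite /X /Y; field; rewrite !gt_eqF.
split; [exact: ltW|apply: le_trans XYc; by rewrite lerDl ltW|].
by rewrite -XY ler_wpM2l ?lerBrDl// mulr_ge0// ltW.
Qed.

Variable r : R.
Hypothesis r0 : 0 < r.
Local Notation u := (G^-1 *: grad f x).
Local Notation t := (L * r / (2 * G)).

(** Convexity: [f] does not decrease in a direction of nonnegative slope. *)
Lemma comparison_pos (z : V) : 0 <= dotv z u -> comparison r f x z = 1.
Proof.
move=> zu; rewrite /comparison /sign_pm ifT// subr_ge0.
have := convex_tangent_le df Lf L0 cf x (x + r *: z).
apply: le_trans; rewrite lerDl addrC addKr dotvZr mulr_ge0 ?(ltW r0)//.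
by move: zu; rewrite dotvZr dotvC pmulr_rge0// invr_gt0 grad_neq0.
Qed.

(** Smoothness: a sufficiently negative slope prevails over the quadratic term. *)
Lemma comparison_neg (z : V) : norm2 z = 1 -> dotv z u < - t -> comparison r f x z = -1.
Proof.
move=> z1 zu; rewrite /comparison /sign_pm ifF//; apply/negbTE.
rewrite -ltNge subr_lt0; apply: le_lt_trans (smooth_le df Lf x (r *: z)) _.
rewrite dotvZr norm2Z z1 mulr1 (gtr0_norm r0) -addrA gtrDl.
have G0 := grad_neq0; move: zu; rewrite dotvZr dotvC => zu.
have : r * G * (G^-1 * dotv (grad f x) z) < r * G * - t by rewrite ltr_pM2l// mulr_gt0.
have -> : r * G * (G^-1 * dotv (grad f x) z) = r * dotv (grad f x) z by field; rewrite gt_eqF.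
have -> : r * G * - t = - (L / 2 * r ^+ 2) by field; rewrite gt_eqF.
lra.
Qed.

End OneStep.

(** * From the fluctuation bound to the alignment of the estimate *)

Section Estimate.
Context {R : realType} {d : nat}.
Local Notation V := 'rV[R]_d.
Implicit Types (u v g h x : V).

Definition feasible (s : R) h := norm1 h <= Num.sqrt s /\ norm2 h <= 1.

Lemma norm1N h : norm1 (- h) = norm1 h.
Proof. by apply: eq_bigr => i _; rewrite mxE normrN. Qed.

Lemma norm1Z (a : R) h : norm1 (a *: h) = `|a| * norm1 h.
Proof. by rewrite /norm1 mulr_sumr; apply: eq_bigr => i _; rewrite mxE normrM. Qed.

Lemma feasibleN s h : feasible s h -> feasible s (- h).
Proof. by move=> [h1 h2]; split; rewrite ?norm1N ?norm2N. Qed.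

(** A maximizer of the empirical correlation nearly maximizes its mean: the two
    objectives differ by a linear form that is uniformly small on the feasible set,
    and this form is evaluated at [g] and at [- u]. *)
Lemma maximizer_gap (m : nat) (y v : 'I_m -> V) (g u : V) (kappa B s : R) :
  0 < kappa -> feasible s g -> feasible s u ->
  \sum_i dotv (y i) u <= \sum_i dotv (y i) g ->
  (forall h, feasible s h -> dotv (kappa *: \sum_i (y i - v i)) h <= B) ->
  \sum_i (dotv (v i) u - dotv (v i) g) <= 2 * B / kappa.
Proof.
move=> k0 fg fu yug hB.
have e h : dotv (kappa *: \sum_i (y i - v i)) h =
    kappa * (\sum_i dotv (y i) h - \sum_i dotv (v i) h).
  rewrite dotvZl; congr (_ * _); rewrite -sumrB.
  elim/big_ind2: _ => [|a b a' b' <- <-|i _]; first by rewrite dotv0l.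
    by rewrite dotvDl.
  by rewrite dotvBl.
rewrite sumrB ler_pdivlMr//; have := hB _ fg; have := hB _ (feasibleN fu).
rewrite dotvNr !e; set a := \sum_i dotv (y i) u in yug *.
set b := \sum_i dotv (y i) g in yug *; have : kappa * a <= kappa * b by rewrite ler_pM2l.
lra.
Qed.

(** [D] and [M] are the square roots of the dimension and of the number of queries,
    [bet] and [y] the defects of the estimate along and across the gradient. *)
Lemma normalized_gap (D M E iD t X q delta eta bet y : R) :
  0 < D -> 0 < M -> 0 < delta -> 2 * delta <= q -> 0 <= t -> t * D <= X / 2 ->
  0 <= X -> X <= 1 -> 7 / 10 <= iD * D -> 0 <= bet -> 0 <= y ->
  E <= M * (eta ^+ 2 * delta / 128) ->
  M ^+ 2 * (q * ((iD - 2 / 3 * t) * bet - t / 3 * y)) <= 2 * (11 * E) / (D / M) ->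
  bet <= X / (21 / 5 - 2 * X) * y + eta ^+ 2 / 4.
Proof.
move=> D0 M0 de0 dq t0 tX X0 X1 iDD be0 y0 EM.
set g := _ - t / 3 * y => H.
have gD : g * D <= 11 / 128 * eta ^+ 2.
  have [g0|g0] := leP g 0.
    by apply: (@le_trans _ _ 0); [rewrite mulr_le0_ge0// ltW|rewrite mulr_ge0 ?sqr_ge0].
  have : M * (q * g * D) <= M * (22 * (eta ^+ 2 * delta / 128)).
    apply: (@le_trans _ _ (22 * E)); last by lra.
    rewrite -(ler_pM2r (divr_gt0 M0 D0)).
    have -> : M * (q * g * D) * (M / D) = M ^+ 2 * (q * g) by field; rewrite gt_eqF.
    apply: le_trans H _; rewrite le_eqVlt; apply/orP; left; apply/eqP; field.
    by rewrite !gt_eqF.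
  rewrite ler_pM2l// => h; have de2 : 0 < 2 * delta by rewrite mulr_gt0.
  rewrite -(ler_pM2l de2).
  have : 2 * delta * (g * D) <= q * (g * D) by rewrite ler_wpM2r// mulr_ge0 ?ltW.
  by move: h; rewrite -mulrA; lra.
have h1 : (7 / 10 - X / 3) * bet - X / 6 * y <= g * D.
  rewrite /g [leRHS]mulrBl; apply: lerB.
    by rewrite mulrAC ler_wpM2r// mulrBl; lra.
  by rewrite mulrAC ler_wpM2r//; lra.
have q0 : 0 < 21 / 5 - 2 * X by lra.
rewrite -(ler_pM2r q0) [leRHS](_ : _ = X * y + eta ^+ 2 / 4 * (21 / 5 - 2 * X)); last first.
  by field; rewrite gt_eqF//; lra.
have : eta ^+ 2 * (11 / 5) <= eta ^+ 2 * (21 / 5 - 2 * X).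
  by apply: ler_wpM2l; [exact: sqr_ge0|lra].
have := sqr_ge0 eta; lra.
Qed.

Lemma inv_sqrt_double (x : R) : 0 < x -> 7 / 10 <= (Num.sqrt (2 * x))^-1 * Num.sqrt x.
Proof.
move=> x0; have sx : 0 < Num.sqrt x by rewrite sqrtr_gt0.
have s2 : 0 < Num.sqrt 2 :> R by rewrite sqrtr_gt0.
rewrite sqrtrM// [leRHS](_ : _ = 1 / Num.sqrt 2); last by field; rewrite !gt_eqF.
rewrite ler_pdivlMr//; have : Num.sqrt 2 ^+ 2 = 2 :> R by rewrite sqr_sqrtr.
nra.
Qed.

Context {dO dS : measure_display} {Omega : measurableType dO}.
Context {S : measurableType dS}.
Local Notation BV := (borel_rV R d).
Variables (P : probability Omega R) (Q : probability S R) (m : nat).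
Variables (Z : 'I_m -> Omega -> BV) (W : 'I_m -> Omega -> S).
Variables (Cf : S -> V -> V -> R) (f : V -> R) (p L nu r s delta eta : R).
Hypothesis mZ : forall i, measurable_fun setT (Z i).
Hypothesis Z1 : forall i w, norm2 (Z i w : V) = 1.
Hypothesis Zinv : forall i (U : 'M[R]_d) (A : set BV),
  U *m U^T = 1%:M -> measurable A ->
  P [set w | A ((Z i w : V) *m U)] = P [set w | A (Z i w)].
Hypothesis mW : forall i, measurable_fun setT (W i).
Hypothesis WQ : forall i A, measurable A -> P (W i @^-1` A) = Q A.
Hypothesis ZW : forall i A B, measurable A -> measurable B ->
  (P ((Z i @^-1` A) `&` (W i @^-1` B)) = P (Z i @^-1` A) * P (W i @^-1` B))%E.
Hypothesis Cf1 : forall s x y, Cf s x y = 1 \/ Cf s x y = -1.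
Hypothesis mCf : measurable_fun setT (fun q : S * borel_rV R d * borel_rV R d =>
  Cf q.1.1 q.1.2 q.2).
Hypothesis acc : forall x y, Q (correct_answer f Cf x y) = p%:E.
Hypothesis accuracy : delta <= p - 1 / 2.
Hypothesis delta0 : 0 < delta.
Hypothesis df : forall y, differentiable f y.
Hypothesis Lf : forall y z, norm2 (grad f y - grad f z) <= L * norm2 (y - z).
Hypothesis L0 : 0 < L.
Hypothesis cf : convex_function [set: convex_lmodType V] f.
Hypothesis nu0 : 0 < nu.
Hypothesis eta0 : 0 < eta.
Hypothesis eta2 : eta <= 1 / 2.
Hypothesis m0 : (0 < m)%N.
Hypothesis r0 : 0 < r.

Let v i x := mean_response P (Z i) (W i) Cf r x.

(** At the scale [r] the strip in which the comparison may contradict the slope has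
    width at most [X / (2 sqrt d)], proportional to the typical size of a coordinate
    and small exactly when the gradient is large compared with the distance. *)
Lemma estimate_direction (x a g : V) (y : 'I_m -> V) (E : R) :
  argmin f a -> nu / 2 * norm2 (x - a) ^+ 2 <= f x - f a -> x != a ->
  norm1 (grad f x) <= Num.sqrt s * norm2 (grad f x) -> s < d%:R ->
  r <= norm2 (x - a) * nu / (2 * L * Num.sqrt d%:R) ->
  feasible s g -> (forall h, feasible s h -> \sum_i dotv (y i) h <= \sum_i dotv (y i) g) ->
  (forall h, feasible s h ->
     dotv (Num.sqrt (d%:R / m%:R) *: \sum_i (y i - v i x)) h <= 11 * E) ->
  E <= Num.sqrt m%:R * (eta ^+ 2 * delta / 128) ->
  nu / (2 * L) - eta <= dotv g ((norm2 (x - a))^-1 *: (x - a)).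
Proof.
move=> ma rsc xa sg sd rD fg gmax noise EM.
have G0 := grad_neq0 df Lf L0 cf nu0 ma rsc xa.
have gx0 : grad f x != 0 by rewrite -norm2_gt0.
have d1 := sparse_gradient_dim gx0 sd sg.
have dR : 0 < d%:R :> R by rewrite ltr0n ltnW.
have mR : 0 < m%:R :> R by rewrite ltr0n.
have De0 : 0 < norm2 (x - a) by rewrite norm2_gt0 subr_eq0.
set u := (norm2 (grad f x))^-1 *: grad f x.
have u1 : norm2 u = 1 := normalize_norm2 gx0.
have fu : feasible s u.
  split; last by rewrite u1.
  by rewrite norm1Z ger0_norm ?invr_ge0 ?norm2_ge0// ler_pdivrMl// mulrC.
have [X0 Xc nuX] := curvature_ratio df Lf L0 cf nu0 ma rsc xa.
have w1 : norm2 ((norm2 (x - a))^-1 *: (x - a)) = 1.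
  by apply: normalize_norm2; rewrite subr_eq0.
set X := nu * _ / _ in X0 Xc nuX.
have X1 : X <= 1.
  by apply: le_trans Xc _; apply: le_trans (dotv_le _ _) _; rewrite u1 w1 mulr1.
pose t := L * r / (2 * norm2 (grad f x)).
have t0 : 0 <= t by rewrite /t !mulr_ge0 ?invr_ge0 ?mulr_ge0 ?norm2_ge0// ltW.
have sD : 0 < Num.sqrt d%:R :> R by rewrite sqrtr_gt0.
have tX : t * Num.sqrt d%:R <= X / 2.
  have k0 : 0 < L / (2 * norm2 (grad f x)) * Num.sqrt d%:R by rewrite mulr_gt0// divr_gt0// mulr_gt0.
  have : L / (2 * norm2 (grad f x)) * Num.sqrt d%:R * r <=
     L / (2 * norm2 (grad f x)) * Num.sqrt d%:R * (norm2 (x - a) * nu / (2 * L * Num.sqrt d%:R)).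
    by rewrite ler_pM2l.
  have -> : L / (2 * norm2 (grad f x)) * Num.sqrt d%:R * r = t * Num.sqrt d%:R.
    by rewrite /t; field; rewrite gt_eqF.
  move=> /le_trans; apply; rewrite le_eqVlt; apply/orP; left; apply/eqP.
  by rewrite /X; field; rewrite !gt_eqF.
have gu1 : dotv g u <= 1.
  by apply: le_trans (dotv_le _ _) _; rewrite u1 mulr1; case: fg.
have gap i : dotv (v i x) u - dotv (v i x) g >= (2 * p - 1) *
    (((Num.sqrt (2 * d%:R))^-1 - 2 / 3 * t) * (1 - dotv g u)
      - t / 3 * norm2 (g - dotv g u *: u)).
  have cont : continuous f by move=> z; exact: differentiable_continuous.
  have mc := mean_response_correlation r (mZ i) (Z1 i) (mW i) Cf1 mCf (WQ i) (ZW i) acc cont.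
  have q0 : 0 <= 2 * p - 1 by move: accuracy delta0; lra.
  rewrite !mc -mulrBr; apply: ler_wpM2l => //.
  apply: (correlation_gap (mZ i) (Z1 i) (Zinv i) (measurable_comparison r cont x)
    (comparison_pm1 r f x) t0 u1 _ _ d1 gu1) => z z1.
    exact: (comparison_pos df Lf L0 cf nu0 ma rsc xa r0).
  exact: (comparison_neg df Lf L0 cf nu0 ma rsc xa r0).
have k0 : 0 < Num.sqrt (d%:R / m%:R) :> R by rewrite sqrtr_gt0 divr_gt0.
have total := maximizer_gap k0 fg fu (gmax _ fu) noise.
have e0 : 0 <= eta ^+ 2 / 4 by rewrite divr_ge0 ?sqr_ge0.
apply: (estimate_alignment u1 w1 _ X0 Xc nuX eta0 eta2 e0 (lexx _)); first by case: fg.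
apply: (@normalized_gap (Num.sqrt d%:R) (Num.sqrt m%:R) E (Num.sqrt (2 * d%:R))^-1
  t X (2 * p - 1) delta eta) => //; rewrite ?sqrtr_gt0 ?subr_ge0 ?norm2_ge0//.
- by move: accuracy; lra.
- exact: inv_sqrt_double.
have kE : Num.sqrt d%:R / Num.sqrt m%:R = Num.sqrt (d%:R / m%:R) :> R.
  by rewrite sqrtrM ?ler0n// sqrtrV ?ler0n.
rewrite kE sqr_sqrtr ?ler0n//.
apply: le_trans total.
rewrite [leLHS](_ : _ = \sum_(i < m) (2 * p - 1) *
    (((Num.sqrt (2 * d%:R))^-1 - 2 / 3 * t) * (1 - dotv g u)
      - t / 3 * norm2 (g - dotv g u *: u))); last by rewrite sumr_const card_ord -[RHS]mulr_natl.
by apply: ler_sum => i _; exact: gap.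
Qed.

End Estimate.

Section Step.
Context {R : realType} {d : nat}.
Implicit Types (x a g : 'rV[R]_d).

Lemma step_sqr (alpha b : R) x a g : 0 < alpha -> norm2 g <= 1 -> x != a ->
  b <= dotv g ((norm2 (x - a))^-1 *: (x - a)) ->
  norm2 (x - alpha *: g - a) ^+ 2 <=
  norm2 (x - a) ^+ 2 - 2 * alpha * b * norm2 (x - a) + alpha ^+ 2.
Proof.
move=> al0 g1 xa; have De0 : 0 < norm2 (x - a) by rewrite norm2_gt0 subr_eq0.
rewrite dotvZr ler_pdivlMl// => hb.
have -> : x - alpha *: g - a = (x - a) - alpha *: g by rewrite addrAC.
move: (x - a) hb => w hb.
rewrite [leLHS]norm2_sqr !(dotvBl, dotvBr, dotvZl, dotvZr) -!norm2_sqr (dotvC w g).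
have : alpha * (norm2 w * b) <= alpha * dotv g w by rewrite ler_pM2l.
have : alpha ^+ 2 * norm2 g ^+ 2 <= alpha ^+ 2.
  by rewrite ler_piMr ?sqr_ge0// expr_le1 ?norm2_ge0.
lra.
Qed.

Lemma step_le (alpha : R) x a g : 0 < alpha -> norm2 g <= 1 ->
  norm2 (x - alpha *: g - a) <= norm2 (x - a) + alpha.
Proof.
move=> al0 g1; rewrite addrAC; apply: le_trans (norm2D _ _) _.
by rewrite norm2N norm2Z gtr0_norm// lerD2l ler_piMr// ltW.
Qed.

End Step.

(** * The exceptional event of one iteration *)

Section Unitize.
Context {R : realType} {d : nat} {dO : measure_display}.
Context {Omega : measurableType dO}.
Local Notation V := 'rV[R]_d.
Local Notation BV := (borel_rV R d).
Variables (e : V) (P : probability Omega R).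
Hypothesis e1 : norm2 e = 1.

(** The directions have norm one only almost surely; on the exceptional null set
    they are replaced by a fixed unit vector. *)
Definition unitize (z : BV) : BV := if norm2 (z : V) == 1 then z else e.

Lemma norm2_unitize z : norm2 (unitize z : V) = 1.
Proof. by rewrite /unitize; case: eqP. Qed.

Lemma measurable_unitize : measurable_fun setT unitize.
Proof.
apply: measurable_fun_ifT => //; apply: measurable_fun_eqr => //.
exact: (@measurable_norm2 _ _ _ _ (fun z : BV => z)).
Qed.

(** An event of full measure does not influence probabilities. *)
Lemma full_measure_eq (N A B : set Omega) : measurable N -> measurable A -> measurable B ->
  P N = 1%E -> N `&` A = N `&` B -> P A = P B.
Proof.
move=> mN mA mB N1 AB.
have null C : measurable C -> P C = P (N `&` C).
  move=> mC; have -> : P C = (P (C `\` N) + P (C `&` N))%E.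
    by rewrite -measureDI.
  rewrite (setIC C); suff -> : P (C `\` N) = 0%E by rewrite add0e.
  apply/eqP; rewrite eq_le measure_ge0 andbT.
  have N0 : P (~` N) = 0%E by have := probability_setC P mN; rewrite N1 subee.
  rewrite -N0; apply: le_measure; rewrite ?inE; [exact: measurableD|exact: measurableC|].
  by move=> x [].
by rewrite (null A)// AB -null.
Qed.

Variable Z : Omega -> BV.
Hypothesis Zu : uniform_on_sphere P Z.

Lemma measurable_unit_event : measurable [set w | norm2 (Z w : V) = 1].
Proof.
have [mZ _ _] := Zu.
have := measurable_norm2 mZ measurableT (measurable_set1 (1 : R)).
by rewrite setTI.
Qed.

Lemma unitize_invariant (U : 'M[R]_d) (A : set BV) : U *m U^T = 1%:M -> measurable A ->
  P [set w | A ((unitize (Z w) : V) *m U)] = P [set w | A (unitize (Z w))].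
Proof.
move=> UU mA; have [mZ Z1 Zinv] := Zu.
have mZu := measurableT_comp measurable_unitize mZ.
have mN := measurable_unit_event.
have pre (F : Omega -> BV) : measurable_fun setT F -> measurable [set w | A (F w)].
  by move=> mF; have := mF measurableT A mA; rewrite setTI.
transitivity (P [set w | A ((Z w : V) *m U)]).
  apply: (full_measure_eq mN) => //; [apply: pre; exact: measurable_mulmx..|].
  apply/seteqP; split=> w [/= n1]; rewrite /unitize n1 eqxx; exact: conj.
rewrite Zinv//; apply: (full_measure_eq mN) => //; [exact: pre..|].
apply/seteqP; split=> w [/= n1]; rewrite /unitize n1 eqxx; exact: conj.
Qed.

Lemma sigma_of_unitize : sigma_of (fun w => unitize (Z w)) `<=` sigma_of Z.
Proof.
move=> _ [A mA <-]; exists (unitize @^-1` A) => //.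
by have := measurable_unitize measurableT mA; rewrite setTI.
Qed.

End Unitize.

Lemma mutually_independent_sub {R : realType} {dO} {Omega : measurableType dO}
    (P : probability Omega R) (I : finType) (F F' : I -> set (set Omega)) :
  (forall i, F' i `<=` F i) -> mutually_independent P F -> mutually_independent P F'.
Proof. by move=> FF ind J E JE; apply: ind => i /JE /FF. Qed.

Section Noise.
Context {dO dS : measure_display} {Omega : measurableType dO} {R : realType}.
Context {S : measurableType dS} {d m : nat}.
Local Notation V := 'rV[R]_d.
Local Notation BV := (borel_rV R d).
Variable P : probability Omega R.
Variables (past : set (set Omega)) (X : Omega -> BV).
Variables (Z : 'I_m -> Omega -> BV) (W : 'I_m -> Omega -> S).
Variables (Cf : S -> V -> V -> R) (r : R).
Hypothesis past_sigma : sigma_algebra setT past.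
Hypothesis past_measurable : past `<=` measurable.
Hypothesis mX : forall A, measurable A -> past (X @^-1` A).
Hypothesis mZ : forall i, measurable_fun setT (Z i).
Hypothesis Z1 : forall i w, norm2 (Z i w : V) = 1.
Hypothesis Zinv : forall i (U : 'M[R]_d) (A : set BV),
  U *m U^T = 1%:M -> measurable A ->
  P [set w | A ((Z i w : V) *m U)] = P [set w | A (Z i w)].
Hypothesis mW : forall i, measurable_fun setT (W i).
Hypothesis fresh : mutually_independent P (fresh_family past Z W).
Hypothesis Cf1 : forall s x y, Cf s x y = 1 \/ Cf s x y = -1.
Hypothesis mCf : measurable_fun setT (fun q : S * borel_rV R d * borel_rV R d =>
  Cf q.1.1 q.1.2 q.2).
Hypothesis m0 : (0 < m)%N.
Hypothesis d0 : (0 < d)%N.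

Lemma fresh_pair_independent i A B : measurable A -> measurable B ->
  (P ((Z i @^-1` A) `&` (W i @^-1` B)) = P (Z i @^-1` A) * P (W i @^-1` B))%E.
Proof.
move=> mA mB; pose a : option ('I_m + 'I_m) := Some (inl i).
pose b : option ('I_m + 'I_m) := Some (inr i).
pose E c := if c == a then Z i @^-1` A else W i @^-1` B.
have Ea : E a = Z i @^-1` A by rewrite /E eqxx.
have Eb : E b = W i @^-1` B by [].
have ab : a \notin [set b]%SET by rewrite inE.
have := fresh (J := [set a; b]%SET) (E := E).
rewrite !big_setU1//= !big_set1 Ea Eb; apply.
move=> c; rewrite !inE => /orP[] /eqP ->; rewrite ?Ea ?Eb.
  by exists A => //; rewrite setTI.
by exists B => //; rewrite setTI.
Qed.

Let v i x := mean_response P (Z i) (W i) Cf r x.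

(** The difference between the empirical objective and its mean, as a linear form.
    The [m] responses contribute [norm2 v ^+ 2 / d] each to the exponent of its Laplace
    transform, and the scaling brings their sum to [norm2 v ^+ 2]. *)
Definition noise w : V := Num.sqrt (d%:R / m%:R) *:
  \sum_i (response Cf r (X w) (Z i w) (W i w) - v i (X w)).

Let centered i (t : BV * (BV * S)) : V := response Cf r t.1 t.2.1 t.2.2 - v i t.1.

Let measurable_centered i : measurable_fun setT (centered i : _ -> BV).
Proof.
have mv : measurable_fun setT (fun t : BV * (BV * S) => v i t.1 : BV).
  exact: (measurableT_comp (measurable_mean_response P r (mZ i) (Z1 i) (mW i) Cf1 mCf)
    measurable_fst).
rewrite (_ : centered i = fun t => response Cf r t.1 t.2.1 t.2.2 + (-1) *: v i t.1).
  by apply: measurable_rVD; [exact: measurable_response|exact: measurable_rVZ].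
by apply/funext => t; rewrite scaleN1r.
Qed.

Let mX0 : measurable_fun setT X.
Proof. by move=> _ A mA; rewrite setTI; exact/past_measurable/mX. Qed.

Lemma dotv_noise w h :
  dotv (noise w) h = \sum_i dotv (centered i (X w, (Z i w, W i w)))
    (Num.sqrt (d%:R / m%:R) *: h).
Proof.
rewrite /noise dotvZl dotvC dotv_sumr mulr_sumr; apply: eq_bigr => i _.
by rewrite dotvZr dotvC.
Qed.

Lemma measurable_noise : measurable_fun setT (noise : Omega -> BV).
Proof.
apply: measurable_fun_coords => j.
under eq_fun do rewrite -dotv_delta dotv_noise.
apply: measurable_sum => i; apply: measurable_dotv => //.
apply: (measurableT_comp (measurable_centered i)
  (g := fun w => (X w, (Z i w, W i w)))).
by apply: measurable_fun_pair => //; exact: measurable_fun_pair.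
Qed.

Lemma noise_laplace h :
  (\int[P]_w (expR (dotv (noise w) h))%:E <= (expR (norm2 h ^+ 2))%:E)%E.
Proof.
have mR : 0 < m%:R :> R by rewrite ltr0n.
have dR : 0 < d%:R :> R by rewrite ltr0n.
set k := Num.sqrt (d%:R / m%:R : R).
have k2 : k ^+ 2 = d%:R / m%:R by rewrite sqr_sqrtr// divr_ge0.
pose psi i t := expR (dotv (centered i t) (k *: h)).
have mpsi i : measurable_fun setT (psi i).
  by apply: measurableT_comp => //; exact: measurable_dotv.
have -> : expR (norm2 h ^+ 2) = expR (norm2 h ^+ 2 / m%:R) ^+ m.
  by rewrite -expRM_natl; congr expR; field; rewrite gt_eqF.
under eq_integral => w _ do rewrite dotv_noise expR_sum.
apply: (fresh_product_le past_sigma past_measurable mX mZ mW fresh mpsi) => //.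
  by move=> i t; exact: expR_ge0.
move=> i x; rewrite (@Ex_integral _ _ _ P (fun w => psi i (x, (Z i w, W i w)))).
  rewrite lee_fin; apply: le_trans (response_laplace r (mZ i) (Z1 i) (mW i) Cf1 mCf (Zinv i) x _) _.
  rewrite norm2Z ger0_norm ?sqrtr_ge0// exprMn k2 ler_expR le_eqVlt; apply/orP; left; apply/eqP.
  by field; rewrite !gt_eqF.
apply: bounded_rv_expR; split.
  have mx : measurable_fun setT (fun w => ((x : BV), (Z i w, W i w))).
    by apply: measurable_fun_pair => //; exact: measurable_fun_pair.
  by apply: measurable_dotv => //; exact: (measurableT_comp (measurable_centered i) mx).
exists (2 * norm2 (k *: h)) => w; apply: le_trans (cauchy_schwarz _ _) _.
rewrite ler_wpM2r ?norm2_ge0//; apply: le_trans (norm2D _ _) _.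
rewrite norm2N norm2_response// Z1.
by have := norm2_mean_response P r (mZ i) (Z1 i) (mW i) Cf1 mCf x; lra.
Qed.

Lemma noise_bounded : exists B : R, forall w i, `|noise w 0 i| <= B.
Proof.
pose k := Num.sqrt (d%:R / m%:R : R).
exists (\sum_(i < m) 2 * k) => w j.
rewrite -dotv_delta dotv_noise; apply: le_trans (ler_norm_sum _ _ _) _.
apply: ler_sum => i _; apply: le_trans (cauchy_schwarz _ _) _.
rewrite norm2Z norm2_delta mulr1 ger0_norm ?sqrtr_ge0// ler_wpM2r ?sqrtr_ge0//.
apply: le_trans (norm2D _ _) _; rewrite norm2N norm2_response// Z1.
by have := norm2_mean_response P r (mZ i) (Z1 i) (mW i) Cf1 mCf (X w); lra.
Qed.

(** The threshold [theta] is chosen so that the potential, a product over [d]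
    coordinates, has expectation at most [(1 + s / d) ^ d <= exp s]. By Markov's
    inequality it exceeds [exp (s + s l)] with probability at most [exp (- s l)]. *)
Lemma noise_event (s : R) (l := ln (2 * d%:R / s)) : 0 < s -> s < d%:R ->
  exists2 B : set Omega, measurable B /\ (P B <= (expR (- (s * l)))%:E)%E &
    forall w, ~ B w -> forall h, feasible s h ->
      dotv (noise w) h <= 11 * Num.sqrt (s * l).
Proof.
move=> s0 sd; have dR : 0 < d%:R :> R by rewrite ltr0n.
have q0 : 0 < 2 * d%:R / s by rewrite divr_gt0// mulr_gt0.
pose u := s / (2 * d%:R); have u0 : 0 < u by rewrite divr_gt0// mulr_gt0.
have u2 : u <= 1 / 2 by rewrite ler_pdivrMr ?mulr_gt0//; lra.
have lE : expR (- l) = u.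
  by rewrite expRN lnK ?posrE// invf_div.
have l2 : 1 / 2 <= l.
  by have := expR_ge1Dx (- l); rewrite lE; lra.
pose theta := Num.sqrt (32 * l).
have th0 : 0 < theta by rewrite sqrtr_gt0; lra.
have th2 : theta ^+ 2 = 32 * l by rewrite sqr_sqrtr//; lra.
have thu : expR (- (theta ^+ 2 / 16)) = u ^+ 2.
  by rewrite -lE -expRM_natl th2; congr expR; field.
have [b hb] := noise_bounded.
pose J := Num.truncn (Num.max 0 b / theta).
have bJ : b < J.+1%:R * theta.
  have b0 : 0 <= Num.max 0 b / theta by rewrite divr_ge0 ?le_max ?lexx// ltW.
  have /andP[_] := truncn_itv b0; rewrite ltr_pdivrMr//; apply: le_lt_trans.
  by rewrite le_max lexx orbT.
pose T := s + s * l.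
have sl0 : 0 < s * l by rewrite mulr_gt0//; lra.
have T0 : 0 <= T by rewrite /T; lra.
exists [set w | expR T < potential theta J (noise w)].
  split.
    have := @measurable_fun_ltr _ _ _ setT (cst (expR T)) _ (measurable_cst _)
      (measurable_potential theta J measurable_noise).
    by move=> /(_ measurableT [set true]); rewrite setTI; apply.
  have := potential_tail J measurable_noise noise_laplace T u0 u2 thu.
  have -> : 2 * u * d%:R - T = - (s * l) by rewrite /T /u; field; rewrite gt_eqF.
  by [].
move=> w /negP; rewrite -leNgt => pT h [h1 h2].
have nJ i : `|noise w 0 i| < J.+1%:R * theta by apply: le_lt_trans bJ.
apply: le_trans (soft_mixture_dual th0 nJ h1 h2 pT T0) _.
have r1 : theta * Num.sqrt s <= 6 * Num.sqrt (s * l).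
  rewrite -sqrtrM; last by lra.
  rewrite -(@ger0_norm _ 6)// -sqrtr_sqr -sqrtrM ?sqr_ge0//; apply: ler_wsqrtr; lra.
have r2 : Num.sqrt (8 * T) <= 5 * Num.sqrt (s * l).
  rewrite -(@ger0_norm _ 5)// -sqrtr_sqr -sqrtrM ?sqr_ge0//; apply: ler_wsqrtr.
  have : s * (1 / 2) <= s * l by rewrite ler_pM2l.
  rewrite /T; lra.
lra.
Qed.

End Noise.

(** * The run of the algorithm *)

Section Run.
Context {R : realType} {d : nat} {dS dO : measure_display}.
Context {S : measurableType dS} {Omega : measurableType dO}.
Local Notation V := 'rV[R]_d.
Local Notation BV := (borel_rV R d).

Lemma measurable_iterates {dT} {T : measurableType dT} (X G : nat -> T -> V) (x0 : V)
    (alpha : R) (K : nat) :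
  (forall w, X 0%N w = x0) ->
  (forall k w, (k < K)%N -> X k.+1 w = X k w - alpha *: G k w) ->
  (forall k, (k < K)%N -> measurable_fun setT (G k : T -> BV)) ->
  forall k, (k <= K)%N -> measurable_fun setT (X k : T -> BV).
Proof.
move=> X0 XS mG; elim=> [_|k ih kK].
  by rewrite (_ : X 0%N = cst x0)//; apply/funext.
rewrite (_ : X k.+1 = fun w => X k w + (- alpha) *: G k w).
  by apply: measurable_rVD; [exact/ih/ltnW|apply: measurable_rVZ; exact: mG].
by apply/funext => w; rewrite XS// scaleNr.
Qed.

Variables (P : probability Omega R) (Q : probability S R).
Variables (Cf : S -> V -> V -> R) (x0 : V) (s alpha r : R) (m K : nat).
Variables (Z : nat -> nat -> Omega -> V) (W : nat -> nat -> Omega -> S).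
Variables (G X : nat -> Omega -> V).
Hypothesis run : scobo_run P Q Cf x0 s m r K (fun=> alpha) Z W G X.

Lemma past_measurable k : (k < K)%N -> past m Z W G k `<=` measurable.
Proof.
move=> kK; apply: smallest_sub; first exact: sigma_algebra_measurable.
move=> A [j jk]; have jK := ltn_trans jk kK.
case=> [[i im] [] [B mB <-]|[B mB <-]].
- by have [mZ _ _] := run_direction_law run jK im; exact: mZ.
- exact: (run_seed_measurable run jK im).
- exact: (run_grad_measurable run jK).
Qed.

Lemma iterate_past k A : (k < K)%N -> measurable (A : set BV) -> past m Z W G k (X k @^-1` A).
Proof.
move=> kK mA; pose T := g_sigma_algebraType [set A | exists2 j, (j < k)%N &
  (exists2 i, (i < m)%N &
     sigma_of (Z j i : Omega -> BV) A \/ sigma_of (W j i) A)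
  \/ sigma_of (G j : Omega -> BV) A].
have mG j : (j < k)%N -> measurable_fun setT (G j : T -> BV).
  move=> jk _ B mB; apply: sub_sigma_algebra; exists j => //; right.
  by exists B.
have XS j w : (j < k)%N -> X j.+1 w = X j w - alpha *: G j w.
  by move=> jk; rewrite (run_step run)// (ltn_trans jk).
have := measurable_iterates (T := T) (run_init run) XS mG (leqnn k) measurableT mA.
by rewrite setTI.
Qed.

Hypothesis Cf1 : forall s x y, Cf s x y = 1 \/ Cf s x y = -1.
Hypothesis mCf : measurable_fun setT (fun q : S * borel_rV R d * borel_rV R d =>
  Cf q.1.1 q.1.2 q.2).
Hypothesis m0 : (0 < m)%N.
Hypothesis s0 : 0 < s.
Hypothesis sd : s < d%:R.
Variable e : V.
Hypothesis e1 : norm2 e = 1.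
Local Notation Zu k := (fun i : 'I_m => unitize e \o Z k i).
Local Notation Wu k := (fun i : 'I_m => W k i).
Local Notation l := (ln (2 * d%:R / s)).

Section Fresh.
Variable k : nat.
Hypothesis kK : (k < K)%N.
Let law (i : 'I_m) := run_direction_law run kK (ltn_ord i).

Lemma measurable_unit_direction i : measurable_fun setT (Zu k i).
Proof. by have [mZ _ _] := law i; exact: (measurableT_comp (measurable_unitize e) mZ). Qed.

Lemma fresh_unit_directions :
  mutually_independent P (fresh_family (past m Z W G k) (Zu k) (Wu k)).
Proof.
apply: mutually_independent_sub (run_fresh run kK) => -[[i|i]|] //.
exact: sigma_of_unitize.
Qed.

Lemma iteration_event :
  exists2 B : set Omega, measurable B /\ (P B <= (expR (- (s * l)))%:E)%E &
    forall w, ~ B w -> forall h, feasible s h ->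
      dotv (noise P (X k) (Zu k) (Wu k) Cf r w) h <= 11 * Num.sqrt (s * l).
Proof.
have d0 : (0 < d)%N by rewrite -(ltr_nat R) (lt_trans s0).
apply: (noise_event r _ (past_measurable kK) (fun A => iterate_past kK)
  measurable_unit_direction _ _ _ fresh_unit_directions Cf1 mCf m0 d0 s0 sd) => //.
- exact: smallest_sigma_algebra.
- by move=> i w; exact: norm2_unitize.
- by move=> i U A; exact: (unitize_invariant _ (law i)).
- by move=> i; exact: (run_seed_measurable run kK (ltn_ord i)).
Qed.

End Fresh.

(** A union bound over the iterations and over the null sets where some direction does
    not have norm one. *)
Lemma run_event :
  exists2 B : set Omega,
    measurable B /\ (P B <= (K%:R * expR (- (s * l)))%:E)%E &
    forall w, ~ B w -> forall k, (k < K)%N ->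
      (forall i : 'I_m, Zu k i w = Z k i w) /\
      forall h, feasible s h ->
        dotv (noise P (X k) (Zu k) (Wu k) Cf r w) h <= 11 * Num.sqrt (s * l).
Proof.
have ev k : {B : set Omega | (k < K)%N ->
   [/\ measurable B, (P B <= (expR (- (s * l)))%:E)%E &
    forall w, ~ B w -> forall h, feasible s h ->
      dotv (noise P (X k) (Zu k) (Wu k) Cf r w) h <= 11 * Num.sqrt (s * l)]}.
  apply: cid; case: (ltnP k K) => [kK|]; last by exists set0.
  by have [B [mB PB] hB] := iteration_event kK; exists B.
pose N (k i : nat) := ~` [set w | norm2 (Z k i w) = 1].
have hN k i : (k < K)%N -> (i < m)%N -> measurable (N k i) /\ P (N k i) = 0%E.
  move=> kK im; have law := run_direction_law run kK im.
  have mN := measurable_unit_event law; split; first exact: measurableC.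
  by have [_ N1 _] := law; rewrite /N probability_setC// N1 subee.
pose Nk k := \big[setU/set0]_(i < m) N k i.
have mNk k : (k < K)%N -> measurable (Nk k).
  by move=> kK; apply: bigsetU_measurable => i _; case: (hN k i kK (ltn_ord i)).
pose B k := sval (ev k) `|` Nk k.
have hB k : (k < K)%N -> measurable (B k) /\ (P (B k) <= (expR (- (s * l)))%:E)%E.
  move=> kK; have [mb Pb _] := svalP (ev k) kK; split.
    by apply: measurableU => //; exact: mNk.
  apply: le_trans (measureU2 _ _ _) _ => //; first exact: mNk.
  rewrite -[leRHS]adde0; apply: leeD => //.
  rewrite (le_trans (Boole_inequality _ _)) ?big1// => i.
    by move=> im; case: (hN k i kK im).
  by case: (hN k i kK (ltn_ord i)).
exists (\big[setU/set0]_(k < K) B k).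
  split; first by apply: bigsetU_measurable => k _; case: (hB k (ltn_ord k)).
  apply: le_trans (Boole_inequality _ _) _; first by move=> k kK; case: (hB k kK).
  apply: (@le_trans _ _ (\sum_(k < K) (expR (- (s * l)))%:E)%E).
    by apply: lee_sum => k _; case: (hB k (ltn_ord k)).
  by rewrite sumEFin sumr_const card_ord lee_fin [leRHS]mulr_natl.
move=> w wB k kK; have wk : ~ B k w.
  by move=> bk; apply: wB; rewrite -bigcup_mkord; exists k.
have [_ _ hk] := svalP (ev k) kK; split; last first.
  by apply: hk => bk; apply: wk; left.
move=> i; rewrite /= /unitize ifT//; apply/eqP; apply: contrapT => n1.
by apply: wk; right; rewrite /Nk -bigcup_mkord; exists i => //=.
Qed.

End Run.

(** * Convergence with high probability *)

Theorem theorem5p1 (R : realType) :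
  exists C c : R, 0 < C /\ 0 < c /\
  forall (d : nat) (s nu L : R) (f : 'rV[R]_d -> R)
    (dS : measure_display) (S : measurableType dS) (Q : probability S R)
    (Cf : S -> 'rV[R]_d -> 'rV[R]_d -> R) (delta0 mu : R)
    (x0 : 'rV[R]_d) (alpha eta : R),
  0 < s -> s < d%:R ->
  0 < nu -> nu <= L ->
  F_class L nu d f -> CG s d f ->
  0 < delta0 -> delta0 < mu -> mu <= 1 / 2 ->
  poly_comparison_oracle Q f delta0 mu 1 Cf ->
  constant_accuracy Q f Cf ->
  0 < alpha ->
  0 < eta -> eta < nu / (2 * L) ->
  let Delta0 := norm2 (x0 - proj_argmin f x0) in
  let rho := (1 - eta ^+ 2) / (nu / (2 * L) - eta) in
  let K := ceil_nat ((Delta0 - alpha * eta) ^+ 3 /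
             ((alpha * rho) ^+ 2 * (alpha * nu / (2 * L) - alpha * eta))) in
  let m := ceil_nat (C / (eta ^+ 4 * delta0 ^+ 2) * s * ln (2 * d%:R / s)) in
  let r := alpha * nu * rho / (2 * L * Num.sqrt d%:R) in
  forall (dO : measure_display) (Omega : measurableType dO)
    (P : probability Omega R) (Z : nat -> nat -> Omega -> 'rV[R]_d)
    (W : nat -> nat -> Omega -> S) (G X : nat -> Omega -> 'rV[R]_d),
  scobo_run P Q Cf x0 s m r K (fun=> alpha) Z W G X ->
  (forall w, size (scobo_queries m r K Z X w) = (m * K)%N) /\
  ((1 - 8 * K%:R * expR (- c * eta ^+ 4 * s * ln (2 * d%:R / s)))%:E
     <= P [set w | f (X K w) - minval f <= L / 2 * alpha ^+ 2 * (1 + rho) ^+ 2]%R)%E.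
Proof.
exists (128 ^+ 2), 1; split; first exact: exprn_gt0; split; first exact: ltr01.
move=> d s nu L f dS S Q Cf delta0 mu x0 alpha eta s0 sd nu0 nuL fF fCG de0 demu mu2
  oracle [p acc] al0 eta0 etab Delta0 rho K m r dO Omega P Z W G X run.
split.
  by move=> w; rewrite /scobo_queries size_allpairs !size_iota mulnC.
have [[df _ _] cf Lf attained rsc] := fF.
have L0 : 0 < L by exact: lt_le_trans nuL.
have dR : 0 < d%:R :> R by exact: lt_trans sd.
have d0 : (0 < d)%N by rewrite -(ltr_nat R).
have b2 : nu / (2 * L) <= 1 / 2 by rewrite ler_pdivrMr ?mulr_gt0//; lra.
have rho0 : 0 < rho by rewrite divr_gt0 ?subr_gt0//; nra.
have [_ _ _ Cf1 mCf correct] := oracle.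
have accuracy : delta0 <= p - 1 / 2.
  have := correct 0 0; rewrite acc lee_fin !subrr powRr0 mulr1 min_l; last exact: ltW.
  by lra.
set l := ln (2 * d%:R / s) in m run *.
have l0 : 0 < l by rewrite ln_gt0// ltr_pdivlMr//; lra.
have sl0 : 0 < s * l by rewrite mulr_gt0.
(* This is the bound on the deviation that the choice C = 128 ^ 2 ensures. *)
have EM : Num.sqrt (s * l) <= Num.sqrt m%:R * (eta ^+ 2 * delta0 / 128).
  have q0 : 0 < eta ^+ 2 * delta0 / 128 by rewrite divr_gt0// mulr_gt0// exprn_gt0.
  rewrite -[leRHS](_ : Num.sqrt (m%:R * (eta ^+ 2 * delta0 / 128) ^+ 2) = _); last first.
    by rewrite sqrtrM ?ler0n// sqrtr_sqr gtr0_norm.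
  apply: ler_wsqrtr.
  have := le_ceil_nat (128 ^+ 2 / (eta ^+ 4 * delta0 ^+ 2) * s * l); rewrite -/m => hm.
  rewrite -(ler_pM2r (exprn_gt0 2 q0)) in hm; apply: le_trans hm.
  rewrite le_eqVlt; apply/orP; left; apply/eqP; field.
  by rewrite !gt_eqF.
have m0 : (0 < m)%N.
  rewrite lt0n; apply/eqP => m0; move: EM; rewrite m0 sqrtr0 mul0r leNgt.
  by rewrite sqrtr_gt0 sl0.
have r0 : 0 < r.
  apply: divr_gt0; first by apply: mulr_gt0 => //; exact: mulr_gt0.
  by rewrite mulr_gt0 ?sqrtr_gt0// mulr_gt0.
have [B [mB PB] good] := run_event run Cf1 mCf m0 s0 sd (norm2_delta (Ordinal d0)).
pose success := [set w | f (X K w) - minval f <= L / 2 * alpha ^+ 2 * (1 + rho) ^+ 2].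
have contf : continuous f by move=> z; exact: differentiable_continuous.
have ms : measurable success.
  have mX : measurable_fun setT (X K : Omega -> borel_rV R d).
    exact: (measurable_iterates (run_init run) (run_step run) (run_grad_measurable run)
      (leqnn K)).
  have mf := measurableT_comp (continuous_borel_measurable contf) mX.
  have mg : measurable_fun setT (fun w => f (X K w) - minval f).
    by apply: measurable_funB.
  have := measurable_fun_ler mg (measurable_cst (L / 2 * alpha ^+ 2 * (1 + rho) ^+ 2)).
  by move=> /(_ measurableT [set true]); rewrite setTI; apply.
have proj x := proj_argminP df x attained.
have sB : ~` B `<=` success.
  move=> w wB; pose D k := norm2 (X k w - proj_argmin f (X k w)).
  have feas k : (k < K)%N -> feasible s (G k w).
    by move=> kK; case: (run_grad_est run w kK).
  have next k : (k < K)%N ->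
      D k.+1 <= norm2 (X k w - alpha *: G k w - proj_argmin f (X k w)).
    move=> kK; have [pm _] := proj (X k w); have [_ /(_ _ pm)] := proj (X k.+1 w).
    by rewrite /D (run_step run w kK : X k.+1 w = X k w - alpha *: G k w).
  have DK : D K <= alpha * (1 + rho).
    apply: (descent_recursion (b := nu / (2 * L)) al0 eta0 etab b2) => [k|k kK|k kK far|].
    - exact: norm2_ge0.
    - have [_ g1] := feas k kK; have [pm _] := proj (X k w).
      exact: le_trans (next k kK) (step_le _ _ al0 g1).
    - have [_ g1] := feas k kK; have [pm _] := proj (X k w).
      have D0 : 0 < D k by apply: lt_le_trans far; rewrite mulr_gt0.
      have xa : X k w != proj_argmin f (X k w) by rewrite -subr_eq0 -norm2_gt0.
      have [Zu noise] := good w wB k kK.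
      apply: le_trans (step_sqr al0 g1 xa _).
        exact: (ler_pM (norm2_ge0 _) (norm2_ge0 _) (next k kK) (next k kK)).
      have rscx := rsc (X k w); rewrite (minval_argmin pm) in rscx.
      have [_ sparse] := fCG (X k w).
      have [_ gmax] := run_grad_est run w kK.
      apply: (estimate_direction (Q := Q) _ _ _ _ _ _ Cf1 mCf acc accuracy de0 df Lf L0 cf
        nu0 eta0 _ m0 r0 pm rscx xa sparse sd _ (feas k kK) _ noise EM).
      + exact: (measurable_unit_direction run).
      + by move=> i v; exact: (norm2_unitize (norm2_delta (Ordinal d0))).
      + by move=> i U A; exact: (unitize_invariant _ (run_direction_law run kK (ltn_ord i))).
      + by move=> i; exact: (run_seed_measurable run kK (ltn_ord i)).
      + by move=> i; exact: (run_seed_law run kK (ltn_ord i)).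
      + exact: (fresh_pair_independent (fresh_unit_directions run kK)).
      + by apply: le_trans b2; exact: ltW.
      + rewrite ler_pM2r ?invr_gt0 ?mulr_gt0 ?sqrtr_gt0//.
        have : alpha * rho * nu <= D k * nu by rewrite ler_pM2r.
        by rewrite mulrAC.
      + move=> h fh; have := gmax h fh.
        have e (h' : 'rV[R]_d) : \sum_(i < m) Cf (W k i w) (X k w) (X k w + r *: Z k i w) *
            dotv (Z k i w) h' = \sum_(i < m)
            dotv (response Cf r (X k w) ((unitize (delta_mx 0 (Ordinal d0)) \o Z k i) w) (W k i w)) h'.
          by apply: eq_bigr => i _; rewrite Zu /response dotvZl.
        by rewrite !e.
    - rewrite -/rho (_ : alpha * (nu / (2 * L) - eta) = alpha * nu / (2 * L) - alpha * eta).
        by rewrite /D (run_init run); exact: le_ceil_nat.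
      by rewrite mulrBr mulrA.
  have [pm _] := proj (X K w).
  suff : f (X K w) - minval f <= L / 2 * alpha ^+ 2 * (1 + rho) ^+ 2 by [].
  rewrite (minval_argmin pm); apply: le_trans (gap_le_argmin df Lf L0 (X K w) pm) _.
  rewrite [leRHS](_ : _ = L / 2 * (alpha * (1 + rho)) ^+ 2); last by ring.
  rewrite ler_pM2l ?divr_gt0// ler_sqr ?nnegrE ?norm2_ge0//.
  by rewrite mulr_ge0 ?ltW// addr_gt0.
have PsB : (1 - P B <= P success)%E.
  rewrite -probability_setC//; apply: le_measure; rewrite ?inE//.
  exact: measurableC.
apply: le_trans PsB; apply: (@le_trans _ _ (1 - (K%:R * expR (- (s * l)))%:E)%E).
  rewrite -EFinB lee_fin lerD2l lerN2 mulN1r.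
  have eta4 : eta ^+ 4 <= 1 by rewrite exprn_ile1//; lra.
  apply: (@le_trans _ _ (K%:R * expR (- eta ^+ 4 * s * l))).
    apply: ler_wpM2l => //; rewrite ler_expR -mulrA mulNr lerN2 ler_piMl// ltW//.
  rewrite ler_wpM2r ?expR_ge0// ler_peMl//; lra.
by rewrite leeB.
Qed.
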